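(* Let $0<\alpha<1$ and consider the problem described in the context with the latent heat $\ell$ unknown (Case 2), the data $k,\rho,c>0$, $T_m$, $T_0>T_m$, $q_0>0$ being given. If $$\frac{\sqrt{\rho c k}\,(T_0-T_m)}{q_0\,\Gamma\left(1-\frac{\alpha}{2}\right)}<1,$$ then the equation $$1-W\left(-x;-\frac{\alpha}{2},1\right)=\frac{\sqrt{\rho c k}\,(T_0-T_m)}{q_0\,\Gamma\left(1-\frac{\alpha}{2}\right)},\quad x>0,$$ has a unique solution $\xi_\alpha>0$, and the solution of Case 2 is given by $$\ell=\ell_\alpha=\frac{c(T_0-T_m)\,\Gamma\left(1-\frac{\alpha}{2}\right)}{\Gamma\left(1+\frac{\alpha}{2}\right)F_{4\alpha}(\xi_\alpha)},\qquad F_{4\alpha}(x)=\frac{x\left[1-W\left(-x;-\frac{\alpha}{2},1\right)\right]}{M_{\alpha/2}(x)},$$ $$T_\alpha(x,t)=T_0-\frac{T_0-T_m}{1-W\left(-\xi_\alpha;-\frac{\alpha}{2},1\right)}\left[1-W\left(-\frac{x}{\lambda_\alpha t^{\alpha/2}};-\frac{\alpha}{2},1\right)\right],\qquad s_\alpha(t)=\lambda\xi_\alpha t^{\alpha/2},$$ with $\lambda_\alpha^2=\lambda^2=\frac{k}{\rho c}$.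
   Context: For $0<\alpha<1$ the Caputo fractional derivative of a function $f$ of $t$ is $D^\alpha f(t)=\frac{1}{\Gamma(1-\alpha)}\int_0^t \frac{f'(\tau)}{(t-\tau)^\alpha}\,d\tau$, where $\Gamma$ is Euler's Gamma function. The Wright function is $W(z;a,b)=\sum_{n=0}^{\infty}\frac{z^n}{n!\,\Gamma(na+b)}$ for $z\in\mathbb{C}$, $a>-1$, $b\in\mathbb{R}$; the Mainardi function is $M_\nu(z)=W(-z;-\nu,1-\nu)$ for $\nu<1$. The problem: $\rho,k,c,\ell$ are positive constants (density, conductivity, specific heat, latent heat), $\lambda^2=k/(\rho c)$, $T_m$ is the melting temperature, $T_0>T_m$ and $q_0>0$ are constants. Find $x=s(t)$, $T=T(x,t)$ and the unknown coefficient such that: $D^\alpha T=\lambda^2 T_{xx}$ for $0<x<s(t)$, $t>0$ (Caputo derivative in $t$); $s(0)=0$; $T(x,0)=T(+\infty,t)=T_m$ for $x>0,t>0$; $T(s(t),t)=T_m$; $-kT_x(s(t),t)=\rho\ell\, D^\alpha s(t)$; $T(0,t)=T_0$; $kT_x(0,t)=-q_0/t^{\alpha/2}$, for all $t>0$.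
   Formalization: The formula T_α tends to T_0-(T_0-T_m)/(1-W(-ξ_α;-α/2,1)) < T_m as x→+∞, so T(x,0)=T(+∞,t)=T_m is required of the field equal to T_α for x<s(t) and to T_m for x≥s(t); all other conditions, including the Caputo equation, are required of the formula T_α itself. *)

(* Defs.v *)
From Stdlib Require Import Reals ZArith.
From Coquelicot Require Import Coquelicot.
Open Scope R_scope.

Definition Gamma (x : R) : R :=
  RInt_gen (fun t => Rpower t (x - 1) * exp (- t)) (at_right 0) (Rbar_locally p_infty).

Fixpoint poch (x : R) (n : nat) : R :=
  match n with
  | O => 1
  | S m => poch x m * (x + INR m)
  end.

(** Reciprocal Gamma 1/Gamma(x), extended to all reals in the standard way
    (entire function, = 0 at the poles 0,-1,-2,...):
    1/Gamma(x) = x(x+1)...(x+n-1) / Gamma(x+n) with n chosen so that x+n > 0. *)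
Definition rgamma (x : R) : R :=
  let n := Z.to_nat (up (- x)) in poch x n / Gamma (x + INR n).

Definition Wright (z a b : R) : R :=
  Series (fun n => z ^ n / INR (fact n) * rgamma (INR n * a + b)).

Definition Mainardi (nu z : R) : R := Wright (- z) (- nu) (1 - nu).

Definition tpow (t a : R) : R := if Rlt_dec 0 t then Rpower t a else 0.

Definition is_caputo (al : R) (f : R -> R) (t v : R) : Prop :=
  (forall tau, 0 < tau < t -> ex_derive f tau) /\
  is_RInt_gen (fun tau => / Gamma (1 - al) * (Derive f tau / Rpower (t - tau) al))
    (at_right 0) (at_left t) v.

(** The temperature on the whole quarter plane: the liquid-phase temperature T
    on 0 < x < s(t), and the melting temperature Tm in the solid x >= s(t). *)
Definition ext_temp (T : R -> R -> R) (s : R -> R) (Tm : R) (x t : R) : R :=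
  if Rlt_dec x (s t) then T x t else Tm.

Definition stefan_case2_solution (al rho k c ell Tm T0 q0 : R)
    (T : R -> R -> R) (s : R -> R) : Prop :=
  0 < ell /\
  (forall x t, 0 < t -> 0 < x < s t ->
     exists v w,
       is_caputo al (fun tau => T x tau) t v /\
       locally x (fun y => ex_derive (fun z => T z t) y) /\
       is_derive_n (fun y => T y t) 2 x w /\
       v = k / (rho * c) * w) /\
  s 0 = 0 /\
  (forall x, 0 < x -> ext_temp T s Tm x 0 = Tm) /\
  (forall t, 0 < t -> is_lim (fun x => ext_temp T s Tm x t) p_infty Tm) /\
  (forall t, 0 < t -> T (s t) t = Tm) /\
  (forall t, 0 < t -> exists d v,
     is_derive (fun x => T x t) (s t) d /\ is_caputo al s t v /\
     - k * d = rho * ell * v) /\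
  (forall t, 0 < t -> T 0 t = T0) /\
  (forall t, 0 < t -> exists d,
     is_derive (fun x => T x t) 0 d /\ k * d = - q0 / Rpower t (al / 2)).

(* Main.v *)
(* The profile g(z) = W(-z; -nu, 1), nu = al/2, has g' = -M_nu and g'' = W(-z; -nu, 1 - al).
   Both sides of the diffusion equation are represented by integrals of
   Im (s^c exp (t s - x s^nu)) along a ray s = r e^(i th), PI/2 < th < PI; the series of the
   Wright function is recovered from the reflection formula for Gamma.  The convolution with
   (t - tau)^(-al) is computed by writing this kernel as a Laplace integral in p, which
   produces the resolvent 1/(s + p): rotating the ray to the positive axis shows that the
   initial term vanishes, and integrating p^(al-1)/(s + p) over p gives the power s^(al-1).

   At a point where g is maximal on [z, oo), the fractional derivative in time of
   g(t^(-nu)) is bounded below by a positive multiple of g(z), which is incompatible with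
   g''(z) <= 0 unless g(z) <= 0.  This maximum principle yields g >= 0, then that g is
   nonincreasing, and finally M_nu > 0, because a zero of M_nu would force the entire
   function g to vanish on a half line.  Hence 1 - g increases strictly from 0 to 1, which
   determines xi; the remaining conditions of the Stefan problem are explicit. *)

(* The alternating series that defines [Wright] reveals neither signs nor the behaviour at infinity,
   hence the passage to ray integrals. There [nu < 1/2] is decisive: for every angle [th < PI] the
   real part of [s^nu] stays positive, so that for [z > 0] the factor [exp (- z s^nu)] makes the
   integrand decay uniformly in [t >= 0], down to [t = 0]. At [z = 0] the decay comes from
   [exp (t s)] instead, which asks for [th > PI / 2]. In the similarity variable, time 0 is [z = oo]
   and the past of a time is a half line [[z, oo)]. The maximum principle first bounds the
   fractional derivative below by a multiple of [g z - L], where [L] is the limit of [g] at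
   infinity, so [L = 0] has to be known before any sign can be deduced. It is read off at the other
   end, [z -> 0], where [g 0 = 1] and [g'' 0 = 1 / Gamma (1 - 2 nu)] are explicit. Strict positivity
   of [M_nu] serves twice: for the uniqueness of [xi], and for [ell > 0], since [M_nu xi] occurs as
   a divisor in [F4]. *)
Require Import Defs.
From Stdlib Require Import Reals Lra Lia Factorial.
From Coquelicot Require Import Coquelicot.
Open Scope R_scope.

(** * Integrals over the real line of exponentially dominated functions *)

(* Integrals over the half line are taken in the variable [x = ln r]; integrands bounded by
   powers [r^(-1 + d)] at 0 and [r^(-1 - d)] at infinity become functions dominated by
   [exp (- d |x|)]. *)
Definition is_RIntR (f : R -> R) (l : R) : Prop :=
  is_RInt_gen f (Rbar_locally m_infty) (Rbar_locally p_infty) l.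

Definition RIntR (f : R -> R) : R :=
  RInt_gen f (Rbar_locally m_infty) (Rbar_locally p_infty).

Definition exp_dominated (C d : R) (f : R -> R) : Prop :=
  forall x, Rabs (f x) <= C * exp (- (d * Rabs x)).

Lemma ex_RInt_cont (f : R -> R) (a b : R) :
  (forall x, continuous f x) -> ex_RInt f a b.
Proof. intros Hf; apply (ex_RInt_continuous (V := R_CompleteNormedModule)); auto. Qed.

Lemma exp_le_le (x y : R) : x <= y -> exp x <= exp y.
Proof.
  intros [H | ->]; [apply Rlt_le, exp_increasing, H | apply Rle_refl].
Qed.

Lemma is_RIntR_unique (f : R -> R) (l : R) : is_RIntR f l -> RIntR f = l.
Proof.
  intros H; exact (is_RInt_gen_unique (V := R_CompleteNormedModule) f l H).
Qed.

Lemma is_RIntR_intro (f : R -> R) (l : R) :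
  (forall x, continuous f x) ->
  (forall eps, 0 < eps -> exists N, forall a b, a < - N -> N < b ->
     Rabs (RInt f a b - l) < eps) ->
  is_RIntR f l.
Proof.
  intros Hf H P [eps HP].
  destruct (H eps (cond_pos eps)) as [N HN].
  apply Filter_prod with (Q := fun a => a < - N) (R := fun b => N < b).
  - exists (- N); auto.
  - exists N; auto.
  - intros a b Ha Hb; exists (RInt f a b); split.
    + apply (RInt_correct (V := R_CompleteNormedModule)); now apply ex_RInt_cont.
    + apply HP. apply HN; auto.
Qed.

Lemma is_RIntR_elim (f : R -> R) (l : R) :
  is_RIntR f l ->
  forall eps, 0 < eps -> exists N, forall a b, a < - N -> N < b ->
     Rabs (RInt f a b - l) < eps.
Proof.
  intros H eps He.
  destruct (H (ball l (mkposreal eps He)) (locally_ball _ _)) as [Q S [m Hm] [p Hp] HH].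
  exists (Rmax (- m) p); intros a b Ha Hb.
  assert (Ha' : a < m) by (pose proof (Rmax_l (- m) p); lra).
  assert (Hb' : p < b) by (pose proof (Rmax_r (- m) p); lra).
  destruct (HH a b (Hm _ Ha') (Hp _ Hb')) as [z [Hz Hball]].
  simpl in Hz; apply (is_RInt_unique (V := R_CompleteNormedModule)) in Hz; rewrite Hz.
  exact Hball.
Qed.

Lemma RInt_exp_bound (f : R -> R) (C d u v N : R) :
  (forall x, continuous f x) -> exp_dominated C d f ->
  0 < d -> 0 <= C -> 0 <= N ->
  (N <= u /\ u <= v) \/ (u <= v /\ v <= - N) ->
  Rabs (RInt f u v) <= C / d * exp (- (d * N)).
Proof.
  intros Hf Hd d0 C0 N0 Hcase.
  assert (Huv : u <= v) by lra.
  (* [s] is the sign of [x] on [[u, v]], so one primitive serves both half lines. *)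
  assert (Hint : forall s, s * s = 1 -> (forall x, u <= x <= v -> Rabs x = s * x) ->
     Rabs (RInt f u v) <= C / d * (s * (exp (- (d * (s * u))) - exp (- (d * (s * v)))))).
  { intros s s2 Hs.
    apply (norm_RInt_le f (fun x => C * exp (- (d * (s * x)))) u v); try lra.
    - intros x Hx; rewrite <- (Hs x Hx); apply Hd.
    - apply (RInt_correct (V := R_CompleteNormedModule)); now apply ex_RInt_cont.
    - assert (H : is_RInt (fun x => C * exp (- (d * (s * x)))) u v
        (- (C / d * s) * exp (- (d * (s * v))) - - (C / d * s) * exp (- (d * (s * u))))).
      { apply (is_RInt_derive (V := R_CompleteNormedModule)
          (fun x => - (C / d * s) * exp (- (d * (s * x))))).
        - intros x _; auto_derive; auto.
          transitivity (C * (s * s) * exp (- (d * (s * x)))); [field; lra | rewrite s2; ring].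
        - intros x _; apply (ex_derive_continuous (V := R_NormedModule)); auto_derive; auto. }
      replace (C / d * (s * (exp (- (d * (s * u))) - exp (- (d * (s * v))))))
        with (- (C / d * s) * exp (- (d * (s * v))) - - (C / d * s) * exp (- (d * (s * u))))
        by ring.
      exact H. }
  assert (HC : 0 <= C / d) by (apply Rmult_le_pos; [auto | apply Rlt_le, Rinv_0_lt_compat; auto]).
  destruct Hcase as [[H1 H2] | [H1 H2]].
  - eapply Rle_trans; [apply (Hint 1); [ring|] |].
    + intros x Hx; rewrite Rabs_pos_eq; lra.
    + apply Rmult_le_compat_l; auto.
      pose proof (exp_pos (- (d * (1 * v)))).
      assert (exp (- (d * (1 * u))) <= exp (- (d * N))); [| lra].
      apply exp_le_le; nra.
  - eapply Rle_trans; [apply (Hint (-1)); [ring|] |].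
    + intros x Hx; rewrite Rabs_left1; lra.
    + apply Rmult_le_compat_l; auto.
      pose proof (exp_pos (- (d * (-1 * u)))).
      assert (exp (- (d * (-1 * v))) <= exp (- (d * N))); [| lra].
      apply exp_le_le; nra.
Qed.

Lemma RInt_exp_bound_diff (f : R -> R) (C d N a b a' b' : R) :
  (forall x, continuous f x) -> exp_dominated C d f ->
  0 < d -> 0 <= C -> 0 <= N ->
  a <= - N -> a' <= - N -> N <= b -> N <= b' ->
  Rabs (RInt f a b - RInt f a' b') <= 2 * (C / d * exp (- (d * N))).
Proof.
  intros Hf Hd d0 C0 N0 H1 H2 H3 H4.
  assert (Hex : forall u v, ex_RInt f u v) by (intros; now apply ex_RInt_cont).
  assert (E1 : RInt f a b = RInt f a a' + (RInt f a' b' + RInt f b' b)).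
  { rewrite <- (RInt_Chasles f a a' b), <- (RInt_Chasles f a' b' b); auto. }
  rewrite E1.
  assert (B1 : Rabs (RInt f a a') <= C / d * exp (- (d * N))).
  { destruct (Rle_dec a a').
    - apply RInt_exp_bound; auto; lra.
    - rewrite <- (opp_RInt_swap (V := R_CompleteNormedModule)), Rabs_Ropp by auto.
      apply RInt_exp_bound; auto; lra. }
  assert (B2 : Rabs (RInt f b' b) <= C / d * exp (- (d * N))).
  { destruct (Rle_dec b' b).
    - apply RInt_exp_bound; auto; lra.
    - rewrite <- (opp_RInt_swap (V := R_CompleteNormedModule)), Rabs_Ropp by auto.
      apply RInt_exp_bound; auto; lra. }
  replace (RInt f a a' + (RInt f a' b' + RInt f b' b) - RInt f a' b')
    with (RInt f a a' + RInt f b' b) by ring.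
  eapply Rle_trans; [apply Rabs_triang | lra].
Qed.

Lemma exp_small (K d eps : R) : 0 < d -> 0 < eps -> exists N, 0 <= N /\ K * exp (- (d * N)) < eps.
Proof.
  intros d0 e0.
  pose proof (Rabs_pos K).
  (* With [y = |K| / eps], this [N] gives [d * N = y], and [exp y >= 1 + y] yields
     [|K| exp (- y) <= eps * y / (1 + y) < eps]. *)
  exists (Rabs K / (eps * d)); split.
  - apply Rmult_le_pos; [auto | apply Rlt_le, Rinv_0_lt_compat; nra].
  - set (y := Rabs K / eps).
    replace (d * (Rabs K / (eps * d))) with y by (unfold y; field; lra).
    assert (Hy : 0 <= y) by (unfold y; apply Rmult_le_pos; [auto | apply Rlt_le, Rinv_0_lt_compat; auto]).
    assert (Hey : 1 + y <= exp y) by apply exp_ineq1_le.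
    rewrite exp_Ropp.
    assert (K <= eps * y) by (unfold y; replace (eps * (Rabs K / eps)) with (Rabs K) by (field; lra); apply Rle_abs).
    apply (Rmult_lt_reg_r (exp y)); [apply exp_pos |].
    rewrite Rmult_assoc, Rinv_l, Rmult_1_r by (apply Rgt_not_eq, exp_pos).
    nra.
Qed.

Section Dominated.

Variables (f : R -> R) (C d : R).
Hypothesis Hf : forall x, continuous f x.
Hypothesis Hd : exp_dominated C d f.
Hypothesis d0 : 0 < d.

Lemma exp_dominated_pos : 0 <= C.
Proof.
  pose proof (Hd 0) as H; rewrite Rabs_R0, Rmult_0_r, Ropp_0, exp_0, Rmult_1_r in H.
  pose proof (Rabs_pos (f 0)); lra.
Qed.

Lemma is_RIntR_dominated : is_RIntR f (RIntR f).
Proof.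
  pose proof exp_dominated_pos as C0.
  assert (Hc : exists l, filterlim (fun ab => RInt f (fst ab) (snd ab))
     (filter_prod (Rbar_locally m_infty) (Rbar_locally p_infty)) (locally l)).
  { apply (filterlim_locally_cauchy (U := R_CompleteSpace)).
    intros eps.
    destruct (exp_small (2 * (C / d)) d eps d0 (cond_pos eps)) as [N [N0 HN]].
    exists (fun ab => fst ab < - N /\ N < snd ab); split.
    - apply Filter_prod with (Q := fun a => a < - N) (R := fun b => N < b).
      + exists (- N); auto.
      + exists N; auto.
      + auto.
    - intros [a b] [a' b'] [H1 H2] [H3 H4]; simpl in *.
      change (Rabs (RInt f a' b' - RInt f a b) < eps).
      eapply Rle_lt_trans; [apply (RInt_exp_bound_diff f C d N); auto; lra | lra]. }
  destruct Hc as [l Hl].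
  refine (RInt_gen_correct (V := R_CompleteNormedModule) f (ex_intro _ l _)).
  intros P HP; specialize (Hl P HP).
  unfold filtermap in Hl; unfold filtermapi.
  eapply filter_imp; [| exact Hl]; simpl.
  intros [a b] Hab; exists (RInt f a b); split; auto.
  apply (RInt_correct (V := R_CompleteNormedModule)); now apply ex_RInt_cont.
Qed.

Lemma RIntR_tail (N a b : R) : 0 <= N -> a <= - N -> N <= b ->
  Rabs (RIntR f - RInt f a b) <= 2 * (C / d * exp (- (d * N))).
Proof.
  intros N0 Ha Hb.
  apply Rle_plus_epsilon; intros eps e0.
  destruct (is_RIntR_elim f _ is_RIntR_dominated eps e0) as [M HM].
  set (a' := Rmin (- M) (- N) - 1). set (b' := Rmax M N + 1).
  pose proof (Rmin_l (- M) (- N)). pose proof (Rmin_r (- M) (- N)).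
  pose proof (Rmax_l M N). pose proof (Rmax_r M N).
  assert (H3 := HM a' b' ltac:(unfold a'; lra) ltac:(unfold b'; lra)).
  replace (RIntR f - RInt f a b) with (- (RInt f a' b' - RIntR f) + (RInt f a' b' - RInt f a b)) by ring.
  eapply Rle_trans; [apply Rabs_triang |]; rewrite Rabs_Ropp.
  assert (Rabs (RInt f a' b' - RInt f a b) <= 2 * (C / d * exp (- (d * N)))).
  { apply (RInt_exp_bound_diff f); auto using exp_dominated_pos; unfold a', b'; lra. }
  lra.
Qed.

Lemma RIntR_bound : Rabs (RIntR f) <= 2 * (C / d).
Proof.
  (* The tail estimate with the empty middle interval [[0, 0]] bounds the whole integral. *)
  pose proof (RIntR_tail 0 0 0 ltac:(lra) ltac:(lra) ltac:(lra)) as H.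
  rewrite RInt_point in H. unfold zero in H; simpl in H.
  rewrite Rminus_0_r, Rmult_0_r, Ropp_0, exp_0, Rmult_1_r in H; auto.
Qed.

End Dominated.

Lemma RIntR_ext (f g : R -> R) : (forall x, f x = g x) -> RIntR f = RIntR g.
Proof.
  intros H; unfold RIntR, RInt_gen; f_equal.
  apply FunctionalExtensionality.functional_extensionality in H; now rewrite H.
Qed.

Lemma is_RIntR_ext (f g : R -> R) (l : R) : (forall x, f x = g x) -> is_RIntR f l -> is_RIntR g l.
Proof.
  intros H; apply FunctionalExtensionality.functional_extensionality in H; now rewrite H.
Qed.

Lemma is_RIntR_plus (f g : R -> R) (lf lg : R) :
  is_RIntR f lf -> is_RIntR g lg -> is_RIntR (fun x => f x + g x) (lf + lg).
Proof. intros Hf Hg; exact (is_RInt_gen_plus (V := R_NormedModule) f g lf lg Hf Hg). Qed.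

Lemma is_RIntR_scal (f : R -> R) (k l : R) : is_RIntR f l -> is_RIntR (fun x => k * f x) (k * l).
Proof. intros Hf; exact (is_RInt_gen_scal (V := R_NormedModule) f k l Hf). Qed.

Lemma is_RIntR_minus (f g : R -> R) (lf lg : R) :
  is_RIntR f lf -> is_RIntR g lg -> is_RIntR (fun x => f x - g x) (lf - lg).
Proof. intros Hf Hg; exact (is_RInt_gen_minus (V := R_NormedModule) f g lf lg Hf Hg). Qed.

Lemma is_RIntR_unique2 (f : R -> R) (l l' : R) : is_RIntR f l -> is_RIntR f l' -> l = l'.
Proof. intros H H'; apply is_RIntR_unique in H, H'; congruence. Qed.

Lemma is_RIntR_le (f g : R -> R) (lf lg : R) :
  (forall x, continuous f x) -> (forall x, continuous g x) ->
  (forall x, f x <= g x) -> is_RIntR f lf -> is_RIntR g lg -> lf <= lg.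
Proof.
  intros Cf Cg H Hf Hg.
  apply Rle_plus_epsilon; intros eps e0.
  destruct (is_RIntR_elim f _ Hf (eps / 2) ltac:(lra)) as [N1 HN1].
  destruct (is_RIntR_elim g _ Hg (eps / 2) ltac:(lra)) as [N2 HN2].
  set (b := Rmax 0 (Rmax N1 N2) + 1).
  pose proof (Rmax_l 0 (Rmax N1 N2)). pose proof (Rmax_r 0 (Rmax N1 N2)).
  pose proof (Rmax_l N1 N2). pose proof (Rmax_r N1 N2).
  specialize (HN1 (- b) b ltac:(unfold b; lra) ltac:(unfold b; lra)).
  specialize (HN2 (- b) b ltac:(unfold b; lra) ltac:(unfold b; lra)).
  assert (RInt f (- b) b <= RInt g (- b) b).
  { apply RInt_le; [unfold b; lra | now apply ex_RInt_cont | now apply ex_RInt_cont | auto]. }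
  apply Rabs_def2 in HN1; apply Rabs_def2 in HN2; lra.
Qed.

Lemma is_RIntR_shift (f : R -> R) (h l : R) :
  (forall x, continuous f x) -> is_RIntR f l -> is_RIntR (fun x => f (x + h)) l.
Proof.
  intros Cf Hf; apply is_RIntR_intro.
  - intros x. apply (continuous_comp (fun x => x + h) f); auto.
    apply (continuous_plus (V := R_NormedModule) (fun x => x) (fun _ => h));
      [apply continuous_id | apply continuous_const].
  - intros eps e0; destruct (is_RIntR_elim f _ Hf eps e0) as [N HN].
    exists (N + Rabs h); intros a b Ha Hb.
    pose proof (Rle_abs h). pose proof (Rle_abs (- h)). rewrite Rabs_Ropp in *.
    replace (RInt (fun x => f (x + h)) a b) with (RInt f (a + h) (b + h)).
    + apply HN; lra.
    + replace (a + h) with (1 * a + h) by ring. replace (b + h) with (1 * b + h) by ring.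
      rewrite <- (RInt_comp_lin (V := R_CompleteNormedModule) f 1 h a b) by now apply ex_RInt_cont.
      apply (RInt_ext (V := R_CompleteNormedModule)); intros x _.
      unfold scal; simpl; unfold mult; simpl. rewrite !Rmult_1_l; auto.
Qed.

Lemma is_RIntR_derive (F f : R -> R) (lm lp : R) :
  (forall x, is_derive F x (f x)) -> (forall x, continuous f x) ->
  is_lim F m_infty lm -> is_lim F p_infty lp -> is_RIntR f (lp - lm).
Proof.
  intros HF Cf Lm Lp.
  apply is_RIntR_intro; auto; intros eps e0.
  assert (e2 : 0 < eps / 2) by lra.
  destruct (Lm (ball lm (mkposreal _ e2)) (locally_ball _ _)) as [M1 H1].
  destruct (Lp (ball lp (mkposreal _ e2)) (locally_ball _ _)) as [M2 H2].
  exists (Rmax (- M1) M2); intros a b Ha Hb.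
  pose proof (Rmax_l (- M1) M2). pose proof (Rmax_r (- M1) M2).
  specialize (H1 a ltac:(lra)). specialize (H2 b ltac:(lra)).
  change (Rabs (F a - lm) < eps / 2) in H1. change (Rabs (F b - lp) < eps / 2) in H2.
  rewrite (is_RInt_unique f a b (F b - F a)).
  - apply Rabs_def2 in H1; apply Rabs_def2 in H2; apply Rabs_def1; lra.
  - apply (is_RInt_derive (V := R_CompleteNormedModule)); auto.
Qed.

(** Dominated convergence: the common bound makes all tails small at once, and uniform convergence
    on compact intervals controls the middle. The filter is arbitrary because limits at a point, at
    the right of 0 and at the left of [t] all occur later. *)
Lemma RIntR_lim {T : Type} (F : (T -> Prop) -> Prop) {FF : Filter F} (g : T -> R -> R)
  (g0 : R -> R) (C d : R) :
  0 < d -> F (fun t => exp_dominated C d (g t)) -> exp_dominated C d g0 ->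
  (forall t x, continuous (g t) x) -> (forall x, continuous g0 x) ->
  (forall N eps, 0 < N -> 0 < eps ->
     F (fun t => forall x, - N <= x <= N -> Rabs (g t x - g0 x) <= eps)) ->
  filterlim (fun t => RIntR (g t)) F (locally (RIntR g0)).
Proof.
  intros d0 HD HD0 Cg Cg0 Hu.
  pose proof (exp_dominated_pos g0 C d HD0) as C0.
  apply filterlim_locally; intros eps.
  assert (e4 : 0 < eps / 4) by (destruct eps; simpl; lra).
  destruct (exp_small (2 * (C / d)) d (eps / 4) d0 e4) as [N1 [N10 HN1]].
  set (N := N1 + 1). assert (N0 : 0 < N) by (unfold N; lra).
  assert (HN : 2 * (C / d * exp (- (d * N))) < eps / 4).
  { eapply Rle_lt_trans; [| exact HN1]. rewrite <- Rmult_assoc.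
    apply Rmult_le_compat_l.
    - apply Rmult_le_pos; [lra |]. apply Rmult_le_pos; [auto | apply Rlt_le, Rinv_0_lt_compat; auto].
    - apply exp_le_le; unfold N; nra. }
  (* Over an interval of length [2 * N] this contributes [eps / 4], as much as each of the two
     tails. *)
  assert (e8 : 0 < eps / (8 * N)).
  { apply Rmult_lt_0_compat; [apply cond_pos | apply Rinv_0_lt_compat; lra]. }
  generalize (filter_and _ _ HD (Hu N _ N0 e8)); apply filter_imp.
  intros t [Ht1 Ht2].
  change (Rabs (RIntR (g t) - RIntR g0) < eps).
  pose proof (RIntR_tail (g t) C d (Cg t) Ht1 d0 N (- N) N ltac:(lra) ltac:(lra) ltac:(lra)) as T1.
  pose proof (RIntR_tail g0 C d Cg0 HD0 d0 N (- N) N ltac:(lra) ltac:(lra) ltac:(lra)) as T2.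
  assert (T3 : Rabs (RInt (g t) (- N) N - RInt g0 (- N) N) <= eps / 4).
  { rewrite <- (RInt_minus (V := R_CompleteNormedModule)) by now apply ex_RInt_cont.
    replace (eps / 4) with ((N - - N) * (eps / (8 * N))) by (field; lra).
    apply (norm_RInt_le_const (V := R_NormedModule)
       (fun x => minus (g t x) (g0 x)) (- N) N); [lra | exact Ht2 |].
    apply (RInt_correct (V := R_CompleteNormedModule)).
    apply (ex_RInt_minus (V := R_NormedModule)); now apply ex_RInt_cont. }
  apply Rabs_def1; apply Rabs_le_between in T1; apply Rabs_le_between in T2;
    apply Rabs_le_between in T3; destruct eps; simpl in *; lra.
Qed.

Lemma at_right_near (a M : R) : a < M -> at_right a (fun u => a < u < M).
Proof.
  intros H; exists (mkposreal (M - a) (proj2 (Rlt_0_minus _ _) H)); intros u Hu Pu; split; auto.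
  apply Rabs_def2 in Hu; unfold minus, plus, opp in Hu; simpl in Hu; lra.
Qed.

Lemma at_left_near (b M : R) : M < b -> at_left b (fun u => M < u < b).
Proof.
  intros H; exists (mkposreal (b - M) (proj2 (Rlt_0_minus _ _) H)); intros u Hu Pu; split; auto.
  apply Rabs_def2 in Hu; unfold minus, plus, opp in Hu; simpl in Hu; lra.
Qed.

(** * Integrals depending on a parameter, and exchange of integrations *)

Definition cont_strip (F : R -> R -> R) (lo hi : R) : Prop :=
  forall x y, lo < y < hi -> continuity_2d_pt F x y.

Lemma continuity_2d_pt_l (F : R -> R -> R) (x y : R) :
  continuity_2d_pt F x y -> continuous (fun u => F u y) x.
Proof.
  intros H; apply filterlim_locally; intros eps.
  destruct (H eps) as [delta Hd]; exists delta; intros u Hu.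
  apply (Hd u y); [exact Hu | rewrite Rminus_diag, Rabs_R0; apply cond_pos].
Qed.

Lemma continuity_2d_pt_r (F : R -> R -> R) (x y : R) :
  continuity_2d_pt F x y -> continuous (F x) y.
Proof.
  intros H; apply filterlim_locally; intros eps.
  destruct (H eps) as [delta Hd]; exists delta; intros v Hv.
  apply (Hd x v); [rewrite Rminus_diag, Rabs_R0; apply cond_pos | exact Hv].
Qed.

Section Param.

Variables (F : R -> R -> R) (lo hi : R).
Hypothesis HF : cont_strip F lo hi.

Lemma cont_strip_unif (a b y : R) : lo < y < hi -> forall eps, 0 < eps ->
  locally y (fun v => forall x, a <= x <= b -> Rabs (F x v - F x y) <= eps).
Proof.
  intros Hy eps e0.
  destruct (uniform_continuity_2d_1d F a b y (fun x _ => HF x y Hy) (mkposreal eps e0))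
    as [delta Hd].
  exists delta; intros v Hv x Hx.
  apply Rlt_le, (Hd x y x v); auto.
  - destruct delta; simpl; lra.
  - apply Rabs_def2 in Hv; unfold minus, plus, opp in Hv; simpl in Hv; lra.
  - rewrite Rminus_diag, Rabs_R0; apply cond_pos.
Qed.

Lemma locally_between (y : R) : lo < y < hi -> locally y (fun v => lo < v < hi).
Proof.
  intros Hy; apply filter_and;
    [apply (open_gt lo) | apply (open_lt hi)]; lra.
Qed.

Lemma cont_strip_RInt (a b y : R) : lo < y < hi ->
  continuous (fun v => RInt (fun x => F x v) a b) y.
Proof.
  intros Hy.
  assert (Hab : forall a b, a <= b -> continuous (fun v => RInt (fun x => F x v) a b) y).
  { clear a b; intros a b Hab.
    apply filterlim_locally; intros eps.
    set (e := eps / (2 * (b - a + 1))).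
    assert (e0 : 0 < e).
    { unfold e; apply Rmult_lt_0_compat; [apply cond_pos | apply Rinv_0_lt_compat; lra]. }
    generalize (filter_and _ _ (locally_between y Hy) (cont_strip_unif a b y Hy e e0)).
    apply filter_imp; intros v [Hv1 Hv2].
    assert (Hex : forall v, lo < v < hi -> ex_RInt (fun x => F x v) a b).
    { intros w Hw; apply ex_RInt_cont; intros x; apply (continuity_2d_pt_l F x w); auto. }
    change (Rabs (RInt (fun x => F x v) a b - RInt (fun x => F x y) a b) < eps).
    rewrite <- (RInt_minus (V := R_CompleteNormedModule)) by auto.
    eapply Rle_lt_trans.
    - apply (norm_RInt_le_const (V := R_NormedModule)
        (fun x => minus (F x v) (F x y)) a b _ e); [lra | exact Hv2 |].
      apply (RInt_correct (V := R_CompleteNormedModule)).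
      apply (ex_RInt_minus (V := R_NormedModule)); auto.
    - assert (Ee : e * (b - a + 1) = eps / 2) by (unfold e; field; lra).
      pose proof (cond_pos eps); nra. }
  destruct (Rle_dec a b); [auto |].
  apply continuous_ext_loc with (g := fun v => opp (RInt (fun x => F x v) b a)).
  - generalize (locally_between y Hy); apply filter_imp; intros v Hv.
    apply (opp_RInt_swap (V := R_CompleteNormedModule)).
    apply ex_RInt_cont; intros x; apply (continuity_2d_pt_l F x v); auto.
  - apply (continuous_opp (V := R_NormedModule)), Hab; lra.
Qed.

Lemma cont_strip_RInt_r (a b x : R) : lo < a -> a <= b -> b < hi ->
  continuous (fun u => RInt (F u) a b) x.
Proof.
  intros Ha Hab Hb; apply filterlim_locally; intros eps.
  set (e := eps / (2 * (b - a + 1))).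
  assert (e0 : 0 < e).
  { unfold e; apply Rmult_lt_0_compat; [apply cond_pos | apply Rinv_0_lt_compat; lra]. }
  destruct (uniform_continuity_2d_1d' F a b x
    (fun y Hy => HF x y ltac:(lra)) (mkposreal e e0)) as [delta Hdel].
  exists delta; intros u Hu.
  assert (Hex : forall u, ex_RInt (F u) a b).
  { intros w; apply (ex_RInt_continuous (V := R_CompleteNormedModule)).
    intros y Hy; rewrite Rmin_left, Rmax_right in Hy by lra; apply continuity_2d_pt_r, HF; lra. }
  change (Rabs (RInt (F u) a b - RInt (F x) a b) < eps).
  rewrite <- (RInt_minus (V := R_CompleteNormedModule)) by auto.
  eapply Rle_lt_trans.
  - apply (norm_RInt_le_const (V := R_NormedModule)
      (fun y => minus (F u y) (F x y)) a b _ e); [lra | |].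
    + intros y Hy; apply Rlt_le, (Hdel y x y u); auto.
      * destruct delta; simpl; lra.
      * apply Rabs_def2 in Hu; unfold minus, plus, opp in Hu; simpl in Hu; lra.
      * rewrite Rminus_diag, Rabs_R0; apply cond_pos.
    + apply (RInt_correct (V := R_CompleteNormedModule)).
      apply (ex_RInt_minus (V := R_NormedModule)); auto.
  - assert (Ee : e * (b - a + 1) = eps / 2) by (unfold e; field; lra).
    pose proof (cond_pos eps); nra.
Qed.

(** As a function of the upper limit [X] of the inner integral, the right side has derivative
    [RInt (F X) c d] by differentiation under the integral sign; the fundamental theorem then
    rebuilds the left side. *)
Lemma RInt_Fubini (a b c d : R) : a <= b -> lo < c -> c <= d -> d < hi ->
  RInt (fun x => RInt (fun y => F x y) c d) a b
  = RInt (fun y => RInt (fun x => F x y) a b) c d.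
Proof.
  intros Hab Hc Hcd Hdh.
  assert (Cx : forall y, lo < y < hi -> forall x, continuous (fun u => F u y) x)
    by (intros y Hy x; apply continuity_2d_pt_l; auto).
  assert (Cy : forall x y, lo < y < hi -> continuous (F x) y)
    by (intros x y Hy; apply continuity_2d_pt_r; auto).
  assert (DG : forall X y, lo < y < hi -> is_derive (fun X => RInt (fun x => F x y) a X) X (F X y)).
  { intros X y Hy.
    apply (is_derive_RInt (V := R_CompleteNormedModule) (fun x => F x y) _ a).
    - apply filter_forall; intros z; apply (RInt_correct (V := R_CompleteNormedModule)).
      apply ex_RInt_cont; auto.
    - auto. }
  assert (D1 : forall X, is_derive (fun X => RInt (fun y => RInt (fun x => F x y) a X) c d) X
      (RInt (fun y => F X y) c d)).
  { intros X.
    assert (E : forall y, lo < y < hi ->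
       Derive (fun u => RInt (fun x => F x y) a u) X = F X y)
      by (intros; apply is_derive_unique; auto).
    replace (RInt (fun y => F X y) c d)
      with (RInt (fun t => Derive (fun u => RInt (fun x => F x t) a u) X) c d).
    - apply (is_derive_RInt_param (fun u t => RInt (fun x => F x t) a u) c d X).
      + apply filter_forall; intros z t Ht; eexists; apply DG.
        rewrite Rmin_left, Rmax_right in Ht; lra.
      + intros t Ht; rewrite Rmin_left, Rmax_right in Ht by lra.
        apply continuity_2d_pt_ext_loc with (f := F); [| apply HF; lra].
        assert (Hth : lo < t < hi) by lra.
        destruct (locally_between t Hth) as [delta Hdel].
        exists delta; intros u v _ Hv; symmetry; apply is_derive_unique, DG, Hdel, Hv.
      + apply filter_forall; intros z.
        apply (ex_RInt_continuous (V := R_CompleteNormedModule)).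
        intros y Hy; rewrite Rmin_left, Rmax_right in Hy by lra.
        apply cont_strip_RInt; lra.
    - apply (RInt_ext (V := R_CompleteNormedModule)); intros y Hy.
      rewrite Rmin_left, Rmax_right in Hy by lra. apply E; lra. }
  assert (I : is_RInt (fun X => RInt (fun y => F X y) c d) a b
     (minus (RInt (fun y => RInt (fun x => F x y) a b) c d)
            (RInt (fun y => RInt (fun x => F x y) a a) c d))).
  { apply (is_RInt_derive (V := R_CompleteNormedModule)
      (fun X => RInt (fun y => RInt (fun x => F x y) a X) c d)).
    - intros X _; apply D1.
    - intros X _; apply cont_strip_RInt_r; lra. }
  apply is_RInt_unique in I; rewrite I.
  rewrite (RInt_ext (V := R_CompleteNormedModule) (fun y => RInt (fun x => F x y) a a) (fun _ => 0) c d).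
  - rewrite (RInt_const (V := R_CompleteNormedModule)).
    unfold minus, plus, opp, scal; simpl; unfold mult; simpl; ring.
  - intros y _; apply (RInt_point (V := R_CompleteNormedModule)).
Qed.

Lemma cont_strip_RIntR (C d y : R) : lo < y < hi -> 0 < d ->
  (forall v, lo < v < hi -> exp_dominated C d (fun x => F x v)) ->
  continuous (fun v => RIntR (fun x => F x v)) y.
Proof.
  intros Hy d0 HD.
  (* outside the strip nothing is known on [F], hence the truncation *)
  set (g := fun v x => if Rlt_dec lo v then if Rlt_dec v hi then F x v else 0 else 0).
  assert (Eg : forall v, lo < v < hi -> g v = fun x => F x v).
  { intros v Hv; unfold g; destruct (Rlt_dec lo v); [| lra]. destruct (Rlt_dec v hi); [auto | lra]. }
  apply continuous_ext_loc with (g := fun v => RIntR (g v)).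
  - generalize (locally_between y Hy); apply filter_imp; intros v Hv; now rewrite Eg.
  - unfold continuous.
    apply (RIntR_lim (locally y) g (g y) C d); auto.
    + generalize (locally_between y Hy); apply filter_imp; intros v Hv; rewrite Eg; auto.
    + rewrite Eg; auto.
    + intros v x; unfold g; destruct (Rlt_dec lo v); [| apply continuous_const].
      destruct (Rlt_dec v hi); [| apply continuous_const].
      apply (continuity_2d_pt_l F x v); auto.
    + rewrite Eg by auto; intros x; apply (continuity_2d_pt_l F x y); auto.
    + intros N eps N0 e0.
      generalize (filter_and _ _ (locally_between y Hy) (cont_strip_unif (- N) N y Hy eps e0)).
      apply filter_imp; intros v [Hv1 Hv2]; rewrite !Eg by auto; auto.
Qed.

(** The exchange is already known over [[u, v]]; the tails outside it are bounded uniformly in the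
    parameter [y], which ranges over a bounded interval. *)
Lemma RIntR_RInt_Fubini (C d a b : R) : 0 < d -> lo < a -> a <= b -> b < hi ->
  (forall v, lo < v < hi -> exp_dominated C d (fun x => F x v)) ->
  is_RIntR (fun x => RInt (fun y => F x y) a b) (RInt (fun y => RIntR (fun x => F x y)) a b).
Proof.
  intros d0 Ha Hab Hb HD.
  assert (Cx : forall y, lo < y < hi -> forall x, continuous (fun u => F u y) x)
    by (intros y Hy x; apply continuity_2d_pt_l; auto).
  assert (C0 : 0 <= C).
  { apply (exp_dominated_pos (fun x => F x a) C d), HD; lra. }
  apply is_RIntR_intro.
  - intros x; apply cont_strip_RInt_r; lra.
  - intros eps e0.
    destruct (exp_small (2 * (C / d) * (b - a + 1)) d eps d0 e0) as [N [N0 HN]].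
    exists N; intros u v Hu Hv.
    rewrite RInt_Fubini by lra.
    assert (Hex1 : ex_RInt (fun y => RInt (fun x => F x y) u v) a b).
    { apply (ex_RInt_continuous (V := R_CompleteNormedModule)).
      intros y Hy; rewrite Rmin_left, Rmax_right in Hy by lra; apply cont_strip_RInt; lra. }
    assert (Hex2 : ex_RInt (fun y => RIntR (fun x => F x y)) a b).
    { apply (ex_RInt_continuous (V := R_CompleteNormedModule)).
      intros y Hy; rewrite Rmin_left, Rmax_right in Hy by lra.
      apply cont_strip_RIntR with (C := C) (d := d); auto; lra. }
    rewrite <- (RInt_minus (V := R_CompleteNormedModule)) by auto.
    eapply Rle_lt_trans.
    + apply (norm_RInt_le_const (V := R_NormedModule)
        (fun y => minus (RInt (fun x => F x y) u v) (RIntR (fun x => F x y))) a b _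
        (2 * (C / d * exp (- (d * N))))); [lra | |].
      * intros y Hy.
        change (Rabs (RInt (fun x => F x y) u v - RIntR (fun x => F x y))
                <= 2 * (C / d * exp (- (d * N)))).
        rewrite Rabs_minus_sym; apply RIntR_tail; auto; try lra.
        -- apply Cx; lra.
        -- apply HD; lra.
      * apply (RInt_correct (V := R_CompleteNormedModule)).
        apply (ex_RInt_minus (V := R_NormedModule)); auto.
    + eapply Rle_lt_trans; [| exact HN].
      assert (0 <= C / d * exp (- (d * N))).
      { apply Rmult_le_pos; [| apply Rlt_le, exp_pos].
        apply Rmult_le_pos; [auto | apply Rlt_le, Rinv_0_lt_compat; auto]. }
      nra.
Qed.

End Param.

(** * Fubini and contour rotation in logarithmic polar coordinates *)

Lemma continuity_2d_pt_exp (g : R -> R -> R) x y :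
  continuity_2d_pt g x y -> continuity_2d_pt (fun u v => exp (g u v)) x y.
Proof. intros H; apply continuity_1d_2d_pt_comp; auto; apply derivable_continuous_pt, derivable_pt_exp. Qed.

Lemma continuity_2d_pt_sin (g : R -> R -> R) x y :
  continuity_2d_pt g x y -> continuity_2d_pt (fun u v => sin (g u v)) x y.
Proof. intros H; apply continuity_1d_2d_pt_comp; auto; apply continuity_sin. Qed.

Lemma continuity_2d_pt_cos (g : R -> R -> R) x y :
  continuity_2d_pt g x y -> continuity_2d_pt (fun u v => cos (g u v)) x y.
Proof. intros H; apply continuity_1d_2d_pt_comp; auto; apply continuity_cos. Qed.

Lemma continuity_2d_pt_swap (F : R -> R -> R) x y :
  continuity_2d_pt F x y -> continuity_2d_pt (fun u v => F v u) y x.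
Proof.
  intros H eps; destruct (H eps) as [delta Hd]; exists delta; intros u v Hu Hv; auto.
Qed.

Ltac cont_2d := repeat first
  [ apply continuity_2d_pt_const | apply continuity_2d_pt_id1 | apply continuity_2d_pt_id2
  | apply continuity_2d_pt_exp | apply continuity_2d_pt_sin | apply continuity_2d_pt_cos
  | apply continuity_2d_pt_plus | apply continuity_2d_pt_minus
  | apply continuity_2d_pt_opp | apply continuity_2d_pt_mult ].

Ltac cont_1d := apply (ex_derive_continuous (V := R_NormedModule)); auto_derive; auto.

Lemma cont_strip_all (F : R -> R -> R) : (forall x y, continuity_2d_pt F x y) ->
  forall lo hi, cont_strip F lo hi.
Proof. intros H lo hi x y _; auto. Qed.

(** Only the [y]-integral is truncated. For each [x] the part cut off is at most a small factor
    times [exp (- d |x|)], so that it remains small after integration over [x]. *)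
Lemma RIntR_RIntR_Fubini (F : R -> R -> R) (K d : R) : 0 < d ->
  (forall x y, continuity_2d_pt F x y) ->
  (forall x y, Rabs (F x y) <= K * exp (- (d * Rabs x)) * exp (- (d * Rabs y))) ->
  is_RIntR (fun y => RIntR (fun x => F x y)) (RIntR (fun x => RIntR (fun y => F x y))).
Proof.
  intros d0 HF HD.
  assert (K0 : 0 <= K).
  { pose proof (HD 0 0) as H; rewrite Rabs_R0, Rmult_0_r, Ropp_0, exp_0 in H.
    pose proof (Rabs_pos (F 0 0)); lra. }
  assert (e1 : forall x, exp (- (d * Rabs x)) <= 1).
  { intros x; rewrite <- exp_0; apply exp_le_le; pose proof (Rabs_pos x); nra. }
  assert (D1 : forall y, exp_dominated K d (fun x => F x y)).
  { intros y x; eapply Rle_trans; [apply HD |].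
    pose proof (e1 y). pose proof (exp_pos (- (d * Rabs x))).
    assert (0 <= K * exp (- (d * Rabs x))) by nra. nra. }
  assert (D2 : forall x, exp_dominated (K * exp (- (d * Rabs x))) d (F x)).
  { intros x y; apply HD. }
  assert (D3 : forall x, exp_dominated K d (F x)).
  { intros x y; eapply Rle_trans; [apply HD |].
    pose proof (e1 x). pose proof (exp_pos (- (d * Rabs y))).
    assert (K * exp (- (d * Rabs x)) <= K) by nra. nra. }
  assert (C1 : forall y, continuous (fun y => RIntR (fun x => F x y)) y).
  { intros y; apply (cont_strip_RIntR F (y - 1) (y + 1) (cont_strip_all F HF _ _) K d); auto; lra. }
  assert (C2 : forall x, continuous (fun x => RIntR (fun y => F x y)) x).
  { intros x; apply (cont_strip_RIntR (fun y x => F x y) (x - 1) (x + 1)) with (C := K) (d := d); auto; [|lra].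
    intros u v _; apply continuity_2d_pt_swap; auto. }
  assert (Kd : 0 <= K / d) by (apply Rmult_le_pos; [auto | apply Rlt_le, Rinv_0_lt_compat; auto]).
  assert (D4 : exp_dominated (2 * (K / d)) d (fun x => RIntR (F x))).
  { intros x; eapply Rle_trans; [apply (RIntR_bound (F x) _ d (fun y => continuity_2d_pt_r F x y (HF x y)) (D2 x) d0) |].
    apply Req_le; field; lra. }
  apply is_RIntR_intro; auto; intros eps e0.
  destruct (exp_small (2 * (2 * (K / d) / d)) d eps d0 e0) as [N [N0 HN]].
  exists N; intros a b Ha Hb.
  assert (I1 := RIntR_RInt_Fubini F (a - 1) (b + 1) (cont_strip_all F HF _ _) K d a b d0
    ltac:(lra) ltac:(lra) ltac:(lra) (fun v _ => D1 v)).
  assert (I2 := is_RIntR_dominated (fun x => RIntR (F x)) _ d C2 D4 d0).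
  assert (I3 := is_RIntR_minus _ _ _ _ I1 I2).
  apply is_RIntR_unique in I3; simpl in I3.
  eapply Rle_lt_trans; [| exact HN].
  match type of I3 with _ = ?r => change (Rabs r <= 2 * (2 * (K / d) / d) * exp (- (d * N))) end.
  rewrite <- I3.
  replace (2 * (2 * (K / d) / d) * exp (- (d * N)))
    with (2 * (2 * (K / d) * exp (- (d * N)) / d)) by (field; lra).
  apply RIntR_bound; auto.
  - intros x. apply (continuous_minus (V := R_NormedModule) (fun x => RInt (fun y => F x y) a b)).
    + apply (cont_strip_RInt (fun y x => F x y) (x - 1) (x + 1)); [| lra].
      intros u v _; apply continuity_2d_pt_swap; auto.
    + apply C2.
  - intros x.
    rewrite Rabs_minus_sym.
    eapply Rle_trans; [apply (RIntR_tail (F x) _ d (fun y => continuity_2d_pt_r F x y (HF x y)) (D2 x) d0 N); lra |].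
    apply Req_le; field; lra.
Qed.

(** [D] being both the [x]-derivative of [A] and the [y]-derivative of [B] is a Cauchy-Riemann
    equation. Integrating [D] over the rectangle [[-N, N] x [y1, y2]] in both orders expresses the
    difference of the two horizontal integrals through the vertical sides, which vanish as [N]
    grows. *)
Lemma RIntR_rotation_real (A B D : R -> R -> R) (lo hi K d y1 y2 : R) :
  0 < d -> lo < y1 -> y1 <= y2 -> y2 < hi ->
  (forall x y, lo < y < hi -> is_derive (fun u => A u y) x (D x y)) ->
  (forall x y, lo < y < hi -> is_derive (fun v => B x v) y (D x y)) ->
  cont_strip D lo hi ->
  (forall x y, lo < y < hi -> continuous (fun u => B u y) x) ->
  (forall y, lo < y < hi -> exp_dominated K d (fun x => A x y)) ->
  (forall y, lo < y < hi -> exp_dominated K d (fun x => B x y)) ->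
  RIntR (fun x => B x y1) = RIntR (fun x => B x y2).
Proof.
  intros d0 H1 H12 H2 DA DB HD CB KA KB.
  assert (Hy1 : lo < y1 < hi) by lra. assert (Hy2 : lo < y2 < hi) by lra.
  assert (K0 : 0 <= K) by apply (exp_dominated_pos _ _ _ (KA y1 Hy1)).
  assert (I : is_RIntR (fun x => B x y2 - B x y1)
      (RIntR (fun x => B x y2) - RIntR (fun x => B x y1))).
  { exact (is_RIntR_minus _ _ _ _
    (is_RIntR_dominated _ K d (fun x => CB x y2 Hy2) (KB y2 Hy2) d0)
    (is_RIntR_dominated _ K d (fun x => CB x y1 Hy1) (KB y1 Hy1) d0)). }
  apply eq_sym, Rminus_diag_uniq.
  apply cond_eq; intros eps e0; rewrite Rminus_0_r.
  destruct (is_RIntR_elim _ _ I (eps / 2) ltac:(lra)) as [N1 HN1].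
  destruct (exp_small (2 * K * (y2 - y1)) d (eps / 2) d0 ltac:(lra)) as [N2 [N20 HN2]].
  set (N := Rmax N1 N2 + 1).
  pose proof (Rmax_l N1 N2). pose proof (Rmax_r N1 N2).
  specialize (HN1 (- N) N ltac:(unfold N; lra) ltac:(unfold N; lra)).
  assert (E : RInt (fun x => B x y2 - B x y1) (- N) N
     = RInt (fun y => A N y - A (- N) y) y1 y2).
  { transitivity (RInt (fun x => RInt (fun y => D x y) y1 y2) (- N) N).
    - apply (RInt_ext (V := R_CompleteNormedModule)); intros x _; symmetry.
      apply is_RInt_unique, (is_RInt_derive (V := R_CompleteNormedModule) (fun v => B x v)).
      + intros y Hy; rewrite Rmin_left, Rmax_right in Hy by lra; apply DB; lra.
      + intros y Hy; rewrite Rmin_left, Rmax_right in Hy by lra.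
        apply continuity_2d_pt_r, HD; lra.
    - rewrite (RInt_Fubini D lo hi) by (auto; unfold N; lra).
      apply (RInt_ext (V := R_CompleteNormedModule)); intros y Hy.
      rewrite Rmin_left, Rmax_right in Hy by lra.
      apply is_RInt_unique, (is_RInt_derive (V := R_CompleteNormedModule) (fun u => A u y)).
      + intros x _; apply DA; lra.
      + intros x _; apply (continuity_2d_pt_l D), HD; lra. }
  assert (Bd : Rabs (RInt (fun y => A N y - A (- N) y) y1 y2) <= 2 * K * (y2 - y1) * exp (- (d * N2))).
  { replace (2 * K * (y2 - y1) * exp (- (d * N2)))
      with ((y2 - y1) * (2 * K * exp (- (d * N2)))) by ring.
    assert (CA : forall y, lo < y < hi -> continuous (fun v => RInt (fun x => D x v) (- N) N) y).
    { intros y Hy; apply (cont_strip_RInt D lo hi); auto. }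
    apply (norm_RInt_le_const (V := R_NormedModule)
       (fun y => A N y - A (- N) y) y1 y2); auto.
    - intros y Hy. change (Rabs (A N y - A (- N) y) <= 2 * K * exp (- (d * N2))).
      assert (Hy' : lo < y < hi) by lra.
      pose proof (KA y Hy' N) as B1. pose proof (KA y Hy' (- N)) as B2; simpl in B1, B2.
      rewrite Rabs_Ropp in B2. rewrite (Rabs_pos_eq N) in B1, B2 by (unfold N; lra).
      assert (exp (- (d * N)) <= exp (- (d * N2))) by (apply exp_le_le; unfold N; nra).
      pose proof (exp_pos (- (d * N))).
      apply Rabs_le_between in B1; apply Rabs_le_between in B2; apply Rabs_le_between; nra.
    - apply (RInt_correct (V := R_CompleteNormedModule)).
      apply ex_RInt_ext with (f := fun y => RInt (fun x => D x y) (- N) N).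
      + intros y Hy; simpl; rewrite Rmin_left, Rmax_right in Hy by lra.
        apply is_RInt_unique, (is_RInt_derive (V := R_CompleteNormedModule) (fun u => A u y)).
        * intros x _; apply DA; lra.
        * intros x _; apply (continuity_2d_pt_l D), HD; lra.
      + apply (ex_RInt_continuous (V := R_CompleteNormedModule)).
        intros y Hy; rewrite Rmin_left, Rmax_right in Hy by lra; apply CA; lra. }
  rewrite <- E in Bd.
  apply Rabs_le_between in Bd; apply Rabs_def2 in HN1; apply Rabs_def1; lra.
Qed.

(** * The complex exponential and holomorphic functions of [x + i y] *)

Definition cexp (z : C) : C := (exp (fst z) * cos (snd z), exp (fst z) * sin (snd z)).

Definition is_cderive (f : R -> C) (t : R) (l : C) : Prop :=
  is_derive (fun u => fst (f u)) t (fst l) /\ is_derive (fun u => snd (f u)) t (snd l).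

(* [h x y] is a function of the complex variable [x + i y]; [h'] is its complex derivative. *)
Definition is_hol (h h' : R -> R -> C) (x y : R) : Prop :=
  is_cderive (fun u => h u y) x (h' x y) /\ is_cderive (fun v => h x v) y (Ci * h' x y)%C.

Definition cont_C (h : R -> R -> C) (x y : R) : Prop :=
  continuity_2d_pt (fun u v => fst (h u v)) x y /\ continuity_2d_pt (fun u v => snd (h u v)) x y.

Lemma is_cderive_plus (f g : R -> C) t l m :
  is_cderive f t l -> is_cderive g t m -> is_cderive (fun u => f u + g u)%C t (l + m)%C.
Proof.
  intros [H1 H2] [H3 H4]; split; simpl.
  - apply (is_derive_plus (V := R_NormedModule) (fun u => fst (f u)) (fun u => fst (g u))); auto.
  - apply (is_derive_plus (V := R_NormedModule) (fun u => snd (f u)) (fun u => snd (g u))); auto.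
Qed.

(** The expression is the real part of a complex product; the imaginary part takes the same shape
    once one factor is negated. *)
Lemma is_derive_prod_minus (a b c e : R -> R) (t a' b' c' e' : R) :
  is_derive a t a' -> is_derive b t b' -> is_derive c t c' -> is_derive e t e' ->
  is_derive (fun u => a u * b u - c u * e u) t (a' * b t + a t * b' - (c' * e t + c t * e')).
Proof.
  intros H1 H2 H3 H4.
  assert (E : forall (h : R -> R) k, is_derive h t k -> ex_derive h t) by (intros; eexists; eauto).
  auto_derive; repeat split; eauto.
  rewrite (is_derive_unique (fun x : R => a x) _ _ H1 : Derive (fun x : R => a x) t = _), (is_derive_unique (fun x : R => b x) _ _ H2 : Derive (fun x : R => b x) t = _),
    (is_derive_unique (fun x : R => c x) _ _ H3 : Derive (fun x : R => c x) t = _), (is_derive_unique (fun x : R => e x) _ _ H4 : Derive (fun x : R => e x) t = _); ring.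
Qed.

Lemma is_cderive_mult (f g : R -> C) t l m :
  is_cderive f t l -> is_cderive g t m ->
  is_cderive (fun u => f u * g u)%C t (l * g t + f t * m)%C.
Proof.
  intros [H1 H2] [H3 H4]; split; simpl.
  - evar_last; [apply (is_derive_prod_minus (fun u => fst (f u)) (fun u => fst (g u))
      (fun u => snd (f u)) (fun u => snd (g u))); eauto | simpl; ring].
  - apply is_derive_ext with
      (f := fun u => fst (f u) * snd (g u) - (- snd (f u)) * fst (g u)); [intros; simpl; ring |].
    assert (H2' : is_derive (fun u => - snd (f u)) t (- snd l))
      by (apply (is_derive_opp (V := R_NormedModule) (fun u => snd (f u))); auto).
    evar_last; [apply (is_derive_prod_minus (fun u => fst (f u)) (fun u => snd (g u))
      (fun u => - snd (f u)) (fun u => fst (g u))); eauto | simpl; ring].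
Qed.

Lemma is_cderive_cexp (f : R -> C) t l :
  is_cderive f t l -> is_cderive (fun u => cexp (f u)) t (cexp (f t) * l)%C.
Proof.
  intros [H1 H2].
  assert (E : forall (h : R -> R) k, is_derive h t k -> ex_derive h t) by (intros; eexists; eauto).
  unfold cexp; split; simpl; set (a := fun u => fst (f u)) in *; set (b := fun u => snd (f u)) in *;
    [change (is_derive (fun u => exp (a u) * cos (b u)) t
       (exp (a t) * cos (b t) * fst l - exp (a t) * sin (b t) * snd l))
    | change (is_derive (fun u => exp (a u) * sin (b u)) t
       (exp (a t) * cos (b t) * snd l + exp (a t) * sin (b t) * fst l))];
    auto_derive; repeat split; eauto;
    rewrite (is_derive_unique (fun x : R => a x) _ _ H1 : Derive (fun x : R => a x) t = _), (is_derive_unique (fun x : R => b x) _ _ H2 : Derive (fun x : R => b x) t = _); ring.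
Qed.

Lemma C_neq_0_norm2 (z : C) : z <> 0%C -> fst z ^ 2 + snd z ^ 2 <> 0.
Proof.
  intros Hz H; apply Hz; destruct z as [a b]; simpl in H.
  apply injective_projections; simpl; nra.
Qed.

Lemma is_cderive_inv (f : R -> C) t l : f t <> 0%C ->
  is_cderive f t l -> is_cderive (fun u => / f u)%C t (- (l * / f t * / f t))%C.
Proof.
  intros Hz' [H1 H2]; pose proof (C_neq_0_norm2 _ Hz') as Hz.
  assert (E : forall (h : R -> R) k, is_derive h t k -> ex_derive h t) by (intros; eexists; eauto).
  simpl in Hz.
  split; simpl; set (a := fun u => fst (f u)) in *; set (b := fun u => snd (f u)) in *;
    change (fst (f t)) with (a t) in *; change (snd (f t)) with (b t) in *;
    [change (fun u => fst (f u) / (fst (f u) * (fst (f u) * 1) + snd (f u) * (snd (f u) * 1)))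
      with (fun u => a u / (a u * (a u * 1) + b u * (b u * 1)))
    |change (fun u => - snd (f u) / (fst (f u) * (fst (f u) * 1) + snd (f u) * (snd (f u) * 1)))
      with (fun u => - b u / (a u * (a u * 1) + b u * (b u * 1)))];
    auto_derive; repeat split; eauto;
    rewrite (is_derive_unique (fun x : R => a x) _ _ H1 : Derive (fun x : R => a x) t = _), (is_derive_unique (fun x : R => b x) _ _ H2 : Derive (fun x : R => b x) t = _);
    field; rewrite !Rmult_1_r in Hz; auto.
Qed.

Lemma is_hol_const (c : C) x y : is_hol (fun _ _ => c) (fun _ _ => 0%C) x y.
Proof.
  split; split; simpl; (evar_last; [apply is_derive_const | unfold zero; simpl; ring]).
Qed.

Lemma is_hol_id x y : is_hol (fun u v => (u, v)) (fun _ _ => 1%C) x y.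
Proof.
  split; split; simpl; auto_derive; auto; ring.
Qed.

Lemma is_hol_plus (h h' g g' : R -> R -> C) x y : is_hol h h' x y -> is_hol g g' x y ->
  is_hol (fun u v => h u v + g u v)%C (fun u v => h' u v + g' u v)%C x y.
Proof.
  intros [H1 H2] [H3 H4]; split; [now apply is_cderive_plus |].
  replace (Ci * (h' x y + g' x y))%C with (Ci * h' x y + Ci * g' x y)%C by ring.
  now apply is_cderive_plus.
Qed.

Lemma is_hol_mult (h h' g g' : R -> R -> C) x y : is_hol h h' x y -> is_hol g g' x y ->
  is_hol (fun u v => h u v * g u v)%C (fun u v => h' u v * g u v + h u v * g' u v)%C x y.
Proof.
  intros [H1 H2] [H3 H4]; split; [now apply (is_cderive_mult (fun u => h u y) (fun u => g u y)) |].
  replace (Ci * (h' x y * g x y + h x y * g' x y))%C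
    with (Ci * h' x y * g x y + h x y * (Ci * g' x y))%C by ring.
  now apply (is_cderive_mult (h x) (g x)).
Qed.

Lemma is_hol_scal (c : C) (h h' : R -> R -> C) x y : is_hol h h' x y ->
  is_hol (fun u v => c * h u v)%C (fun u v => c * h' u v)%C x y.
Proof.
  intros H.
  assert (H' := is_hol_mult _ _ _ _ _ _ (is_hol_const c x y) H).
  destruct H' as [H1 H2]; split; simpl in *.
  - replace (c * h' x y)%C with (0 * h x y + c * h' x y)%C by ring; exact H1.
  - replace (c * h' x y)%C with (0 * h x y + c * h' x y)%C by ring; exact H2.
Qed.

Lemma is_hol_cexp (h h' : R -> R -> C) x y : is_hol h h' x y ->
  is_hol (fun u v => cexp (h u v)) (fun u v => cexp (h u v) * h' u v)%C x y.
Proof.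
  intros [H1 H2]; split; [now apply (is_cderive_cexp (fun u => h u y)) |].
  replace (Ci * (cexp (h x y) * h' x y))%C with (cexp (h x y) * (Ci * h' x y))%C by ring.
  now apply (is_cderive_cexp (h x)).
Qed.

Lemma is_hol_inv (h h' : R -> R -> C) x y : h x y <> 0%C -> is_hol h h' x y ->
  is_hol (fun u v => / h u v)%C (fun u v => - (h' u v * / h u v * / h u v))%C x y.
Proof.
  intros H0 [H1 H2]; split; [now apply (is_cderive_inv (fun u => h u y)) |].
  replace (Ci * - (h' x y * / h x y * / h x y))%C
    with (- (Ci * h' x y * / h x y * / h x y))%C by ring.
  now apply (is_cderive_inv (h x)).
Qed.

Lemma cont_C_const c x y : cont_C (fun _ _ => c) x y.
Proof. split; apply continuity_2d_pt_const. Qed.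

Lemma cont_C_id x y : cont_C (fun u v => (u, v)) x y.
Proof. split; simpl; [apply continuity_2d_pt_id1 | apply continuity_2d_pt_id2]. Qed.

Lemma cont_C_plus (h g : R -> R -> C) x y : cont_C h x y -> cont_C g x y -> cont_C (fun u v => h u v + g u v)%C x y.
Proof. intros [H1 H2] [H3 H4]; split; simpl; apply continuity_2d_pt_plus; auto. Qed.

Lemma cont_C_opp (h : R -> R -> C) x y : cont_C h x y -> cont_C (fun u v => - h u v)%C x y.
Proof. intros [H1 H2]; split; simpl; apply continuity_2d_pt_opp; auto. Qed.

Lemma cont_C_mult (h g : R -> R -> C) x y : cont_C h x y -> cont_C g x y -> cont_C (fun u v => h u v * g u v)%C x y.
Proof.
  intros [H1 H2] [H3 H4]; split; simpl;
    [apply continuity_2d_pt_minus | apply continuity_2d_pt_plus];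
    apply continuity_2d_pt_mult; auto.
Qed.

Lemma cont_C_cexp (h : R -> R -> C) x y : cont_C h x y -> cont_C (fun u v => cexp (h u v)) x y.
Proof.
  intros [H1 H2]; split; simpl; apply continuity_2d_pt_mult;
    auto using continuity_2d_pt_exp, continuity_2d_pt_cos, continuity_2d_pt_sin.
Qed.

Lemma cont_C_inv (h : R -> R -> C) x y : h x y <> 0%C -> cont_C h x y -> cont_C (fun u v => / h u v)%C x y.
Proof.
  intros Hz' [H1 H2]; pose proof (C_neq_0_norm2 _ Hz') as Hz; simpl in Hz.
  split; simpl; unfold Rdiv; apply continuity_2d_pt_mult;
    try apply continuity_2d_pt_opp; auto;
    apply continuity_2d_pt_inv; auto;
    apply continuity_2d_pt_plus; repeat apply continuity_2d_pt_mult; auto;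
    apply continuity_2d_pt_const.
Qed.

Ltac cont_C_tac := repeat first
  [ apply cont_C_const | apply cont_C_id | apply cont_C_plus | apply cont_C_mult
  | apply cont_C_cexp | apply cont_C_opp | apply cont_C_inv ].

Lemma Rabs_fst_le_Cmod (z : C) : Rabs (fst z) <= Cmod z.
Proof.
  pose proof (Rmax_Cmod z); pose proof (Rmax_l (Rabs (fst z)) (Rabs (snd z))); lra.
Qed.

Lemma Rabs_snd_le_Cmod (z : C) : Rabs (snd z) <= Cmod z.
Proof.
  pose proof (Rmax_Cmod z); pose proof (Rmax_r (Rabs (fst z)) (Rabs (snd z))); lra.
Qed.

Lemma Cmod_cexp (z : C) : Cmod (cexp z) = exp (fst z).
Proof.
  unfold Cmod, cexp; simpl.
  replace (_ + _) with (exp (fst z) * exp (fst z) * (Rsqr (sin (snd z)) + Rsqr (cos (snd z))))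
    by (unfold Rsqr; ring).
  rewrite sin2_cos2, Rmult_1_r; apply sqrt_square, Rlt_le, exp_pos.
Qed.

Lemma cexp_plus (z w : C) : cexp (z + w)%C = (cexp z * cexp w)%C.
Proof.
  unfold cexp; apply injective_projections; simpl; rewrite exp_plus;
    [rewrite cos_plus | rewrite sin_plus]; ring.
Qed.

Section Rotation.

Variables (h h' : R -> R -> C) (lo hi K d y1 y2 : R).
Hypothesis d0 : 0 < d.
Hypothesis H1 : lo < y1 < hi.
Hypothesis H2 : lo < y2 < hi.
Hypothesis Hh : forall x y, lo < y < hi -> is_hol h h' x y.
Hypothesis Ch' : forall x y, lo < y < hi -> cont_C h' x y.
Hypothesis Bh : forall x y, lo < y < hi -> Cmod (h x y) <= K * exp (- (d * Rabs x)).

(** The height [y] of a horizontal line is the argument of [exp (x + i y)]: moving the line amounts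
    to rotating a ray from the origin. *)
Lemma RIntR_rotation_snd : RIntR (fun x => snd (h x y1)) = RIntR (fun x => snd (h x y2)).
Proof.
  assert (Main : forall a b, lo < a -> a <= b -> b < hi ->
    RIntR (fun x => snd (h x a)) = RIntR (fun x => snd (h x b))).
  { intros a b Ha Hab Hb.
    apply (RIntR_rotation_real (fun x y => fst (h x y)) (fun x y => snd (h x y))
      (fun x y => fst (h' x y)) lo hi K d); auto.
    - intros x y Hy; apply (Hh x y Hy).
    - intros x y Hy; destruct (Hh x y Hy) as [_ [_ H]]; simpl in H.
      now rewrite Rmult_0_l, Rmult_1_l, Rplus_0_l in H.
    - intros x y Hy; apply (Ch' x y Hy).
    - intros x y Hy; destruct (Hh x y Hy) as [[_ H] _].
      apply (ex_derive_continuous (V := R_NormedModule)); eexists; apply H.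
    - intros y Hy x; eapply Rle_trans; [apply Rabs_fst_le_Cmod | auto].
    - intros y Hy x; eapply Rle_trans; [apply Rabs_snd_le_Cmod | auto]. }
  destruct (Rle_dec y1 y2); [| symmetry]; apply Main; lra.
Qed.

End Rotation.

(* Multiplication by [Ci] turns real parts into imaginary parts. *)
Lemma RIntR_rotation_fst (h h' : R -> R -> C) (lo hi K d y1 y2 : R) :
  0 < d -> lo < y1 < hi -> lo < y2 < hi ->
  (forall x y, lo < y < hi -> is_hol h h' x y) ->
  (forall x y, lo < y < hi -> cont_C h' x y) ->
  (forall x y, lo < y < hi -> Cmod (h x y) <= K * exp (- (d * Rabs x))) ->
  RIntR (fun x => fst (h x y1)) = RIntR (fun x => fst (h x y2)).
Proof.
  intros d0 H1 H2 Hh Ch' Bh.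
  rewrite (RIntR_ext (fun x => fst (h x y1)) (fun x => snd (Ci * h x y1)%C)) by (intros; simpl; ring).
  rewrite (RIntR_ext (fun x => fst (h x y2)) (fun x => snd (Ci * h x y2)%C)) by (intros; simpl; ring).
  apply (RIntR_rotation_snd (fun x y => Ci * h x y)%C (fun x y => Ci * h' x y)%C lo hi K d); auto.
  - intros x y Hy; apply is_hol_scal; auto.
  - intros x y Hy; apply cont_C_mult; auto using cont_C_const.
  - intros x y Hy; rewrite Cmod_mult.
    replace (Cmod Ci) with 1; [rewrite Rmult_1_l; auto |].
    unfold Cmod, Ci; simpl; replace (_ + _) with 1 by ring; now rewrite sqrt_1.
Qed.

(** * Gamma and Beta functions *)

Lemma exp_exp_dominated (a b nu : R) : 0 < a -> 0 < b -> 0 < nu ->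
  exists K, forall x, exp (a * x - b * exp (nu * x)) <= K * exp (- (a * Rabs x)).
Proof.
  intros a0 b0 n0.
  (* For [x >= 0], [exp (nu x) >= (nu x)^2 / 4], and [4 a^2 / (b nu^2)] is the maximum of
     [2 a x - b (nu x)^2 / 4]. For [x < 0] the term [a x] is already [- a |x|]. *)
  exists (exp (4 * a * a / (b * nu * nu))); intros x.
  rewrite <- exp_plus; apply exp_le_le.
  assert (q : 0 < b * nu * nu) by (repeat apply Rmult_lt_0_compat; auto).
  assert (Hq : 0 <= 4 * a * a / (b * nu * nu)).
  { apply Rmult_le_pos; [nra | apply Rlt_le, Rinv_0_lt_compat; auto]. }
  destruct (Rle_dec 0 x) as [Hx | Hx].
  - rewrite Rabs_pos_eq by auto.
    assert (He : (nu * x) ^ 2 / 4 <= exp (nu * x)).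
    { assert (Hy : 0 <= nu * x) by nra; set (y := nu * x) in *.
      assert (H1 : 1 + y / 2 <= exp (y / 2)) by apply exp_ineq1_le.
      assert (H2 : exp y = exp (y / 2) * exp (y / 2)) by (rewrite <- exp_plus; f_equal; field).
      rewrite H2; nra. }
    assert (E : 4 * a * a / (b * nu * nu) + b * ((nu * x) ^ 2 / 4) - 2 * a * x
      = b * nu * nu / 4 * (x - 4 * a / (b * nu * nu)) ^ 2) by (field; lra).
    pose proof (pow2_ge_0 (x - 4 * a / (b * nu * nu))).
    assert (b * ((nu * x) ^ 2 / 4) <= b * exp (nu * x)) by (apply Rmult_le_compat_l; lra).
    set (Q := 4 * a * a / (b * nu * nu)) in *. nra.
  - rewrite Rabs_left by lra.
    assert (0 < b * exp (nu * x)) by (apply Rmult_lt_0_compat; auto using exp_pos).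
    set (Q := 4 * a * a / (b * nu * nu)) in *. lra.
Qed.

Lemma is_RIntR_pos (f : R -> R) (l : R) :
  (forall x, continuous f x) -> (forall x, 0 < f x) -> is_RIntR f l -> 0 < l.
Proof.
  intros Cf Pf Hf.
  assert (P01 : 0 < RInt f 0 1) by (apply RInt_gt_0; auto; lra).
  destruct (is_RIntR_elim f l Hf (RInt f 0 1) P01) as [N HN].
  pose proof (Rmax_l N 1). pose proof (Rmax_r N 1). set (b := Rmax N 1 + 1) in *.
  specialize (HN (- b) b ltac:(unfold b; lra) ltac:(unfold b; lra)).
  assert (Hex : forall u v, ex_RInt f u v) by (intros; now apply ex_RInt_cont).
  assert (Pos : forall u v, u < v -> 0 < RInt f u v) by (intros; apply RInt_gt_0; auto).
  assert (E : RInt f (- b) b = RInt f (- b) 0 + (RInt f 0 1 + RInt f 1 b)).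
  { rewrite <- (RInt_Chasles f (- b) 0 b), <- (RInt_Chasles f 0 1 b); auto. }
  pose proof (Pos (- b) 0 ltac:(unfold b; lra)). pose proof (Pos 1 b ltac:(unfold b; lra)).
  apply Rabs_def2 in HN; lra.
Qed.

Lemma is_RIntR_opp_arg (f : R -> R) (l : R) :
  (forall x, continuous f x) -> is_RIntR f l -> is_RIntR (fun x => f (- x)) l.
Proof.
  intros Cf Hf; apply is_RIntR_intro.
  - intros x; apply (continuous_comp (fun x => - x) f); auto.
    apply (continuous_opp (V := R_NormedModule) (fun x => x)), continuous_id.
  - intros eps e0; destruct (is_RIntR_elim f _ Hf eps e0) as [N HN].
    exists N; intros a b Ha Hb.
    replace (RInt (fun x => f (- x)) a b) with (RInt f (- b) (- a)); [apply HN; lra |].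
    rewrite <- (opp_RInt_swap (V := R_CompleteNormedModule)) by now apply ex_RInt_cont.
    replace (- a) with (-1 * a + 0) by ring. replace (- b) with (-1 * b + 0) by ring.
    rewrite <- (RInt_comp_lin (V := R_CompleteNormedModule) f (-1) 0 a b) by now apply ex_RInt_cont.
    assert (E : ex_RInt (fun y => scal (-1) (f (-1 * y + 0))) a b).
    { apply (ex_RInt_comp_lin (V := R_NormedModule)); now apply ex_RInt_cont. }
    rewrite <- (RInt_opp (V := R_CompleteNormedModule)) by exact E.
    apply (RInt_ext (V := R_CompleteNormedModule)); intros x _.
    replace (-1 * x + 0) with (- x) by ring.
    unfold opp, scal; simpl; unfold mult; simpl; ring.
Qed.

(** Change of variable [u = phi x]. The inverse [psi] is required near the two endpoints, where it
    translates the filters into [x] going to minus and plus infinity; [D] is an interval containing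
    the image of [phi]. *)
Lemma is_RInt_gen_subst (f phi dphi psi : R -> R) (D : R -> Prop)
  (Fa Fb : (R -> Prop) -> Prop) {FFa : Filter Fa} {FFb : Filter Fb} (l : R) :
  (forall x, D x -> continuous f x) ->
  (forall p q z, D p -> D q -> p <= z <= q -> D z) ->
  (forall x, D (phi x)) ->
  (forall x, is_derive phi x (dphi x)) -> (forall x, continuous dphi x) ->
  (forall N, Fa (fun u => phi (psi u) = u /\ psi u < N)) ->
  (forall N, Fb (fun u => phi (psi u) = u /\ N < psi u)) ->
  is_RIntR (fun x => dphi x * f (phi x)) l ->
  is_RInt_gen f Fa Fb l.
Proof.
  intros Cf Conv Dphi Der Cd Ha Hb H P [eps HP].
  destruct (is_RIntR_elim _ _ H eps (cond_pos eps)) as [N HN].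
  eapply Filter_prod; [apply (Ha (- N)) | apply (Hb N) |].
  intros u v [Eu Hu] [Ev Hv]; simpl.
  exists (RInt f u v); split.
  - apply (RInt_correct (V := R_CompleteNormedModule)).
    apply (ex_RInt_continuous (V := R_CompleteNormedModule)); intros z Hz; apply Cf.
    apply (Conv (Rmin u v) (Rmax u v)); auto.
    + rewrite <- Eu, <- Ev; apply (Rmin_case (phi (psi u)) (phi (psi v)) D); auto.
    + rewrite <- Eu, <- Ev; apply (Rmax_case (phi (psi u)) (phi (psi v)) D); auto.
  - apply HP. rewrite <- Eu, <- Ev at 1.
    rewrite <- (RInt_comp (V := R_CompleteNormedModule) f phi dphi (psi u) (psi v)); auto.
    apply (HN (psi u) (psi v) Hu Hv).
Qed.

Lemma Gamma_integrand_dominated (a b : R) : 0 < a -> 0 < b ->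
  exists K, exp_dominated K a (fun x => exp (a * x - b * exp x)).
Proof.
  intros a0 b0; destruct (exp_exp_dominated a b 1 a0 b0 Rlt_0_1) as [K HK].
  exists K; intros x. rewrite Rabs_pos_eq by (apply Rlt_le, exp_pos).
  generalize (HK x); now rewrite Rmult_1_l.
Qed.

Lemma continuous_Gamma_integrand (a x : R) : continuous (fun x => exp (a * x - exp x)) x.
Proof. cont_1d. Qed.

(** Substitution [t = exp x] in Euler's integral; the factor [exp x] from [dt] turns [a - 1] into
    [a]. *)
Lemma is_RIntR_Gamma (a : R) : 0 < a -> is_RIntR (fun x => exp (a * x - exp x)) (Gamma a).
Proof.
  intros a0.
  destruct (Gamma_integrand_dominated a 1 a0 Rlt_0_1) as [K HK].
  set (f := fun x => exp (a * x - exp x)).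
  assert (HK' : exp_dominated K a f).
  { intros x; generalize (HK x); now rewrite Rmult_1_l. }
  assert (Cf : forall x, continuous f x) by (intros x; unfold f; cont_1d).
  assert (I := is_RIntR_dominated f K a Cf HK' a0).
  replace (Gamma a) with (RIntR f); [exact I |].
  symmetry; unfold Gamma.
  refine (is_RInt_gen_unique (V := R_CompleteNormedModule) _ _ _).
  refine (is_RInt_gen_subst _ exp exp ln (fun z => 0 < z) _ _ _ _ _ _ _ _ _ _ _).
  - intros x Hx; apply (ex_derive_continuous (V := R_NormedModule)).
    unfold Rpower; auto_derive; auto.
  - intros p q z Hp Hq [H1 H2]; lra.
  - intros x; apply exp_pos.
  - intros x; apply is_derive_Reals, derivable_pt_lim_exp.
  - intros x; cont_1d.
  - intros N; exists (mkposreal _ (exp_pos N)); intros u Hu Pu; split; [apply exp_ln; auto |].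
    rewrite <- (ln_exp N); apply ln_increasing; auto.
    apply Rabs_def2 in Hu; unfold minus, plus, opp in Hu; simpl in Hu; lra.
  - intros N; exists (exp N); intros u Hu; pose proof (exp_pos N); split; [apply exp_ln; lra |].
    rewrite <- (ln_exp N); apply ln_increasing; auto.
  - apply is_RIntR_ext with (f := f); [| exact I].
    intros x; unfold f, Rpower; rewrite ln_exp, <- !exp_plus; f_equal; ring.
Qed.

Lemma Gamma_pos (a : R) : 0 < a -> 0 < Gamma a.
Proof.
  intros a0; refine (is_RIntR_pos (fun x => exp (a * x - exp x)) _ _ _ (is_RIntR_Gamma a a0)); intros x.
  - cont_1d.
  - apply exp_pos.
Qed.

Lemma is_lim_dominated (f : R -> R) (K d : R) : 0 < d -> exp_dominated K d f ->
  is_lim f m_infty 0 /\ is_lim f p_infty 0.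
Proof.
  intros d0 HD.
  assert (H : forall eps, 0 < eps -> exists N, 0 <= N /\ forall x, N < Rabs x -> Rabs (f x) < eps).
  { intros eps e0; destruct (exp_small K d eps d0 e0) as [N [N0 HN]].
    exists N; split; auto; intros x Hx.
    eapply Rle_lt_trans; [apply HD |]. eapply Rle_lt_trans; [| exact HN].
    apply Rmult_le_compat_l; [apply (exp_dominated_pos f K d HD) | apply exp_le_le; nra]. }
  split; apply filterlim_locally; intros eps; destruct (H eps (cond_pos eps)) as [N [N0 HN]].
  - exists (- N); intros x Hx; change (Rabs (f x - 0) < eps); rewrite Rminus_0_r; apply HN.
    rewrite Rabs_left; lra.
  - exists N; intros x Hx; change (Rabs (f x - 0) < eps); rewrite Rminus_0_r; apply HN.
    rewrite Rabs_right; lra.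
Qed.

(** Integration by parts, written as the integral of the derivative of [exp (a x - exp x)], which
    tends to 0 on both sides. *)
Lemma Gamma_plus_1 (a : R) : 0 < a -> Gamma (a + 1) = a * Gamma a.
Proof.
  intros a0.
  assert (I1 := is_RIntR_scal _ a _ (is_RIntR_Gamma a a0)).
  assert (I2 := is_RIntR_Gamma (a + 1) ltac:(lra)).
  assert (I3 := is_RIntR_minus _ _ _ _ I1 I2).
  destruct (Gamma_integrand_dominated a 1 a0 Rlt_0_1) as [K HK].
  destruct (is_lim_dominated _ K a a0 HK) as [L1 L2].
  assert (I4 : is_RIntR (fun x => a * exp (a * x - exp x) - exp ((a + 1) * x - exp x)) (0 - 0)).
  { apply (is_RIntR_derive (fun x => exp (a * x - 1 * exp x))); auto.
    - intros x; auto_derive; auto.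
      replace (exp ((a + 1) * x - exp x)) with (exp (a * x + - exp x) * exp x)
        by (rewrite <- exp_plus; f_equal; ring).
      rewrite !Rmult_1_l; unfold Rminus; ring.
    - intros x; cont_1d. }
  pose proof (is_RIntR_unique2 _ _ _ I3 I4); lra.
Qed.

Lemma Gamma_1 : Gamma 1 = 1.
Proof.
  assert (I : is_RIntR (fun x => exp (1 * x - exp x)) (0 - (- 1))).
  { apply (is_RIntR_derive (fun x => - exp (- exp x))).
    - intros x; auto_derive; auto. replace (1 * x - exp x) with (x + - exp x) by ring.
      rewrite exp_plus; ring.
    - intros x; cont_1d.
    - apply (is_lim_comp (fun y => - exp (- y)) exp m_infty (-1) 0).
      + assert (H : is_lim (fun y => - exp (- y)) 0 (- exp (- 0))).
        { apply (is_lim_continuity (fun y => - exp (- y)) 0), continuity_pt_filterlim.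
          apply (ex_derive_continuous (V := R_NormedModule) (fun y => - exp (- y)) 0).
          auto_derive; auto. }
        rewrite Ropp_0, exp_0 in H; exact H.
      + apply is_lim_exp_m.
      + exists 0; intros y _ H; apply (Rgt_not_eq _ _ (exp_pos y)); congruence.
    - replace (Finite 0) with (Rbar_opp 0) by (simpl; f_equal; ring).
      apply is_lim_opp.
      apply (is_lim_comp exp (fun x => - exp x) p_infty 0 m_infty).
      + apply is_lim_exp_m.
      + apply (is_lim_opp exp p_infty p_infty), is_lim_exp_p.
      + exists 0; intros; discriminate. }
  rewrite <- (is_RIntR_unique2 _ _ _ I (is_RIntR_Gamma 1 Rlt_0_1)); ring.
Qed.

Lemma is_RIntR_Gamma_scal (a r : R) : 0 < a -> 0 < r ->
  is_RIntR (fun x => exp (a * x - r * exp x)) (exp (- (a * ln r)) * Gamma a).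
Proof.
  intros a0 r0.
  assert (I := is_RIntR_scal _ (exp (- (a * ln r))) _
     (is_RIntR_shift _ (ln r) _ (fun x => continuous_Gamma_integrand a x) (is_RIntR_Gamma a a0))).
  eapply is_RIntR_ext; [| exact I]; intros x; simpl.
  rewrite exp_plus, exp_ln, <- exp_plus by auto; f_equal; ring.
Qed.

(** Two orders of integration for [F s w]: over [w] a shift by [s] produces [Gamma a] and leaves the
    integrand of [Gamma b]; over [s] the rate is [1 + exp w] and produces [Gamma (a + b)]. *)
Lemma is_RIntR_Beta (a b : R) : 0 < a -> 0 < b ->
  is_RIntR (fun w => exp (a * w - (a + b) * ln (1 + exp w)))
    (Gamma a * Gamma b / Gamma (a + b)).
Proof.
  intros a0 b0.
  set (F := fun s w => exp (a * w + (a + b) * s - exp s - exp (s + w))).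
  (* For [w > 0] decay in [w] is bought with half of [b]: the linear exponent [a w + (a + b) s]
     equals [- e w + (b - e) s + (a + e) (s + w)], and the last two terms pair with [exp s] and
     [exp (s + w)]. *)
  set (e := b / 2).
  assert (e0 : 0 < e) by (unfold e; lra).
  destruct (Gamma_integrand_dominated (b - e) 1 ltac:(unfold e; lra) Rlt_0_1) as [K1 H1].
  destruct (Gamma_integrand_dominated (a + b) 1 ltac:(lra) Rlt_0_1) as [K2 H2].
  destruct (Gamma_integrand_dominated (a + e) 1 ltac:(lra) Rlt_0_1) as [K3 H3].
  assert (K10 := exp_dominated_pos _ _ _ H1). assert (K20 := exp_dominated_pos _ _ _ H2).
  assert (K30 := exp_dominated_pos _ _ _ H3).
  set (d := Rmin a e).
  assert (Hda : d <= a) by apply Rmin_l. assert (Hde : d <= e) by apply Rmin_r.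
  assert (d0 : 0 < d) by (apply Rmin_glb_lt; auto).
  assert (Cx : forall s w, continuity_2d_pt F s w) by (intros; unfold F; cont_2d).
  assert (Hd' : forall x k, d <= k -> exp (- (k * Rabs x)) <= exp (- (d * Rabs x))).
  { intros x k Hk; apply exp_le_le; pose proof (Rabs_pos x); nra. }
  assert (Bd : forall s w, Rabs (F s w) <= (K2 + K1 * K3) * exp (- (d * Rabs s)) * exp (- (d * Rabs w))).
  { intros s w; unfold F; rewrite Rabs_pos_eq by (apply Rlt_le, exp_pos).
    destruct (Rle_dec w 0) as [Hw | Hw].
    - apply Rle_trans with (exp (a * w) * exp ((a + b) * s - 1 * exp s)).
      + rewrite <- exp_plus; apply exp_le_le; pose proof (exp_pos (s + w)); lra.
      + pose proof (H2 s) as H; rewrite Rabs_pos_eq in H by (apply Rlt_le, exp_pos).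
        assert (exp (a * w) <= exp (- (d * Rabs w))).
        { apply exp_le_le; rewrite Rabs_left1; nra. }
        pose proof (Hd' s (a + b) ltac:(lra)).
        pose proof (exp_pos (a * w)). pose proof (exp_pos (- (d * Rabs s))).
        pose proof (exp_pos (- (d * Rabs w))).
        assert (exp ((a + b) * s - 1 * exp s) <= (K2 + K1 * K3) * exp (- (d * Rabs s))).
        { eapply Rle_trans; [apply H |].
          apply Rle_trans with (K2 * exp (- (d * Rabs s))).
          - apply Rmult_le_compat_l; auto.
          - apply Rmult_le_compat_r; [lra |]. assert (0 <= K1 * K3) by (apply Rmult_le_pos; auto). lra. }
        rewrite Rmult_comm; apply Rmult_le_compat; auto; apply Rlt_le, exp_pos.
    - apply Rle_trans with (exp (- (e * w)) * (exp ((b - e) * s - 1 * exp s)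
          * exp ((a + e) * (s + w) - 1 * exp (s + w)))).
      + rewrite <- !exp_plus; apply exp_le_le; lra.
      + pose proof (H1 s) as G1; rewrite Rabs_pos_eq in G1 by (apply Rlt_le, exp_pos).
        pose proof (H3 (s + w)) as G3; rewrite Rabs_pos_eq in G3 by (apply Rlt_le, exp_pos).
        assert (G3' : exp ((a + e) * (s + w) - 1 * exp (s + w)) <= K3).
        { eapply Rle_trans; [apply G3 |]. rewrite <- (Rmult_1_r K3) at 2.
          apply Rmult_le_compat_l; auto. rewrite <- exp_0; apply exp_le_le.
          pose proof (Rabs_pos (s + w)); nra. }
        assert (exp (- (e * w)) <= exp (- (d * Rabs w))).
        { apply exp_le_le; rewrite Rabs_pos_eq by lra; nra. }
        pose proof (Hd' s (b - e) ltac:(unfold e in *; lra)).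
        pose proof (exp_pos ((b - e) * s - 1 * exp s)).
        pose proof (exp_pos ((a + e) * (s + w) - 1 * exp (s + w))).
        pose proof (exp_pos (- (d * Rabs s))).
        rewrite Rmult_comm; apply Rmult_le_compat; try apply Rlt_le, exp_pos; auto.
        * apply Rlt_le, Rmult_lt_0_compat; apply exp_pos.
        * apply Rle_trans with (K1 * exp (- (d * Rabs s)) * K3).
          -- apply Rmult_le_compat; auto; try lra.
             eapply Rle_trans; [apply G1 | apply Rmult_le_compat_l; auto].
          -- replace (K1 * exp (- (d * Rabs s)) * K3) with (K1 * K3 * exp (- (d * Rabs s))) by ring.
             apply Rmult_le_compat_r; lra. }
  assert (Fub := RIntR_RIntR_Fubini F (K2 + K1 * K3) d d0 Cx Bd).
  assert (E1 : forall s, RIntR (fun w => F s w) = exp (b * s - exp s) * Gamma a).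
  { intros s; apply is_RIntR_unique.
    assert (I := is_RIntR_scal _ (exp (b * s - exp s)) _ (is_RIntR_shift _ s _ (fun x => continuous_Gamma_integrand a x) (is_RIntR_Gamma a a0))).
    eapply is_RIntR_ext; [| exact I]; intros w; unfold F; simpl; rewrite <- exp_plus; f_equal.
    rewrite (Rplus_comm w s); ring. }
  assert (E2 : forall w, RIntR (fun s => F s w) = exp (a * w - (a + b) * ln (1 + exp w)) * Gamma (a + b)).
  { intros w; apply is_RIntR_unique.
    assert (P : 0 < 1 + exp w) by (pose proof (exp_pos w); lra).
    assert (I := is_RIntR_scal _ (exp (a * w)) _ (is_RIntR_Gamma_scal (a + b) (1 + exp w) ltac:(lra) P)).
    replace (exp (a * w - (a + b) * ln (1 + exp w)) * Gamma (a + b))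
      with (exp (a * w) * (exp (- ((a + b) * ln (1 + exp w))) * Gamma (a + b))).
    - eapply is_RIntR_ext; [| exact I]; intros s; unfold F; simpl; rewrite <- exp_plus; f_equal.
      rewrite (exp_plus s w); ring.
    - rewrite <- Rmult_assoc, <- exp_plus; f_equal. }
  assert (E3 : RIntR (fun s => RIntR (fun w => F s w)) = Gamma b * Gamma a).
  { apply is_RIntR_unique. rewrite Rmult_comm.
    eapply is_RIntR_ext; [| apply (is_RIntR_scal _ (Gamma a) _ (is_RIntR_Gamma b b0))].
    intros s; simpl; rewrite E1; ring. }
  rewrite E3 in Fub.
  assert (G := Gamma_pos (a + b) ltac:(lra)).
  replace (Gamma a * Gamma b / Gamma (a + b)) with (/ Gamma (a + b) * (Gamma b * Gamma a)) by (field; lra).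
  eapply is_RIntR_ext; [| apply (is_RIntR_scal _ (/ Gamma (a + b)) _ Fub)].
  intros w; simpl; rewrite E2; field; lra.
Qed.

(** * The reflection formula *)

(** After squaring, the difference of the two sides is at least [(1 + k) / 2 * (exp x - p)^2]. The
    bound keeps resolvents away from their pole on sectors that avoid the negative axis. *)
Lemma Cmod_cexp_plus_ge (x y p k : R) : 0 <= p -> 0 <= k < 1 -> - k <= cos y ->
  sqrt ((1 - k) / 2) * (exp x + p) <= Cmod (cexp (x, y) + p)%C.
Proof.
  intros p0 k0 Hc.
  assert (E0 := exp_pos x).
  rewrite <- (sqrt_square (exp x + p)) by lra.
  rewrite <- sqrt_mult by nra.
  unfold Cmod; apply sqrt_le_1_alt; unfold cexp; simpl.
  set (e := exp x) in *.
  assert (T : cos y * cos y + sin y * sin y = 1).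
  { generalize (sin2_cos2 y); unfold Rsqr; lra. }
  replace ((e * cos y + p) * ((e * cos y + p) * 1) + (e * sin y + 0) * ((e * sin y + 0) * 1))
    with (e * e * (cos y * cos y + sin y * sin y) + 2 * e * p * cos y + p * p) by ring.
  rewrite T.
  assert (e * p * - k <= e * p * cos y) by (apply Rmult_le_compat_l; nra).
  assert (0 <= (e - p) ^ 2) by apply pow2_ge_0.
  nra.
Qed.

Lemma cos_lower (t y : R) : PI / 2 < t < PI -> - t <= y <= t -> - (- cos t) <= cos y.
Proof.
  intros Ht Hy; rewrite Ropp_involutive.
  assert (P := PI_RGT_0).
  destruct (Rle_dec 0 y).
  - apply cos_decr_1; lra.
  - rewrite <- (cos_neg y); apply cos_decr_1; lra.
Qed.

Lemma minus_cos_range (t : R) : PI / 2 < t < PI -> 0 <= - cos t < 1.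
Proof.
  intros Ht; assert (P := PI_RGT_0).
  split.
  - rewrite <- cos_PI2 at 1. rewrite cos_PI2.
    assert (cos t < cos (PI / 2)) by (apply cos_decreasing_1; lra).
    rewrite cos_PI2 in *; lra.
  - assert (cos PI < cos t) by (apply cos_decreasing_1; lra).
    rewrite cos_PI in *; lra.
Qed.

Lemma exists_strip (y : R) : Rabs y < PI -> exists t, PI / 2 < t < PI /\ - t < y < t.
Proof.
  intros Hy; assert (P := PI_RGT_0).
  exists ((Rmax (PI / 2) (Rabs y) + PI) / 2).
  assert (M : Rmax (PI / 2) (Rabs y) < PI) by (apply Rmax_lub_lt; lra).
  pose proof (Rmax_l (PI / 2) (Rabs y)). pose proof (Rmax_r (PI / 2) (Rabs y)).
  split; [lra |]. pose proof (Rle_abs y); pose proof (Rle_abs (- y)); rewrite Rabs_Ropp in *; lra.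
Qed.

Lemma sqrt_half_pos (k : R) : k < 1 -> 0 < sqrt ((1 - k) / 2).
Proof. intros; apply sqrt_lt_R0; lra. Qed.

(* the function [s^a / (1 + s)] at [s = exp (x + i y)] *)
Definition mellin_kernel (a x y : R) : C := (cexp (a * (x, y)) * / (1 + cexp (x, y)))%C.

(** The complex derivative of [mellin_kernel], left in the unsimplified form that the product,
    exponential and inverse rules produce, so that these rules apply verbatim. *)
Definition mellin_kernel' (a x y : R) : C :=
  (cexp (a * (x, y)) * (a * 1) * / (1 + cexp (x, y))
   + cexp (a * (x, y)) *
     - ((0 + cexp (x, y) * 1) * / (1 + cexp (x, y)) * / (1 + cexp (x, y))))%C.

Lemma one_plus_cexp_neq_0 (t x y : R) : PI / 2 < t < PI -> - t <= y <= t -> (1 + cexp (x, y))%C <> 0%C.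
Proof.
  intros Ht Hy H.
  pose proof (Cmod_cexp_plus_ge x y 1 (- cos t) Rle_0_1 (minus_cos_range t Ht) (cos_lower t y Ht Hy)) as B.
  rewrite Cplus_comm, H, Cmod_0 in B.
  pose proof (sqrt_half_pos (- cos t) (proj2 (minus_cos_range t Ht))).
  pose proof (exp_pos x). nra.
Qed.

Lemma mellin_kernel_hol (a t x y : R) : PI / 2 < t < PI -> - t < y < t ->
  is_hol (mellin_kernel a) (mellin_kernel' a) x y.
Proof.
  intros Ht Hy; unfold mellin_kernel, mellin_kernel'.
  apply (is_hol_mult (fun u v => cexp (a * (u, v))) (fun u v => cexp (a * (u, v)) * (a * 1))%C
    (fun u v => / (1 + cexp (u, v)))%C
    (fun u v => - ((0 + cexp (u, v) * 1) * / (1 + cexp (u, v)) * / (1 + cexp (u, v))))%C).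
  - apply (is_hol_cexp (fun u v => a * (u, v))%C (fun u v => a * 1)%C).
    apply (is_hol_scal a (fun u v => (u, v)) (fun _ _ => 1%C)), is_hol_id.
  - apply (is_hol_inv (fun u v => 1 + cexp (u, v))%C (fun u v => 0 + cexp (u, v) * 1)%C).
    + apply (one_plus_cexp_neq_0 t); auto; lra.
    + apply is_hol_plus; [apply is_hol_const |].
      apply (is_hol_cexp (fun u v => (u, v)) (fun _ _ => 1%C)), is_hol_id.
Qed.

Lemma mellin_kernel'_cont (a t x y : R) : PI / 2 < t < PI -> - t < y < t -> cont_C (mellin_kernel' a) x y.
Proof.
  intros Ht Hy; unfold mellin_kernel'.
  cont_C_tac; apply (one_plus_cexp_neq_0 t); auto; lra.
Qed.

(** The modulus is comparable to [exp (a x) / (1 + exp x)], which decays at rate [a] on the left and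
    [1 - a] on the right; this is where [0 < a < 1] enters. *)
Lemma Cmod_mellin_kernel (a t : R) : PI / 2 < t < PI -> 0 < a < 1 ->
  exists K d, 0 < d /\ forall x y, - t < y < t -> Cmod (mellin_kernel a x y) <= K * exp (- (d * Rabs x)).
Proof.
  intros Ht Ha.
  set (c := sqrt ((1 - - cos t) / 2)).
  assert (c0 : 0 < c) by (apply sqrt_half_pos, minus_cos_range; auto).
  exists (/ c), (Rmin a (1 - a)).
  assert (D1 : Rmin a (1 - a) <= a) by apply Rmin_l.
  assert (D2 : Rmin a (1 - a) <= 1 - a) by apply Rmin_r.
  split; [apply Rmin_glb_lt; lra |].
  intros x y Hy; unfold mellin_kernel.
  rewrite Cmod_mult, Cmod_inv, Cmod_cexp by (apply (one_plus_cexp_neq_0 t); auto; lra).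
  assert (B := Cmod_cexp_plus_ge x y 1 (- cos t) Rle_0_1 (minus_cos_range t Ht)
    (cos_lower t y Ht ltac:(lra))); fold c in B.
  rewrite Cplus_comm in B. assert (E := exp_pos x).
  replace (fst (a * (x, y))%C) with (a * x) by (simpl; ring).
  apply Rle_trans with (exp (a * x) * / (c * (exp x + 1))).
  - apply Rmult_le_compat_l; [apply Rlt_le, exp_pos |].
    apply Rinv_le_contravar; [apply Rmult_lt_0_compat; lra | exact B].
  - rewrite Rinv_mult, (Rmult_comm (exp (a * x))), Rmult_assoc.
    apply Rmult_le_compat_l; [apply Rlt_le, Rinv_0_lt_compat; auto |].
    apply (Rmult_le_reg_l (exp x + 1)); [lra |].
    rewrite <- Rmult_assoc, Rinv_r, Rmult_1_l by lra.
    set (m := Rmin a (1 - a)) in *.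
    assert (P := exp_pos (- (m * Rabs x))).
    destruct (Rle_dec 0 x).
    + apply Rle_trans with (exp x * exp (- (m * Rabs x))); [| nra].
      rewrite <- exp_plus; apply exp_le_le; rewrite Rabs_pos_eq by auto; nra.
    + apply Rle_trans with (1 * exp (- (m * Rabs x))); [| nra].
      rewrite Rmult_1_l; apply exp_le_le; rewrite Rabs_left1 by lra; nra.
Qed.

Lemma mellin_kernel_0 (a x : R) : mellin_kernel a x 0 = (exp (a * x) / (1 + exp x), 0).
Proof.
  unfold mellin_kernel, cexp; apply injective_projections; simpl;
    rewrite ?Rmult_0_l, ?Rmult_0_r, ?Rplus_0_r, ?Rminus_0_r, ?cos_0, ?sin_0, ?Rmult_1_r, ?Rmult_0_r;
    pose proof (exp_pos x); field; lra.
Qed.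

Lemma is_RIntR_mellin_kernel_0 (a : R) : 0 < a < 1 ->
  is_RIntR (fun x => exp (a * x) / (1 + exp x)) (Gamma a * Gamma (1 - a)).
Proof.
  intros Ha; assert (I := is_RIntR_Beta a (1 - a) ltac:(lra) ltac:(lra)).
  replace (a + (1 - a)) with 1 in I by ring.
  rewrite Gamma_1 in I; unfold Rdiv in I; rewrite Rinv_1, Rmult_1_r in I.
  eapply is_RIntR_ext; [| exact I]; intros x; simpl.
  unfold Rminus; rewrite exp_plus, Rmult_1_l, exp_Ropp, exp_ln; auto.
  pose proof (exp_pos x); lra.
Qed.

Lemma cont_C_mellin_kernel (a t x y : R) : PI / 2 < t < PI -> - t < y < t -> cont_C (mellin_kernel a) x y.
Proof.
  intros Ht Hy; unfold mellin_kernel.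
  cont_C_tac; apply (one_plus_cexp_neq_0 t); auto; lra.
Qed.

(** Rotation to [y = 0], where the kernel is real and its integral is the Beta integral with
    parameters [a] and [1 - a]. *)
Lemma is_RIntR_mellin_kernel (a y : R) : 0 < a < 1 -> Rabs y < PI ->
  is_RIntR (fun x => fst (mellin_kernel a x y)) (Gamma a * Gamma (1 - a)) /\
  is_RIntR (fun x => snd (mellin_kernel a x y)) 0.
Proof.
  intros Ha Hy; destruct (exists_strip y Hy) as [t [Ht Hty]].
  assert (P := PI_RGT_0).
  destruct (Cmod_mellin_kernel a t Ht Ha) as [K [d [d0 B]]].
  assert (H0 : - t < 0 < t) by lra.
  assert (Rf := RIntR_rotation_fst (mellin_kernel a) (mellin_kernel' a) (- t) t K d y 0 d0 Hty H0
    (fun x y => mellin_kernel_hol a t x y Ht) (fun x y => mellin_kernel'_cont a t x y Ht) B).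
  assert (Rs := RIntR_rotation_snd (mellin_kernel a) (mellin_kernel' a) (- t) t K d y 0 d0 Hty H0
    (fun x y => mellin_kernel_hol a t x y Ht) (fun x y => mellin_kernel'_cont a t x y Ht) B).
  split.
  - replace (Gamma a * Gamma (1 - a)) with (RIntR (fun x => fst (mellin_kernel a x y))).
    + apply (is_RIntR_dominated _ K d); auto.
      * intros x; apply (continuity_2d_pt_l (fun u v => fst (mellin_kernel a u v))), (cont_C_mellin_kernel a t); auto.
      * intros x; eapply Rle_trans; [apply Rabs_fst_le_Cmod | auto].
    + rewrite Rf; apply is_RIntR_unique.
      eapply is_RIntR_ext; [| apply (is_RIntR_mellin_kernel_0 a Ha)]; intros x; now rewrite mellin_kernel_0.
  - replace 0 with (RIntR (fun x => snd (mellin_kernel a x y))).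
    + apply (is_RIntR_dominated _ K d); auto.
      * intros x; apply (continuity_2d_pt_l (fun u v => snd (mellin_kernel a u v))), (cont_C_mellin_kernel a t); auto.
      * intros x; eapply Rle_trans; [apply Rabs_snd_le_Cmod | auto].
    + rewrite Rs; apply is_RIntR_unique.
      assert (Z := is_RIntR_scal _ 0 _ (is_RIntR_mellin_kernel_0 a Ha)); rewrite Rmult_0_l in Z.
      eapply is_RIntR_ext; [| exact Z].
      intros x; rewrite mellin_kernel_0; simpl; ring.
Qed.

(* The integrand is minus the imaginary part of [exp (- i a y) s^a / (1 + s)]. *)
Lemma is_RIntR_sin_kernel (a y : R) : 0 < a < 1 -> 0 < y < PI ->
  is_RIntR (fun x => exp (a * x) * (sin y / (exp x + exp (- x) + 2 * cos y)))
    (Gamma a * Gamma (1 - a) * sin (a * y)).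
Proof.
  intros Ha Hy.
  destruct (is_RIntR_mellin_kernel a y Ha) as [I1 I2]; [rewrite Rabs_pos_eq; lra |].
  assert (I := is_RIntR_minus _ _ _ _ (is_RIntR_scal _ (sin (a * y)) _ I1)
    (is_RIntR_scal _ (cos (a * y)) _ I2)).
  replace (sin (a * y) * (Gamma a * Gamma (1 - a)) - cos (a * y) * 0)
    with (Gamma a * Gamma (1 - a) * sin (a * y)) in I by ring.
  eapply is_RIntR_ext; [| exact I]; intros x; simpl.
  destruct (exists_strip y) as [t [Ht Hty]]; [rewrite Rabs_pos_eq; lra |].
  assert (Hn := one_plus_cexp_neq_0 t x y Ht ltac:(lra)).
  apply C_neq_0_norm2 in Hn; unfold mellin_kernel, cexp in *; simpl in *.
  replace (a * x - 0 * y) with (a * x) by ring. replace (a * y + 0 * x) with (a * y) by ring.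
  set (e := exp x) in *. set (c := cos y) in *. set (s := sin y) in *.
  assert (E0 : 0 < e) by apply exp_pos.
  assert (T : s * s = 1 - c * c).
  { generalize (sin2_cos2 y); unfold Rsqr, s, c; lra. }
  assert (T2 : sin (a * y) * sin (a * y) = 1 - cos (a * y) * cos (a * y)).
  { generalize (sin2_cos2 (a * y)); unfold Rsqr; lra. }
  rewrite exp_Ropp; fold e.
  (* [D] is [|1 + s|^2]; divided by [e = |s|] it becomes the symmetric denominator of the
     statement. *)
  set (D := 1 + 2 * e * c + e * e).
  replace ((1 + e * c) * ((1 + e * c) * 1) + (0 + e * s) * ((0 + e * s) * 1)) with D in *
    by (unfold D; ring [T]).
  replace (e + / e + 2 * c) with (D / e) by (unfold D; field; lra).
  clearbody D.
  transitivity (exp (a * x) * (e * s) / D * (sin (a * y) * sin (a * y) + cos (a * y) * cos (a * y)));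
    [field; repeat split; auto; lra | rewrite T2; field; repeat split; auto; lra].
Qed.

(** A primitive is [atan (tanh (x / 2) * tan (y / 2))], written with [(exp x - 1) / (exp x + 1)] for
    the hyperbolic tangent. Its limits are [- y / 2] and [y / 2]. *)
Lemma is_RIntR_sin_kernel_0 (y : R) : 0 < y < PI ->
  is_RIntR (fun x => sin y / (exp x + exp (- x) + 2 * cos y)) y.
Proof.
  intros Hy; set (h := y / 2).
  assert (S0 : 0 < sin h) by (apply sin_gt_0; unfold h; lra).
  assert (C0 : 0 < cos h) by (apply cos_gt_0; unfold h; lra).
  assert (T : sin h * sin h + cos h * cos h = 1).
  { generalize (sin2_cos2 h); unfold Rsqr; lra. }
  assert (Ey : y = 2 * h) by (unfold h; field).
  assert (D0 : forall x, exp x + exp (- x) + 2 * cos y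
     = ((exp x + 1) ^ 2 * cos h ^ 2 + (exp x - 1) ^ 2 * sin h ^ 2) / exp x).
  { intros x; rewrite exp_Ropp, Ey, cos_2a; pose proof (exp_pos x).
    set (e := exp x) in *. set (c := cos h) in *. set (s := sin h) in *.
    replace ((e + 1) ^ 2 * c ^ 2 + (e - 1) ^ 2 * s ^ 2)
      with (e ^ 2 * (s * s + c * c) + 2 * e * (c * c - s * s) + (s * s + c * c)) by ring.
    rewrite T; field; lra. }
  assert (Pos : forall x, 0 < (exp x + 1) ^ 2 * cos h ^ 2 + (exp x - 1) ^ 2 * sin h ^ 2).
  { intros x; pose proof (exp_pos x); pose proof (pow2_ge_0 (exp x - 1)).
    pose proof (pow2_ge_0 (sin h)).
    assert (0 < (exp x + 1) ^ 2 * cos h ^ 2) by (apply Rmult_lt_0_compat; apply pow_lt; lra).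
    assert (0 <= (exp x - 1) ^ 2 * sin h ^ 2) by (apply Rmult_le_pos; auto). lra. }
  cut (is_RIntR (fun x => sin y / (exp x + exp (- x) + 2 * cos y)) (h - - h)).
  { intros I; replace (h - - h) with y in I by (unfold h; field); exact I. }
  assert (At : forall l x, is_lim (fun x => (exp x - 1) / (exp x + 1)) x (Finite l) ->
     is_lim (fun x => atan ((exp x - 1) / (exp x + 1) * tan h)) x (Finite (atan (l * tan h)))).
  { intros l x Hl.
    apply (is_lim_comp_continuous (fun x => (exp x - 1) / (exp x + 1)) (fun q => atan (q * tan h)) x l Hl).
    apply (ex_derive_continuous (V := R_NormedModule)); auto_derive; auto. }
  assert (Ah : atan (tan h) = h) by (apply atan_tan; unfold h; lra).
  apply (is_RIntR_derive (fun x => atan ((exp x - 1) / (exp x + 1) * tan h))).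
  - intros x; pose proof (exp_pos x); auto_derive; [lra |].
    rewrite D0, Ey, sin_2a; unfold tan; pose proof (Pos x).
    field; repeat split; lra.
  - intros x; apply continuous_ext with
      (f := fun x => sin y / (((exp x + 1) ^ 2 * cos h ^ 2 + (exp x - 1) ^ 2 * sin h ^ 2) / exp x)).
    + intros u; now rewrite D0.
    + pose proof (Pos x); pose proof (exp_pos x); apply (ex_derive_continuous (V := R_NormedModule)); auto_derive.
      split; [lra |]; split; auto. apply Rgt_not_eq, Rdiv_lt_0_compat; auto.
  - assert (An : atan (-1 * tan h) = - h) by (rewrite <- Ah at 2; rewrite <- atan_opp; f_equal; ring).
    rewrite <- An; apply At.
    apply is_lim_ext with (fun x => 1 - 2 * / (exp x + 1)).
    { intros x; pose proof (exp_pos x); field; lra. }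
    assert (Hc := is_lim_comp_continuous exp (fun e => 1 - 2 * / (e + 1)) m_infty 0 is_lim_exp_m).
    simpl in Hc; replace (1 - 2 * / (0 + 1)) with (-1) in Hc by field. apply Hc.
    apply (ex_derive_continuous (V := R_NormedModule)); auto_derive; lra.
  - assert (Ap : is_lim (fun x => atan ((exp x - 1) / (exp x + 1) * tan h)) p_infty (atan (1 * tan h)));
      [apply At | rewrite Rmult_1_l, Ah in Ap; exact Ap].
    apply is_lim_ext with (fun x => 2 * / (exp (- x) + 1) - 1).
    { intros x; pose proof (exp_pos x); rewrite exp_Ropp; field; repeat split; lra. }
    assert (L : is_lim (fun x => exp (- x)) p_infty 0).
    { apply (is_lim_comp exp (fun x => - x) p_infty 0 m_infty); [apply is_lim_exp_m | |].
      - apply (is_lim_opp (fun x => x) p_infty p_infty), is_lim_id.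
      - exists 0; intros; discriminate. }
    assert (Hc := is_lim_comp_continuous (fun x => exp (- x)) (fun e => 2 * / (e + 1) - 1) p_infty 0 L).
    simpl in Hc; replace (2 * / (0 + 1) - 1) with 1 in Hc by field. apply Hc.
    apply (ex_derive_continuous (V := R_NormedModule)); auto_derive; lra.
Qed.

(** For [u = |x|], [p = exp (- a u)] and [q = exp (- u)], multiplying by [p] reduces the claim to
    [(1 - p)^2 <= (1 - q)^2], which holds because [q <= p <= 1]. *)
Lemma cosh_sub_one_le (a x : R) : 0 < a < 1 ->
  exp (a * x) + exp (- (a * x)) - 2 <= exp (- ((1 - a) * Rabs x)) * (exp x + exp (- x) - 2).
Proof.
  intros Ha.
  assert (Main : forall u, 0 <= u ->
     exp (a * u) + exp (- (a * u)) - 2 <= exp (- ((1 - a) * u)) * (exp u + exp (- u) - 2)).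
  { intros u u0.
    set (p := exp (- (a * u))). set (q := exp (- u)).
    assert (p0 : 0 < p) by apply exp_pos. assert (q0 : 0 < q) by apply exp_pos.
    assert (Ep : exp (a * u) = / p).
    { unfold p; rewrite exp_Ropp, Rinv_inv; auto. }
    assert (Eq : exp u = / q).
    { unfold q; rewrite exp_Ropp, Rinv_inv; auto. }
    assert (Er : exp (- ((1 - a) * u)) = q / p).
    { unfold Rdiv; rewrite <- Ep; unfold q; rewrite <- exp_plus; f_equal; ring. }
    assert (Hqp : q <= p) by (apply exp_le_le; nra).
    assert (Hp1 : p <= 1) by (rewrite <- exp_0; apply exp_le_le; nra).
    rewrite Ep, Eq, Er.
    apply (Rmult_le_reg_l p); auto.
    replace (p * (/ p + p - 2)) with ((1 - p) ^ 2) by (field; lra).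
    replace (p * (q / p * (/ q + q - 2))) with ((1 - q) ^ 2) by (field; lra).
    apply pow_incr; lra. }
  destruct (Rle_dec 0 x).
  - rewrite Rabs_pos_eq by auto; auto.
  - rewrite Rabs_left by lra. generalize (Main (- x) ltac:(lra)).
    rewrite <- !Ropp_mult_distr_r, !Ropp_involutive; lra.
Qed.

(* At [a = 0] the kernel has integral exactly [y]; the excess of the symmetrized kernel
   over it is at most a multiple of [sin y], which disappears as [y] tends to [PI]. *)
Lemma reflection_squeeze (a y : R) : 0 < a < 1 -> 0 < y < PI ->
  y <= Gamma a * Gamma (1 - a) * sin (a * y) <= y + sin y * (2 * (1 / (1 - a))).
Proof.
  intros Ha Hy.
  assert (S0 : 0 < sin y) by (apply sin_gt_0; lra).
  assert (C1 : -1 < cos y) by (rewrite <- cos_PI; apply cos_decreasing_1; lra).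
  assert (E2 : forall x, 0 <= exp x + exp (- x) - 2).
  { intros x; rewrite exp_Ropp; pose proof (exp_pos x).
    replace (exp x + / exp x - 2) with ((exp x - 1) ^ 2 * / exp x) by (field; lra).
    apply Rmult_le_pos; [apply pow2_ge_0 | apply Rlt_le, Rinv_0_lt_compat; auto]. }
  assert (D0 : forall x, 0 < exp x + exp (- x) + 2 * cos y) by (intros x; pose proof (E2 x); lra).
  set (w := fun x => sin y / (exp x + exp (- x) + 2 * cos y)).
  assert (Cw : forall (g : R -> R) x, ex_derive g x -> continuous (fun x => g x * w x) x).
  { intros g x Hg; pose proof (D0 x).
    apply (ex_derive_continuous (V := R_NormedModule)); unfold w; auto_derive; repeat split; auto; lra. }
  assert (I1 := is_RIntR_sin_kernel a y Ha Hy).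
  assert (C1' : forall x, continuous (fun x => exp (a * x) * w x) x).
  { intros x; apply (Cw (fun x => exp (a * x))); auto_derive; auto. }
  assert (I2 := is_RIntR_opp_arg _ _ C1' I1).
  assert (I0 := is_RIntR_sin_kernel_0 y Hy).
  assert (I := is_RIntR_minus _ _ _ _ (is_RIntR_scal _ (1 / 2) _ (is_RIntR_plus _ _ _ _ I1 I2)) I0).
  set (G := Gamma a * Gamma (1 - a) * sin (a * y)) in *.
  replace (1 / 2 * (G + G) - y) with (G - y) in I by field.
  set (f := fun x => 1 / 2 * (exp (a * x) + exp (- (a * x)) - 2) * w x).
  assert (If : is_RIntR f (G - y)).
  { eapply is_RIntR_ext; [| exact I]; intros x; unfold f, w; simpl.
    rewrite Ropp_involutive, (Rplus_comm (exp (- x))), <- Ropp_mult_distr_r; field.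
    apply Rgt_not_eq, D0. }
  assert (Cf : forall x, continuous f x).
  { intros x; apply (Cw (fun x => 1 / 2 * (exp (a * x) + exp (- (a * x)) - 2))); auto_derive; auto. }
  assert (W0 : forall x, 0 < w x) by (intros x; apply Rdiv_lt_0_compat; auto).
  assert (E3 : forall x, 0 <= exp (a * x) + exp (- (a * x)) - 2) by (intros x; apply E2).
  assert (F0 : forall x, 0 <= f x).
  { intros x; unfold f; apply Rmult_le_pos; [pose proof (E3 x); lra | apply Rlt_le, W0]. }
  (* Since [cos y > -1], the denominator of [w] exceeds [exp x + exp (- x) - 2], the very factor
     that [cosh_sub_one_le] produces; what remains is [sin y] times an exponential independent of
     [y]. *)
  assert (Fd : exp_dominated (sin y) (1 - a) f).
  { intros x; rewrite Rabs_pos_eq by auto; unfold f.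
    pose proof (cosh_sub_one_le a x Ha). pose proof (E3 x). pose proof (E2 x).
    set (q := exp (- ((1 - a) * Rabs x))) in *.
    assert (q0 : 0 < q) by apply exp_pos.
    apply Rle_trans with (q * (exp x + exp (- x) - 2) / 2 * w x).
    - apply Rmult_le_compat_r; [apply Rlt_le, W0 | lra].
    - unfold w. pose proof (D0 x).
      apply (Rmult_le_reg_r (exp x + exp (- x) + 2 * cos y)); auto.
      replace (q * (exp x + exp (- x) - 2) / 2 * (sin y / (exp x + exp (- x) + 2 * cos y))
        * (exp x + exp (- x) + 2 * cos y))
        with (sin y * q * ((exp x + exp (- x) - 2) / 2)) by (field; lra).
      apply Rmult_le_compat_l; [apply Rmult_le_pos; lra |]. lra. }
  assert (L1 : 0 <= G - y).
  { apply (is_RIntR_le (fun _ => 0) f 0 (G - y)); auto.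
    - intros x; apply continuous_const.
    - generalize (is_RIntR_scal _ 0 _ If); rewrite Rmult_0_l; apply is_RIntR_ext.
      intros; ring. }
  assert (L2 := RIntR_bound f (sin y) (1 - a) Cf Fd ltac:(lra)).
  rewrite (is_RIntR_unique _ _ If), Rabs_pos_eq in L2 by auto.
  split; [lra |]. replace (2 * (sin y / (1 - a))) with (sin y * (2 * (1 / (1 - a)))) in L2 by (field; lra).
  lra.
Qed.

(** Both outer terms of [reflection_squeeze] tend to [PI] along a sequence [u] increasing to [PI],
    because [sin (u n)] tends to 0; the middle term tends to its value at [y = PI] by continuity. *)
Lemma Gamma_reflection (a : R) : 0 < a < 1 -> Gamma a * Gamma (1 - a) * sin (PI * a) = PI.
Proof.
  intros Ha; assert (P := PI_RGT_0).
  set (u := fun n => PI - PI / (INR n + 2)).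
  assert (Hu : forall n, 0 < u n < PI).
  { intros n; unfold u; pose proof (pos_INR n).
    assert (0 < PI / (INR n + 2)) by (apply Rdiv_lt_0_compat; lra).
    assert (PI / (INR n + 2) < PI); [| lra].
    apply (Rmult_lt_reg_r (INR n + 2)); [lra |].
    replace (PI / (INR n + 2) * (INR n + 2)) with PI by (field; lra). nra. }
  assert (Lu : is_lim_seq u PI).
  { replace (Finite PI) with (Finite (PI - PI * 0)) by (f_equal; ring).
    apply is_lim_seq_minus'; [apply is_lim_seq_const |].
    apply (is_lim_seq_scal_l (fun n => / (INR n + 2)) PI 0).
    apply (is_lim_seq_inv (fun n => INR n + 2) p_infty); [| discriminate].
    apply (is_lim_seq_plus INR (fun _ => 2) p_infty 2 p_infty);
      [apply is_lim_seq_INR | apply is_lim_seq_const | reflexivity]. }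
  assert (Lc : forall g, ex_derive g PI -> is_lim_seq (fun n => g (u n)) (g PI)).
  { intros g Hg; apply is_lim_seq_continuous; auto.
    apply continuity_pt_filterlim, (ex_derive_continuous (V := R_NormedModule)); auto. }
  set (G := Gamma a * Gamma (1 - a)).
  assert (L : is_lim_seq (fun n => G * sin (a * u n)) PI).
  { apply (is_lim_seq_le_le u (fun n => G * sin (a * u n)) (fun n => u n + sin (u n) * (2 * (1 / (1 - a))))); auto.
    - intros n; apply reflection_squeeze; auto.
    - assert (H := Lc (fun y => y + sin y * (2 * (1 / (1 - a)))) ltac:(auto_derive; auto)).
      simpl in H; rewrite sin_PI, Rmult_0_l, Rplus_0_r in H; exact H. }
  assert (L' := Lc (fun y => G * sin (a * y)) ltac:(auto_derive; auto)).
  apply is_lim_seq_unique in L, L'; simpl in L'; rewrite L in L'; injection L' as E.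
  rewrite (Rmult_comm PI a); auto.
Qed.

(** * The reciprocal Gamma function on the whole line *)

Lemma poch_shift (x : R) (n : nat) : poch x (S n) = x * poch (x + 1) n.
Proof.
  induction n as [| n IH]; [simpl; ring |].
  change (poch x (S (S n))) with (poch x (S n) * (x + INR (S n))).
  rewrite IH, S_INR. change (poch (x + 1) (S n)) with (poch (x + 1) n * (x + 1 + INR n)). ring.
Qed.

(** For [x <= 0] the shift used in [rgamma x] is at least 1, and it drops by exactly one at [x + 1]:
    both sides evaluate [Gamma] at the same point and differ by the first factor [x] of the
    product. *)
Lemma rgamma_nonpos (x : R) : x <= 0 -> rgamma x = x * rgamma (x + 1).
Proof.
  intros Hx; unfold rgamma.
  destruct (archimed (- x)) as [A1 A2].
  assert (Eup : up (- (x + 1)) = (up (- x) - 1)%Z).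
  { symmetry; apply tech_up; rewrite minus_IZR; lra. }
  rewrite Eup.
  assert (Hz : (0 < up (- x))%Z) by (apply lt_IZR; lra).
  replace (Z.to_nat (up (- x))) with (S (Z.to_nat (up (- x) - 1))) by lia.
  rewrite poch_shift, S_INR.
  set (n := Z.to_nat (up (- x) - 1)).
  replace (x + (INR n + 1)) with (x + 1 + INR n) by ring.
  unfold Rdiv; ring.
Qed.

Lemma rgamma_pos (x : R) : 0 < x -> x <= 1 -> rgamma x = / Gamma x.
Proof.
  intros H0 H1; unfold rgamma.
  replace (up (- x)) with 0%Z by (apply tech_up; simpl; lra).
  simpl; rewrite Rplus_0_r; unfold Rdiv; ring.
Qed.

(** On [(0, 1)] this is [Gamma_reflection]; at [a = 1] both sides vanish. Larger [a] follow by unit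
    steps, since the functional equations of [rgamma] and [Gamma] and the sign change of the sine
    match. *)
Lemma rgamma_reflection (a : R) : 0 < a -> rgamma (1 - a) = Gamma a * sin (PI * a) / PI.
Proof.
  intros a0; assert (P := PI_RGT_0).
  assert (Base : forall a, 0 < a <= 1 -> rgamma (1 - a) = Gamma a * sin (PI * a) / PI).
  { clear a a0; intros a [a0 a1]; destruct (Req_dec a 1) as [-> | Hn].
    - rewrite Rminus_diag, rgamma_nonpos by lra.
      rewrite Rmult_1_r, sin_PI; unfold Rdiv; ring.
    - rewrite rgamma_pos by lra.
      assert (E := Gamma_reflection a ltac:(lra)).
      assert (G1 := Gamma_pos (1 - a) ltac:(lra)).
      apply (Rmult_eq_reg_l (Gamma (1 - a) * PI)); [| apply Rgt_not_eq; nra].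
      replace (Gamma (1 - a) * PI * / Gamma (1 - a)) with PI by (field; lra).
      rewrite <- E at 1; field; lra. }
  assert (Ind : forall n a, 0 < a <= INR n + 1 -> rgamma (1 - a) = Gamma a * sin (PI * a) / PI).
  { induction n as [| n IH]; intros b Hb.
    - apply Base; simpl in Hb; lra.
    - destruct (Rle_dec b 1); [apply Base; lra |].
      rewrite S_INR in Hb.
      rewrite rgamma_nonpos by lra.
      replace (1 - b + 1) with (1 - (b - 1)) by ring; rewrite IH by lra.
      replace b with (b - 1 + 1) at 4 by ring; rewrite Gamma_plus_1 by lra.
      replace (PI * b) with (PI * (b - 1) + PI) by ring; rewrite neg_sin. field; lra. }
  destruct (INR_unbounded a) as [n Hn].
  apply (Ind n); lra.
Qed.

(** * Wright functions as ray integrals *)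

Lemma cexp_neq_0 (z : C) : cexp z <> 0%C.
Proof.
  intros H; pose proof (exp_pos (fst z)) as P; rewrite <- Cmod_cexp, H, Cmod_0 in P; lra.
Qed.

(** With [s = exp (r + i y)] and [p = exp e], the quotient [p^a / (s + p)] is [s^(a - 1)] times the
    Mellin kernel at [p / s], a point of argument [- y]; the shift by [r] leaves the integral
    unchanged. *)
Lemma is_RIntR_power_resolvent (a r y : R) : 0 < a < 1 -> Rabs y < PI ->
  is_RIntR (fun e => fst (exp (a * e)%R * / (cexp (r, y) + exp e))%C)
    (fst (cexp ((a - 1) * (r, y))%C) * (Gamma a * Gamma (1 - a))) /\
  is_RIntR (fun e => snd (exp (a * e)%R * / (cexp (r, y) + exp e))%C)
    (snd (cexp ((a - 1) * (r, y))%C) * (Gamma a * Gamma (1 - a))).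
Proof.
  intros Ha Hy; set (c := cexp ((a - 1) * (r, y))%C).
  assert (E : forall e, (exp (a * e)%R * / (cexp (r, y) + exp e))%C = (c * mellin_kernel a (e + - r) (- y))%C).
  { intros e; unfold mellin_kernel, c.
    destruct (exists_strip (- y)) as [t [Ht Hty]]; [rewrite Rabs_Ropp; auto |].
    assert (N1 := one_plus_cexp_neq_0 t (e + - r) (- y) Ht ltac:(lra)).
    assert (N2 := cexp_neq_0 (r, y)).
    assert (E1 : (cexp (r, y) * cexp ((e + - r)%R, (- y)%R))%C = exp e).
    { rewrite <- cexp_plus. unfold cexp; apply injective_projections; simpl;
        replace (y + - y) with 0 by ring; rewrite ?cos_0, ?sin_0, ?Rmult_1_r, ?Rmult_0_r; auto.
      f_equal; ring. }
    assert (E2 : (cexp ((a - 1) * (r, y)) * cexp (a * ((e + - r)%R, (- y)%R)) * cexp (r, y))%C = exp (a * e)%R).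
    { rewrite <- !cexp_plus. unfold cexp; apply injective_projections; simpl.
      - replace (exp (a * e)) with (exp (a * e) * cos 0) by (rewrite cos_0; ring); f_equal; f_equal; ring.
      - transitivity (exp (a * e) * sin 0); [f_equal; f_equal; ring | rewrite sin_0; ring]. }
    rewrite <- E1, <- E2.
    assert (N3 : (cexp (r, y) + cexp (r, y) * cexp ((e + - r)%R, (- y)%R))%C <> 0%C).
    { replace (cexp (r, y) + cexp (r, y) * cexp ((e + - r)%R, (- y)%R))%C
        with (cexp (r, y) * (1 + cexp ((e + - r)%R, (- y)%R)))%C by ring.
      apply Cmult_neq_0; auto. }
    field; auto. }
  destruct (exists_strip (- y)) as [t [Ht Hty]]; [rewrite Rabs_Ropp; auto |].
  destruct (is_RIntR_mellin_kernel a (- y) Ha) as [I1 I2]; [rewrite Rabs_Ropp; auto |].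
  apply (is_RIntR_shift _ (- r)) in I1, I2;
    [| intros x; apply (continuity_2d_pt_l (fun u v => snd (mellin_kernel a u v))), (cont_C_mellin_kernel a t); auto
     | intros x; apply (continuity_2d_pt_l (fun u v => fst (mellin_kernel a u v))), (cont_C_mellin_kernel a t); auto].
  split.
  - assert (I := is_RIntR_minus _ _ _ _ (is_RIntR_scal _ (fst c) _ I1) (is_RIntR_scal _ (snd c) _ I2)).
    rewrite Rmult_0_r, Rminus_0_r in I.
    eapply is_RIntR_ext; [| exact I]; intros e; rewrite E; reflexivity.
  - assert (I := is_RIntR_plus _ _ _ _ (is_RIntR_scal _ (snd c) _ I1) (is_RIntR_scal _ (fst c) _ I2)).
    rewrite Rmult_0_r, Rplus_0_r in I.
    eapply is_RIntR_ext; [| exact I]; intros e; rewrite E; simpl; ring.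
Qed.

(** By exchange of integrations, the integral of [RIntR G] over [[a, b]] is the increment of
    [RIntR F]; as [RIntR G] is continuous, the fundamental theorem gives the derivative. *)
Lemma is_derive_RIntR (F G : R -> R -> R) (lo hi K d y : R) : 0 < d -> lo < y < hi ->
  (forall x v, lo < v < hi -> is_derive (F x) v (G x v)) ->
  cont_strip G lo hi ->
  (forall v, lo < v < hi -> forall x, continuous (fun u => F u v) x) ->
  (forall v, lo < v < hi -> exp_dominated K d (fun x => F x v)) ->
  (forall v, lo < v < hi -> exp_dominated K d (fun x => G x v)) ->
  is_derive (fun v => RIntR (fun x => F x v)) y (RIntR (fun x => G x y)).
Proof.
  intros d0 Hy DF CG CF BF BG.
  assert (CI : forall v, lo < v < hi -> continuous (fun v => RIntR (fun x => G x v)) v).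
  { intros v Hv; apply (cont_strip_RIntR G lo hi CG K d); auto. }
  assert (Inc : forall a b, lo < a -> a <= b -> b < hi ->
     RInt (fun v => RIntR (fun x => G x v)) a b = RIntR (fun x => F x b) - RIntR (fun x => F x a)).
  { intros a b Ha Hab Hb.
    assert (I1 := RIntR_RInt_Fubini G lo hi CG K d a b d0 Ha Hab Hb BG).
    assert (Ia : lo < a < hi) by lra. assert (Ib : lo < b < hi) by lra.
    assert (I2 : is_RIntR (fun x => F x b - F x a) (RIntR (fun x => F x b) - RIntR (fun x => F x a))).
    { exact (is_RIntR_minus _ _ _ _ (is_RIntR_dominated _ K d (CF b Ib) (BF b Ib) d0)
        (is_RIntR_dominated _ K d (CF a Ia) (BF a Ia) d0)). }
    apply (is_RIntR_unique2 (fun x => F x b - F x a)); [| exact I2].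
    eapply is_RIntR_ext; [| exact I1]; intros x; simpl.
    apply is_RInt_unique, (is_RInt_derive (V := R_CompleteNormedModule) (F x)).
    - intros v Hv; rewrite Rmin_left, Rmax_right in Hv by lra; apply DF; lra.
    - intros v Hv; rewrite Rmin_left, Rmax_right in Hv by lra; apply continuity_2d_pt_r, CG; lra. }
  assert (Ex : forall v, lo < v < hi -> ex_RInt (fun v => RIntR (fun x => G x v)) y v).
  { intros v Hv; apply (ex_RInt_continuous (V := R_CompleteNormedModule)); intros z Hz; apply CI.
    revert Hz; unfold Rmin, Rmax; destruct (Rle_dec y v); lra. }
  apply is_derive_ext_loc with
    (f := fun v => RIntR (fun x => F x y) + RInt (fun v => RIntR (fun x => G x v)) y v).
  - generalize (locally_between lo hi y Hy); apply filter_imp; intros v Hv.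
    match goal with |- @eq _ ?a ?b => change (@eq R a b) end.
    destruct (Rle_dec y v).
    + rewrite Inc by lra; ring.
    + rewrite <- (opp_RInt_swap (V := R_CompleteNormedModule)) by (apply ex_RInt_swap; auto).
      unfold opp; simpl; rewrite Inc by lra; ring.
  - rewrite <- (Rplus_0_l (RIntR (fun x => G x y))).
    apply (is_derive_plus (V := R_NormedModule)).
    + apply (is_derive_const (V := R_NormedModule)).
    + apply (is_derive_RInt (V := R_CompleteNormedModule) (fun v => RIntR (fun x => G x v)) _ y); [| apply CI; auto].
      generalize (locally_between lo hi y Hy); apply filter_imp; intros v Hv.
      apply (RInt_correct (V := R_CompleteNormedModule)); auto.
Qed.

Lemma exp_exp_dominated_lower (a b nu Z : R) : 0 < a -> 0 < b -> 0 < nu < 1 -> 0 <= Z ->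
  exists K, forall x, exp (a * x - b * exp x + Z * exp (nu * x)) <= K * exp (- (a * Rabs x)).
Proof.
  intros a0 b0 n0 Z0.
  destruct (exp_exp_dominated a (b / 2) 1 a0 ltac:(lra) Rlt_0_1) as [K HK].
  (* Beyond [x0] the term [Z exp (nu x)] is absorbed by half of [b exp x]; before [x0] it is bounded
     by a constant. The [+ 1] keeps the logarithm defined when [Z = 0]. *)
  set (x0 := ln (2 * (Z + 1) / b) / (1 - nu)).
  exists (exp (Z * exp (nu * x0)) * K); intros x.
  apply Rle_trans with (exp (Z * exp (nu * x0)) * exp (a * x - b / 2 * exp (1 * x))).
  - rewrite <- exp_plus; apply exp_le_le; rewrite Rmult_1_l.
    assert (P : 0 <= Z * exp (nu * x0)) by (apply Rmult_le_pos; [auto | apply Rlt_le, exp_pos]).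
    destruct (Rle_dec x x0) as [H | H].
    + assert (Z * exp (nu * x) <= Z * exp (nu * x0)).
      { apply Rmult_le_compat_l; auto; apply exp_le_le; nra. }
      pose proof (exp_pos x). nra.
    + assert (Hx : 2 * (Z + 1) / b <= exp ((1 - nu) * x)).
      { rewrite <- (exp_ln (2 * (Z + 1) / b)) by (apply Rdiv_lt_0_compat; lra).
        apply exp_le_le. replace (ln (2 * (Z + 1) / b)) with ((1 - nu) * x0) by (unfold x0; field; lra).
        nra. }
      assert (Ex : exp x = exp ((1 - nu) * x) * exp (nu * x)) by (rewrite <- exp_plus; f_equal; ring).
      pose proof (exp_pos (nu * x)).
      assert (Z * exp (nu * x) <= b / 2 * exp x); [| lra].
      rewrite Ex, <- Rmult_assoc. apply Rmult_le_compat_r; [lra |].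
      apply (Rmult_le_compat_l (b / 2)) in Hx; [| lra].
      replace (b / 2 * (2 * (Z + 1) / b)) with (Z + 1) in Hx by (field; lra). lra.
  - rewrite Rmult_assoc; apply Rmult_le_compat_l; [apply Rlt_le, exp_pos | apply HK].
Qed.

Section Ray.

Variables nu th : R.
Hypothesis Hnu : 0 < nu < 1 / 2.
Hypothesis Hth : PI / 2 < th < PI.

(* imaginary part of [s^c exp (t s - z s^nu)] at [s = exp (x + i th)] *)
Definition ray_kernel (c t z x : R) : R :=
  exp (c * x + t * cos th * exp x - z * cos (nu * th) * exp (nu * x))
  * sin (c * th + t * sin th * exp x - z * sin (nu * th) * exp (nu * x)).

(** Inverse Laplace integral of [s^(c - 1) exp (- z s^nu)] at time [t] over a Hankel contour:
    [ds / s] is [dx], and the two conjugate rays together give [2 i] times the imaginary part of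
    one, against the factor [1 / (2 PI i)]. *)
Definition ray_int (c t z : R) : R := RIntR (ray_kernel c t z) / PI.

Lemma cos_th_neg : cos th < 0.
Proof. pose proof PI_RGT_0; apply cos_lt_0; lra. Qed.

Lemma cos_nu_th_pos : 0 < cos (nu * th).
Proof. pose proof PI_RGT_0; apply cos_gt_0; nra. Qed.

Lemma continuous_ray_kernel c t z x : continuous (ray_kernel c t z) x.
Proof. unfold ray_kernel; cont_1d. Qed.

Lemma Rabs_exp_sin_le (u v : R) : Rabs (exp u * sin v) <= exp u.
Proof.
  rewrite Rabs_mult, (Rabs_pos_eq (exp u)) by (apply Rlt_le, exp_pos).
  rewrite <- (Rmult_1_r (exp u)) at 2; apply Rmult_le_compat_l; [apply Rlt_le, exp_pos |].
  apply Rabs_le; pose proof (SIN_bound v); lra.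
Qed.

Lemma ray_kernel_bound_z (c t z Z x : R) : Rabs z <= Z ->
  Rabs (ray_kernel c t z x) <= exp (c * x - t * - cos th * exp x + Z * exp (nu * x)).
Proof.
  intros Hz; unfold ray_kernel; eapply Rle_trans; [apply Rabs_exp_sin_le |].
  apply exp_le_le.
  assert (E := exp_pos (nu * x)). assert (C0 := cos_nu_th_pos).
  assert (C1 : cos (nu * th) <= 1) by apply COS_bound.
  assert (- z * cos (nu * th) <= Z).
  { pose proof (Rle_abs (- z)); rewrite Rabs_Ropp in *; pose proof (Rabs_pos z). nra. }
  nra.
Qed.

Lemma ray_kernel_dominated_z (c Z : R) : 0 < c -> 0 <= Z ->
  exists K, forall z, Rabs z <= Z -> exp_dominated K c (ray_kernel c 1 z).
Proof.
  intros c0 Z0.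
  destruct (exp_exp_dominated_lower c (1 * - cos th) nu Z c0) as [K HK];
    [pose proof cos_th_neg; lra | lra | auto |].
  exists K; intros z Hz x; eapply Rle_trans; [apply (ray_kernel_bound_z c 1 z Z x Hz) | apply HK].
Qed.

(** Differentiating in [z] brings down [- s^nu], which raises the exponent [c] by [nu]. *)
Lemma is_derive_ray_int (c z : R) : 0 < c ->
  is_derive (ray_int c 1) z (- ray_int (c + nu) 1 z).
Proof.
  intros c0; assert (P := PI_RGT_0).
  assert (Z0 : 0 <= Rabs z + 1) by (pose proof (Rabs_pos z); lra).
  destruct (ray_kernel_dominated_z c (Rabs z + 1) c0 Z0) as [K1 H1].
  destruct (ray_kernel_dominated_z (c + nu) (Rabs z + 1) ltac:(lra) Z0) as [K2 H2].
  assert (Hz : forall v, z - 1 < v < z + 1 -> Rabs v <= Rabs z + 1).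
  { intros v Hv; apply Rabs_le; pose proof (Rle_abs z); pose proof (Rle_abs (- z));
      rewrite Rabs_Ropp in *; lra. }
  assert (K10 : 0 <= K1) by apply (exp_dominated_pos _ _ _ (H1 z ltac:(lra))).
  assert (K20 : 0 <= K2) by apply (exp_dominated_pos _ _ _ (H2 z ltac:(lra))).
  assert (D : is_derive (fun v => RIntR (fun x => ray_kernel c 1 v x)) z
     (RIntR (fun x => - ray_kernel (c + nu) 1 z x))).
  { apply (is_derive_RIntR (fun x v => ray_kernel c 1 v x) (fun x v => - ray_kernel (c + nu) 1 v x)
      (z - 1) (z + 1) (K1 + K2) c); auto; try lra.
    - intros x v _; unfold ray_kernel; auto_derive; auto.
      replace ((c + nu) * th + 1 * sin th * exp x - v * sin (nu * th) * exp (nu * x))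
        with ((c * th + 1 * sin th * exp x - v * sin (nu * th) * exp (nu * x)) + nu * th) by ring.
      rewrite (sin_plus (_ - _) (nu * th)).
      replace (exp ((c + nu) * x + 1 * cos th * exp x - v * cos (nu * th) * exp (nu * x)))
        with (exp (c * x + 1 * cos th * exp x + - (v * cos (nu * th) * exp (nu * x))) * exp (nu * x))
        by (rewrite <- exp_plus; f_equal; ring).
      unfold Rminus; ring.
    - intros x v _; unfold ray_kernel; cont_2d.
    - intros v _ x; apply continuous_ray_kernel.
    - intros v Hv x; eapply Rle_trans; [apply (H1 v (Hz v Hv)) |].
      apply Rmult_le_compat_r; [apply Rlt_le, exp_pos | lra].
    - intros v Hv x; rewrite Rabs_Ropp; eapply Rle_trans; [apply (H2 v (Hz v Hv)) |].
      pose proof (exp_pos (- (c * Rabs x))).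
      assert (exp (- ((c + nu) * Rabs x)) <= exp (- (c * Rabs x))).
      { apply exp_le_le; pose proof (Rabs_pos x); nra. }
      apply Rmult_le_compat; auto; try lra. apply Rlt_le, exp_pos. }
  assert (I := is_RIntR_scal _ (-1) _ (is_RIntR_dominated _ K2 (c + nu)
     (continuous_ray_kernel (c + nu) 1 z) (H2 z ltac:(lra)) ltac:(lra))).
  assert (E : RIntR (fun x => - ray_kernel (c + nu) 1 z x) = -1 * RIntR (ray_kernel (c + nu) 1 z)).
  { apply is_RIntR_unique; eapply is_RIntR_ext; [| exact I]; intros x; simpl; ring. }
  rewrite E in D.
  unfold ray_int.
  replace (- (RIntR (ray_kernel (c + nu) 1 z) / PI))
    with (-1 * RIntR (ray_kernel (c + nu) 1 z) * / PI) by (field; lra).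
  apply (is_derive_ext (fun v => scal (RIntR (fun x => ray_kernel c 1 v x)) (/ PI))).
  { intros v; reflexivity. }
  apply (is_derive_scal_l (V := R_NormedModule) (fun v => RIntR (fun x => ray_kernel c 1 v x))); auto.
Qed.

Lemma is_derive_n_ray_int (c : R) (n : nat) (z : R) : 0 < c ->
  is_derive_n (ray_int c 1) n z ((-1) ^ n * ray_int (c + nu * INR n) 1 z).
Proof.
  intros c0; revert z; induction n as [| n IH]; intros z.
  - simpl; rewrite Rmult_0_r, Rplus_0_r; ring.
  - change (is_derive (Derive_n (ray_int c 1) n) z ((-1) ^ S n * ray_int (c + nu * INR (S n)) 1 z)).
    apply (is_derive_ext (fun z => (-1) ^ n * ray_int (c + nu * INR n) 1 z)).
    + intros t; symmetry; apply is_derive_n_unique, IH.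
    + replace ((-1) ^ S n * ray_int (c + nu * INR (S n)) 1 z)
        with ((-1) ^ n * - ray_int (c + nu * INR n + nu) 1 z).
      * apply (is_derive_scal (fun z => ray_int (c + nu * INR n) 1 z)).
        apply is_derive_ray_int. pose proof (pos_INR n); nra.
      * rewrite S_INR. replace (c + nu * (INR n + 1)) with (c + nu * INR n + nu) by ring. simpl; ring.
Qed.

Lemma pow_div_fact_le_exp (w : R) (n : nat) : 0 <= w -> w ^ n / INR (fact n) <= exp w.
Proof.
  intros w0.
  assert (H := is_exp_Reals w). 
  assert (Hs : ex_series (fun k => w ^ k / INR (fact k))).
  { exists (exp w). eapply is_series_ext; [| apply H].
    intros k; simpl; unfold scal; simpl; unfold mult; simpl. rewrite pow_n_pow. field. apply INR_fact_neq_0. }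
  assert (Es : Series (fun k => w ^ k / INR (fact k)) = exp w).
  { apply is_series_unique. eapply is_series_ext; [| apply H].
    intros k; simpl; unfold scal; simpl; unfold mult; simpl. rewrite pow_n_pow. field. apply INR_fact_neq_0. }
  assert (P : forall k, 0 <= w ^ k / INR (fact k)).
  { intros k; apply Rmult_le_pos; [apply pow_le; auto | apply Rlt_le, Rinv_0_lt_compat, INR_fact_lt_0]. }
  rewrite <- Es, (Series_incr_n _ (S n)) by (auto; lia).
  simpl pred.
  assert (w ^ n / INR (fact n) <= sum_f_R0 (fun k => w ^ k / INR (fact k)) n).
  { destruct n; [simpl; lra |]. rewrite tech5. 
    assert (0 <= sum_f_R0 (fun k => w ^ k / INR (fact k)) n) by (apply cond_pos_sum; auto). lra. }
  assert (0 <= Series (fun k => w ^ (S n + k) / INR (fact (S n + k)))).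
  { rewrite <- (Rmult_0_l (Series (fun k => w ^ (S n + k) / INR (fact (S n + k))))), <- Series_scal_l.
    apply Series_le; [intros k; pose proof (P (S n + k)%nat); lra |].
    apply (ex_series_incr_n (fun k => w ^ k / INR (fact k)) (S n)); auto. }
  lra.
Qed.

(** Rotation to the negative axis [y = PI], where [exp s] becomes [exp (- r)] and the power
    contributes [sin (PI a)]; the reflection formula turns the result into a reciprocal Gamma
    value. *)
Lemma ray_int_0 (a : R) : 0 < a -> ray_int a 1 0 = rgamma (1 - a).
Proof.
  intros a0; assert (P := PI_RGT_0).
  (* The strip is symmetric about [PI], so that [PI] is an interior height. With [z = 0] the
     integrand is entire in [x + i y], and [cos y <= cos lo < 0] holds on the whole strip. *)
  set (lo := (PI / 2 + th) / 2). set (hi := 2 * PI - lo).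
  assert (Hlo : PI / 2 < lo < th) by (unfold lo; lra).
  assert (C0 : cos lo < 0) by (apply cos_lt_0; lra).
  assert (Cy : forall y, lo < y < hi -> cos y <= cos lo).
  { intros y Hy. destruct (Rle_dec y PI).
    - apply cos_decr_1; lra.
    - replace (cos y) with (cos (2 * PI - y)).
      + apply cos_decr_1; unfold hi in Hy; lra.
      + rewrite cos_minus, cos_2PI, sin_2PI; ring. }
  destruct (Gamma_integrand_dominated a (- cos lo) a0 ltac:(lra)) as [K HK].
  assert (Rot : RIntR (fun x => snd (cexp (a * (x, th) + cexp (x, th))%C))
              = RIntR (fun x => snd (cexp (a * (x, PI) + cexp (x, PI))%C))).
  { apply (RIntR_rotation_snd (fun x y => cexp (a * (x, y) + cexp (x, y)))%C
      (fun x y => cexp (a * (x, y) + cexp (x, y)) * (a * 1 + cexp (x, y) * 1))%C lo hi K a);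
      try (unfold hi; lra); intros x y Hy.
    - apply (is_hol_cexp (fun x y => a * (x, y) + cexp (x, y))%C (fun x y => a * 1 + cexp (x, y) * 1)%C).
      apply is_hol_plus.
      + apply (is_hol_scal a (fun u v => (u, v)) (fun _ _ => 1%C)), is_hol_id.
      + apply (is_hol_cexp (fun u v => (u, v)) (fun _ _ => 1%C)), is_hol_id.
    - cont_C_tac.
    - rewrite Cmod_cexp; generalize (HK x); rewrite Rabs_pos_eq by (apply Rlt_le, exp_pos).
      apply Rle_trans; apply exp_le_le; simpl. pose proof (exp_pos x). pose proof (Cy y Hy). nra. }
  assert (E1 : RIntR (fun x => snd (cexp (a * (x, th) + cexp (x, th))%C)) = RIntR (ray_kernel a 1 0)).
  { apply RIntR_ext; intros x; unfold ray_kernel, cexp; simpl. f_equal; f_equal; ring. }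
  assert (E2 : RIntR (fun x => snd (cexp (a * (x, PI) + cexp (x, PI))%C)) = sin (PI * a) * Gamma a).
  { apply is_RIntR_unique.
    eapply is_RIntR_ext; [| apply (is_RIntR_scal _ (sin (PI * a)) _ (is_RIntR_Gamma a a0))].
    intros x; unfold cexp; simpl; rewrite cos_PI, sin_PI, Rmult_comm; f_equal; f_equal; ring. }
  unfold ray_int; rewrite <- E1, Rot, E2, rgamma_reflection by auto; field; lra.
Qed.

(** Geometric decay of Taylor remainders. The term [(2 Z exp (nu x))^n / n!] is at most
    [exp (2 Z exp (nu x))], of lower order than the decay of [exp s] because [nu < 1]; the factor 2
    yields [(1 / 2)^n]. *)
Lemma ray_int_tail_bound (c Z : R) : 0 < c -> 0 <= Z -> exists B, forall n z, Rabs z <= Z ->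
  Rabs (ray_int (c + nu * INR n) 1 z) * (Z ^ n / INR (fact n)) <= B * (1 / 2) ^ n.
Proof.
  intros c0 Z0; assert (P := PI_RGT_0).
  (* [3 * Z] is [2 * Z] from the Taylor term plus [Z] from the factor with [z]. *)
  destruct (exp_exp_dominated_lower c (1 * - cos th) nu (3 * Z) c0) as [K HK];
    [pose proof cos_th_neg; lra | lra | lra |].
  exists (2 * (K / c) / PI); intros n z Hz.
  set (f := fun x => (2 ^ n * (Z ^ n / INR (fact n))) * ray_kernel (c + nu * INR n) 1 z x).
  assert (n0 := pos_INR n).
  assert (W0 : 0 <= Z ^ n / INR (fact n)).
  { apply Rmult_le_pos; [apply pow_le; auto | apply Rlt_le, Rinv_0_lt_compat, INR_fact_lt_0]. }
  assert (T0 : 0 < 2 ^ n) by (apply pow_lt; lra).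
  assert (Hf : exp_dominated K c f).
  { intros x; unfold f; rewrite Rabs_mult, (Rabs_pos_eq (2 ^ n * _)) by (apply Rmult_le_pos; lra).
    eapply Rle_trans; [apply Rmult_le_compat_l; [apply Rmult_le_pos; lra |];
      apply (ray_kernel_bound_z _ 1 z Z x Hz) |].
    eapply Rle_trans; [| apply HK].
    set (e := exp (nu * x)). assert (e0 : 0 < e) by apply exp_pos.
    set (X := c * x - 1 * - cos th * exp x + Z * e).
    replace ((c + nu * INR n) * x - 1 * - cos th * exp x + Z * e)
      with (INR n * (nu * x) + X) by (unfold X; ring).
    replace (c * x - 1 * - cos th * exp x + 3 * Z * e)
      with (2 * Z * e + X) by (unfold X; ring).
    rewrite (exp_plus (INR n * (nu * x)) X), (exp_plus (2 * Z * e) X), <- Rmult_assoc.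
    replace (exp (INR n * (nu * x))) with (e ^ n).
    2: { unfold e; rewrite <- Rpower_pow by apply exp_pos. unfold Rpower; rewrite ln_exp; f_equal. }
    apply Rmult_le_compat_r; [apply Rlt_le, exp_pos |].
    replace (2 ^ n * (Z ^ n / INR (fact n)) * e ^ n) with ((2 * Z * e) ^ n / INR (fact n)).
    - apply pow_div_fact_le_exp. apply Rmult_le_pos; lra.
    - rewrite !Rpow_mult_distr; unfold Rdiv; ring. }
  assert (Cf : forall x, continuous f x) by (intros x; unfold f, ray_kernel; cont_1d).
  assert (Bf := RIntR_bound f K c Cf Hf c0).
  destruct (ray_kernel_dominated_z (c + nu * INR n) Z ltac:(nra) Z0) as [K2 H2].
  assert (I : is_RIntR f (2 ^ n * (Z ^ n / INR (fact n)) * RIntR (ray_kernel (c + nu * INR n) 1 z))).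
  { apply is_RIntR_scal, (is_RIntR_dominated _ K2 (c + nu * INR n)); [| exact (H2 z Hz) | nra].
    apply continuous_ray_kernel. }
  rewrite (is_RIntR_unique _ _ I), Rabs_mult, (Rabs_pos_eq (2 ^ n * _)) in Bf by (apply Rmult_le_pos; lra).
  unfold ray_int. unfold Rdiv at 1; rewrite Rabs_mult, (Rabs_pos_eq (/ PI)) by (apply Rlt_le, Rinv_0_lt_compat; auto).
  apply (Rmult_le_reg_l (2 ^ n)); auto.
  replace (2 ^ n * (2 * (K / c) / PI * (1 / 2) ^ n)) with (2 * (K / c) / PI).
  - apply (Rmult_le_reg_r PI); auto.
    replace (2 * (K / c) / PI * PI) with (2 * (K / c)) by (field; lra).
    eapply Rle_trans; [| exact Bf]. apply Req_le. field. split; [apply INR_fact_neq_0 | lra].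
  - replace (1 / 2) with (/ 2) by field. rewrite pow_inv. field. repeat split; lra.
Qed.

(** * The Wright function as an entire power series *)

Definition Wright_coef (b : R) (n : nat) : R := / INR (fact n) * rgamma (INR n * - nu + b).

Lemma Wright_PSeries (z b : R) : Wright z (- nu) b = PSeries (Wright_coef b) z.
Proof.
  apply Series_ext; intros n; unfold Wright_coef; field; apply INR_fact_neq_0.
Qed.

(** Taylor's formula at 0 for [ray_int c 1]: the [n]-th derivative at 0 is [(-1)^n] times a
    reciprocal Gamma value, and [ray_int_tail_bound] sends the Lagrange remainder to 0. *)
Lemma is_series_ray_int (c z : R) : 0 < c -> 0 < z ->
  is_series (fun n => Wright_coef (1 - c) n * (- z) ^ n) (ray_int c 1 z).
Proof.
  intros c0 z0.
  destruct (ray_int_tail_bound c z c0 (Rlt_le _ _ z0)) as [B HB].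
  assert (Ediff : forall n, Rabs (sum_n (fun n => Wright_coef (1 - c) n * (- z) ^ n) n - ray_int c 1 z)
     <= B * (1 / 2) ^ S n).
  { intros n.
    destruct (Taylor_Lagrange (ray_int c 1) n 0 z z0) as [zeta [Hzeta E]].
    { intros t _ k _. destruct k; [exact I |].
      eexists; exact (is_derive_n_ray_int c (S k) t c0). }
    rewrite E, sum_n_Reals.
    rewrite (sum_eq _ (fun m => (z - 0) ^ m / INR (fact m) * Derive_n (ray_int c 1) m 0)).
    - match goal with |- Rabs (?s - (?s + ?r)) <= _ => replace (s - (s + r)) with (- r) by ring end.
      rewrite Rabs_Ropp, (is_derive_n_unique _ _ _ _ (is_derive_n_ray_int c (S n) zeta c0)).
      rewrite Rminus_0_r.
      rewrite !Rabs_mult, pow_1_abs, Rmult_1_l, Rmult_comm, (Rabs_pos_eq (z ^ S n / INR (fact (S n)))).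
      + apply HB. rewrite Rabs_pos_eq; lra.
      + apply Rmult_le_pos; [apply pow_le; lra | apply Rlt_le, Rinv_0_lt_compat, INR_fact_lt_0].
    - intros i _. rewrite (is_derive_n_unique _ _ _ _ (is_derive_n_ray_int c i 0 c0)).
      rewrite ray_int_0 by (pose proof (pos_INR i); nra).
      rewrite Rminus_0_r. unfold Wright_coef.
      replace (1 - (c + nu * INR i)) with (INR i * - nu + (1 - c)) by ring.
      replace (- z) with (-1 * z) by ring. rewrite Rpow_mult_distr. field. apply INR_fact_neq_0. }
  apply (filterlim_locally (F := eventually)). intros eps.
  assert (L : is_lim_seq (fun n => B * (1 / 2) ^ S n) 0).
  { replace (Finite 0) with (Rbar_mult B 0) by (simpl; f_equal; ring).
    apply is_lim_seq_scal_l, (is_lim_seq_incr_1 (fun n => (1 / 2) ^ n)), is_lim_seq_geom.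
    rewrite Rabs_pos_eq; lra. }
  destruct (proj2 (is_lim_seq_spec _ _) L eps) as [N HN].
  exists N; intros n Hn. specialize (HN n Hn). rewrite Rminus_0_r in HN.
  eapply Rle_lt_trans; [apply Ediff |]. eapply Rle_lt_trans; [apply Rle_abs | exact HN].
Qed.

Lemma Wright_ray_int (c z : R) : 0 < c -> 0 < z -> Wright (- z) (- nu) (1 - c) = ray_int c 1 z.
Proof.
  intros c0 z0; rewrite Wright_PSeries; apply is_series_unique, is_series_ray_int; auto.
Qed.

Lemma PS_derive_Wright_coef (b : R) (n : nat) : PS_derive (Wright_coef b) n = Wright_coef (b - nu) n.
Proof.
  unfold PS_derive, Wright_coef.
  replace (INR (S n) * - nu + b) with (INR n * - nu + (b - nu)) by (rewrite S_INR; ring).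
  change (fact (S n)) with (S n * fact n)%nat; rewrite mult_INR. field.
  split; [apply INR_fact_neq_0 | apply not_0_INR; lia].
Qed.

(** For [b < 1] the series converges at every negative point, hence everywhere. The value [b = 1]
    would be [c = 0], outside the range of the ray integrals; it is reached through the derived
    series, which has the same radius and parameter [1 - nu]. *)
Lemma CV_radius_Wright_coef (b : R) : b <= 1 -> CV_radius (Wright_coef b) = p_infty.
Proof.
  intros Hb.
  assert (Main : forall b, b < 1 -> CV_radius (Wright_coef b) = p_infty).
  { clear b Hb; intros b Hb.
    assert (Out : forall r, 0 < r -> ~ Rbar_lt (CV_radius (Wright_coef b)) r).
    { intros r r0 H. apply (CV_disk_outside (Wright_coef b) (- r)).
      - rewrite Rabs_Ropp, Rabs_pos_eq by lra; exact H.
      - apply ex_series_lim_0. exists (ray_int (1 - b) 1 r).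
        assert (S := is_series_ray_int (1 - b) r ltac:(lra) r0).
        replace (1 - (1 - b)) with b in S by ring. exact S. }
    pose proof (CV_radius_ge_0 (Wright_coef b)) as G.
    destruct (CV_radius (Wright_coef b)) as [r | |]; [| reflexivity | contradiction].
    exfalso; apply (Out (r + 1)); simpl in *; lra. }
  destruct (Rle_lt_or_eq_dec b 1 Hb) as [H | ->]; [auto |].
  rewrite <- CV_radius_derive, (CV_radius_ext _ _ (PS_derive_Wright_coef 1)).
  apply Main; lra.
Qed.

Lemma is_derive_Wright (b z : R) : b <= 1 ->
  is_derive (fun z => Wright z (- nu) b) z (Wright z (- nu) (b - nu)).
Proof.
  intros Hb.
  apply (is_derive_ext (PSeries (Wright_coef b))); [intros t; symmetry; apply Wright_PSeries |].
  rewrite Wright_PSeries.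
  rewrite <- (PSeries_ext _ _ z (PS_derive_Wright_coef b)).
  apply is_derive_PSeries; rewrite CV_radius_Wright_coef by auto; exact I.
Qed.

Lemma Wright_0 (b : R) : Wright 0 (- nu) b = rgamma b.
Proof.
  rewrite Wright_PSeries, PSeries_0; unfold Wright_coef; simpl.
  rewrite Rinv_1, Rmult_1_l, Rmult_0_l, Rplus_0_l; reflexivity.
Qed.

(** Self-similarity: replacing [s] by [s / t], a shift of [x] by [ln t], normalizes the time to
    1. *)
Lemma ray_int_scal (c t z : R) : 0 < c -> 0 < t -> 0 < z ->
  ray_int c t z = exp (- (c * ln t)) * Wright (- (z * exp (- (nu * ln t)))) (- nu) (1 - c).
Proof.
  intros c0 t0 z0.
  rewrite Wright_ray_int by (auto; apply Rmult_lt_0_compat; auto using exp_pos).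
  destruct (ray_kernel_dominated_z c (z * exp (- (nu * ln t))) c0) as [K HK].
  { apply Rlt_le, Rmult_lt_0_compat; auto using exp_pos. }
  specialize (HK (z * exp (- (nu * ln t)))).
  set (z' := z * exp (- (nu * ln t))) in *.
  assert (z'0 : 0 < z') by (apply Rmult_lt_0_compat; auto using exp_pos).
  assert (HK' : exp_dominated K c (ray_kernel c 1 z')) by (apply HK; rewrite Rabs_pos_eq; lra).
  assert (I := is_RIntR_scal _ (exp (- (c * ln t))) _
    (is_RIntR_shift _ (ln t) _ (continuous_ray_kernel c 1 z')
      (is_RIntR_dominated _ K c (continuous_ray_kernel c 1 z') HK' c0))).
  unfold ray_int; unfold Rdiv; rewrite <- Rmult_assoc; f_equal.
  apply is_RIntR_unique; eapply is_RIntR_ext; [| exact I].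
  intros x; unfold ray_kernel; simpl.
  rewrite <- Rmult_assoc, <- exp_plus.
  assert (Ex : exp (x + ln t) = t * exp x) by (rewrite exp_plus, exp_ln by auto; ring).
  assert (En : z' * exp (nu * (x + ln t)) = z * exp (nu * x)).
  { unfold z'; rewrite Rmult_assoc, <- exp_plus; f_equal; f_equal; ring. }
  rewrite Ex.
  replace (z' * cos (nu * th) * exp (nu * (x + ln t))) with (z' * exp (nu * (x + ln t)) * cos (nu * th)) by ring.
  replace (z' * sin (nu * th) * exp (nu * (x + ln t))) with (z' * exp (nu * (x + ln t)) * sin (nu * th)) by ring.
  rewrite En; f_equal; f_equal; ring.
Qed.

End Ray.

(** * The fractional derivative of a ray integral *)

Lemma is_RIntR_0 : is_RIntR (fun _ => 0) 0.
Proof.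
  apply is_RIntR_intro; [intros; apply continuous_const |].
  intros eps e0; exists 0; intros a b _ _.
  rewrite (RInt_const (V := R_CompleteNormedModule)).
  unfold scal; simpl; unfold mult; simpl; rewrite Rmult_0_r, Rminus_0_r, Rabs_R0; auto.
Qed.

Section Caputo.

Variables nu th z al : R.
Hypothesis Hnu : 0 < nu < 1 / 2.
Hypothesis Hth : PI / 2 < th < PI.
Hypothesis Hz : 0 < z.
Hypothesis Hal : 0 < al < 1.

(** The variable [a] is the time. The exponent of [s] is 1 because [ray_int nu th 1] will be the
    time derivative of the self-similar profile. *)
Definition ray_C (a x : R) : C := cexp ((x, th) + a * cexp (x, th) - z * cexp (nu * (x, th)))%C.

Definition ray_res (a e x : R) : C := (ray_C a x * / (cexp (x, th) + exp e))%C.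

Lemma snd_ray_C a x : snd (ray_C a x) = ray_kernel nu th 1 a z x.
Proof.
  unfold ray_C, ray_kernel, cexp; simpl.
  replace (nu * x - 0 * th) with (nu * x) by ring. replace (nu * th + 0 * x) with (nu * th) by ring.
  f_equal; f_equal; ring.
Qed.

(** Since [cos th < 0], the factor [exp (a s)] has modulus at most 1; the bound is therefore uniform
    in time and includes [a = 0]. *)
Lemma Cmod_ray_C a x : 0 <= a ->
  Cmod (ray_C a x) <= exp (1 * x - z * cos (nu * th) * exp (nu * x)).
Proof.
  intros a0; unfold ray_C; rewrite Cmod_cexp; apply exp_le_le; simpl.
  replace (nu * x - 0 * th) with (nu * x) by ring. replace (nu * th + 0 * x) with (nu * th) by ring.
  pose proof (cos_th_neg th Hth). pose proof (exp_pos x).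
  assert (a * (exp x * - cos th) >= 0) by (apply Rle_ge; repeat apply Rmult_le_pos; lra).
  nra.
Qed.

Lemma resolvent_ge : exists delta, 0 < delta /\
  forall x e, delta * (exp x + exp e) <= Cmod (cexp (x, th) + exp e)%C.
Proof.
  exists (sqrt ((1 - - cos th) / 2)); split.
  - apply sqrt_half_pos, minus_cos_range, Hth.
  - intros x e; apply Cmod_cexp_plus_ge.
    + apply Rlt_le, exp_pos.
    + apply minus_cos_range, Hth.
    + apply (cos_lower th th Hth). pose proof PI_RGT_0; lra.
Qed.

Lemma resolvent_neq_0 x e : (cexp (x, th) + exp e)%C <> 0%C.
Proof.
  destruct resolvent_ge as [delta [d0 H]]; intros E; specialize (H x e).
  rewrite E, Cmod_0 in H. pose proof (exp_pos x); pose proof (exp_pos e). nra.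
Qed.

Lemma Cmod_ray_res : exists delta, 0 < delta /\ forall a e x, 0 <= a ->
  Cmod (ray_res a e x) <= exp (1 * x - z * cos (nu * th) * exp (nu * x)) * / (delta * (exp x + exp e)).
Proof.
  destruct resolvent_ge as [delta [d0 H]]; exists delta; split; auto; intros a e x a0.
  unfold ray_res; rewrite Cmod_mult, Cmod_inv by apply resolvent_neq_0.
  apply Rmult_le_compat; [apply Cmod_ge_0 | | apply Cmod_ray_C; auto |].
  - apply Rlt_le, Rinv_0_lt_compat, Cmod_gt_0, resolvent_neq_0.
  - apply Rinv_le_contravar; auto. pose proof (exp_pos x); pose proof (exp_pos e). nra.
Qed.

Lemma ray_exp_dominated (a : R) : 0 < a -> exists K, 0 <= K /\
  forall x, exp (a * x - z * cos (nu * th) * exp (nu * x)) <= K * exp (- (a * Rabs x)).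
Proof.
  intros a0; pose proof (cos_nu_th_pos nu th Hnu Hth).
  destruct (exp_exp_dominated a (z * cos (nu * th)) nu a0) as [K HK]; [nra | lra |].
  exists K; split; auto. specialize (HK 0).
  pose proof (exp_pos (a * 0 - z * cos (nu * th) * exp (nu * 0))).
  pose proof (exp_pos (- (a * Rabs 0))). nra.
Qed.

Lemma ray_res_product_bound : exists K d, 0 < d /\ 0 <= K /\ forall a e x, 0 <= a ->
  exp (al * e) * Cmod (ray_res a e x) <= K * exp (- (d * Rabs x)) * exp (- (d * Rabs e)).
Proof.
  destruct Cmod_ray_res as [delta [d0 H]].
  destruct (ray_exp_dominated 1 Rlt_0_1) as [K1 [K10 H1]].
  destruct (ray_exp_dominated (al / 2) ltac:(lra)) as [K2 [K20 H2]].
  (* The rate in [e] is [1 - al] on the right and [al / 2] on the left; the geometric mean with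
     weights [1 - al / 2] and [al / 2] also leaves the rate [al / 2] in [x]. *)
  set (d := Rmin (al / 2) (1 - al)).
  assert (da : d <= al / 2) by apply Rmin_l. assert (db : d <= 1 - al) by apply Rmin_r.
  assert (dp : 0 < d) by (apply Rmin_glb_lt; lra).
  assert (Kp : 0 <= (K1 + K2) / delta).
  { apply Rmult_le_pos; [lra | apply Rlt_le, Rinv_0_lt_compat; auto]. }
  exists ((K1 + K2) / delta), d; repeat split; auto.
  intros a e x a0.
  assert (Hx := exp_pos x). assert (He := exp_pos e).
  assert (Hd : forall k y, d <= k -> exp (- (k * Rabs y)) <= exp (- (d * Rabs y))).
  { intros k y Hk; apply exp_le_le; pose proof (Rabs_pos y); nra. }
  eapply Rle_trans; [apply Rmult_le_compat_l; [apply Rlt_le, exp_pos | apply H; auto] |].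
  rewrite Rinv_mult.
  set (g := exp (1 * x - z * cos (nu * th) * exp (nu * x))).
  assert (g0 : 0 < g) by apply exp_pos.
  (* the resolvent is estimated by [/ exp e] for [e >= 0] and by a geometric mean for [e < 0] *)
  assert (Main : exp (al * e) * (g * / (exp x + exp e))
     <= (K1 + K2) * exp (- (d * Rabs x)) * exp (- (d * Rabs e))).
  { assert (P1 := exp_pos (- (d * Rabs x))). assert (P2 := exp_pos (- (d * Rabs e))).
    destruct (Rle_dec 0 e) as [e0 | e0].
    - apply Rle_trans with (K1 * exp (- (1 * Rabs x)) * exp (- ((1 - al) * Rabs e))).
      + replace (exp (- ((1 - al) * Rabs e))) with (exp (al * e) * / exp e)
          by (rewrite <- exp_Ropp, <- exp_plus, Rabs_pos_eq by auto; f_equal; ring).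
        replace (K1 * exp (- (1 * Rabs x)) * (exp (al * e) * / exp e))
          with (exp (al * e) * (K1 * exp (- (1 * Rabs x)) * / exp e)) by ring.
        apply Rmult_le_compat_l; [apply Rlt_le, exp_pos |].
        apply Rmult_le_compat; [lra | apply Rlt_le, Rinv_0_lt_compat; lra | apply H1 |].
        apply Rinv_le_contravar; lra.
      + apply Rmult_le_compat; try (apply Rlt_le, exp_pos); auto.
        * apply Rmult_le_pos; [auto | apply Rlt_le, exp_pos].
        * apply Rmult_le_compat; try (apply Rlt_le, exp_pos); auto; try lra.
          apply Hd; lra.
    - apply Rle_trans with (K2 * exp (- (al / 2 * Rabs x)) * exp (- (al / 2 * Rabs e))).
      + assert (Geo : exp ((1 - al / 2) * x + al / 2 * e) <= exp x + exp e).
        { destruct (Rle_dec x e).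
          - assert (exp ((1 - al / 2) * x + al / 2 * e) <= exp e) by (apply exp_le_le; nra). lra.
          - assert (exp ((1 - al / 2) * x + al / 2 * e) <= exp x) by (apply exp_le_le; nra). lra. }
        apply Rle_trans with (exp (al * e) * (g * exp (- ((1 - al / 2) * x + al / 2 * e)))).
        * apply Rmult_le_compat_l; [apply Rlt_le, exp_pos |].
          apply Rmult_le_compat_l; [lra |]. rewrite exp_Ropp.
          apply Rinv_le_contravar; [apply exp_pos | auto].
        * unfold g; rewrite <- !exp_plus.
          replace (al * e + (1 * x - z * cos (nu * th) * exp (nu * x) + - ((1 - al / 2) * x + al / 2 * e)))
            with ((al / 2 * x - z * cos (nu * th) * exp (nu * x)) + - (al / 2 * Rabs e))
            by (rewrite Rabs_left by lra; field).
          rewrite exp_plus; apply Rmult_le_compat_r; [apply Rlt_le, exp_pos | apply H2].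
      + apply Rmult_le_compat; try (apply Rlt_le, exp_pos); auto.
        * apply Rmult_le_pos; [auto | apply Rlt_le, exp_pos].
        * apply Rmult_le_compat; try (apply Rlt_le, exp_pos); auto; try lra. }
  apply (Rmult_le_reg_l delta); auto.
  replace (delta * (exp (al * e) * (g * (/ delta * / (exp x + exp e)))))
    with (exp (al * e) * (g * / (exp x + exp e))) by (field; lra).
  replace (delta * ((K1 + K2) / delta * exp (- (d * Rabs x)) * exp (- (d * Rabs e))))
    with ((K1 + K2) * exp (- (d * Rabs x)) * exp (- (d * Rabs e))) by (field; lra).
  exact Main.
Qed.

Lemma cont_C_ray_res_xe a x e : cont_C (fun x e => ray_res a e x) x e.
Proof.
  unfold ray_res, ray_C.
  assert (Cth : cont_C (fun x _ => (x, th)) x e).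
  { split; simpl; [apply continuity_2d_pt_id1 | apply continuity_2d_pt_const]. }
  assert (Cex : cont_C (fun _ e => RtoC (exp e)) x e).
  { split; simpl; [apply continuity_2d_pt_exp, continuity_2d_pt_id2 | apply continuity_2d_pt_const]. }
  apply cont_C_mult.
  - apply cont_C_cexp; unfold Cminus; repeat first
      [exact Cth | apply cont_C_plus | apply cont_C_mult | apply cont_C_const | apply cont_C_opp | apply cont_C_cexp].
  - apply cont_C_inv; [apply resolvent_neq_0 |].
    apply cont_C_plus; auto. apply cont_C_cexp, Cth.
Qed.

(** With [p = exp e], this is the convolution of [ray_int nu th 1] with [exp (- p t)], that is, the
    solution of [Y' + p Y = ray_int] with [Y 0 = 0]; both properties are established below. *)
Definition Yint (e a : R) : R := RIntR (fun x => snd (ray_res a e x)) / PI.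

Lemma ray_res_dominated_e (e : R) : exists K, forall a v, 0 <= a -> e - 1 < v < e + 1 ->
  exp_dominated K 1 (fun x => snd (ray_res a v x)).
Proof.
  destruct Cmod_ray_res as [delta [d0 H]].
  destruct (ray_exp_dominated 1 Rlt_0_1) as [K1 [K10 H1]].
  exists (/ (delta * exp (e - 1)) * K1); intros a v a0 Hv x.
  eapply Rle_trans; [apply Rabs_snd_le_Cmod |]. eapply Rle_trans; [apply H; auto |].
  rewrite Rmult_comm, (Rmult_assoc (/ (delta * exp (e - 1)))).
  pose proof (exp_pos x); pose proof (exp_pos v); pose proof (exp_pos (e - 1)).
  assert (exp (e - 1) <= exp v) by (apply exp_le_le; lra).
  apply Rmult_le_compat; [apply Rlt_le, Rinv_0_lt_compat; nra | apply Rlt_le, exp_pos | | apply H1].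
  apply Rinv_le_contravar; [nra |]. nra.
Qed.

Lemma continuous_ray_res a e x : continuous (fun x => snd (ray_res a e x)) x.
Proof.
  apply (continuity_2d_pt_l (fun x e => snd (ray_res a e x))), (cont_C_ray_res_xe a x e).
Qed.

Lemma continuous_Yint a e : 0 <= a -> continuous (fun e => Yint e a) e.
Proof.
  intros a0; destruct (ray_res_dominated_e e) as [K HK].
  unfold Yint, Rdiv.
  apply (continuous_scal_l (V := R_NormedModule) (fun e => RIntR (fun x => snd (ray_res a e x)))).
  apply (cont_strip_RIntR (fun x e => snd (ray_res a e x)) (e - 1) (e + 1)) with (C := K) (d := 1); auto; try lra.
  intros u v _; apply (cont_C_ray_res_xe a u v).
Qed.

Lemma ray_int_1_bound : exists B, 0 <= B /\ forall a, 0 <= a -> Rabs (ray_int nu th 1 a z) <= B.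
Proof.
  destruct (ray_exp_dominated 1 Rlt_0_1) as [K1 [K10 H1]].
  assert (P := PI_RGT_0).
  exists (2 * (K1 / 1) / PI); split.
  - unfold Rdiv; repeat apply Rmult_le_pos; try lra; apply Rlt_le, Rinv_0_lt_compat; lra.
  - intros a a0; unfold ray_int; unfold Rdiv at 1.
    rewrite Rabs_mult, (Rabs_pos_eq (/ PI)) by (apply Rlt_le, Rinv_0_lt_compat; auto).
    apply Rmult_le_compat_r; [apply Rlt_le, Rinv_0_lt_compat; auto |].
    apply RIntR_bound; [apply continuous_ray_kernel | | lra].
    intros x; rewrite <- snd_ray_C; eapply Rle_trans; [apply Rabs_snd_le_Cmod |].
    eapply Rle_trans; [apply Cmod_ray_C; auto | apply H1].
Qed.

Lemma ray_kernel_dominated_t : exists K, forall a, 0 <= a -> exp_dominated K 1 (ray_kernel nu th 1 a z).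
Proof.
  destruct (ray_exp_dominated 1 Rlt_0_1) as [K1 [K10 H1]].
  exists K1; intros a a0 x; rewrite <- snd_ray_C; eapply Rle_trans; [apply Rabs_snd_le_Cmod |].
  eapply Rle_trans; [apply Cmod_ray_C; auto | apply H1].
Qed.

Lemma continuous_ray_int_t (a : R) : 0 < a -> continuous (fun a => ray_int nu th 1 a z) a.
Proof.
  intros a0; destruct ray_kernel_dominated_t as [K HK].
  unfold ray_int, Rdiv.
  apply (continuous_scal_l (V := R_NormedModule) (fun a => RIntR (ray_kernel nu th 1 a z))).
  apply (cont_strip_RIntR (fun x a => ray_kernel nu th 1 a z x) 0 (a + 1)) with (C := K) (d := 1); try lra.
  - intros u v _; unfold ray_kernel; cont_2d.
  - intros v Hv; apply HK; lra.
Qed.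

(** With [p = exp e], the product is the imaginary part of [exp (a (s + p)) / (s + p)] times a
    factor independent of [a]; differentiation cancels the resolvent. *)
Lemma is_derive_ray_res (e x a : R) :
  is_derive (fun a => exp (a * exp e) * snd (ray_res a e x)) a
    (exp (a * exp e) * ray_kernel nu th 1 a z x).
Proof.
  rewrite <- snd_ray_C.
  set (s := cexp (x, th)). set (w := ((x, th) - z * cexp (nu * (x, th)))%C).
  assert (D : is_cderive (fun a => cexp (a * (s + exp e) + w) * / (s + exp e))%C a
     (cexp (a * (s + exp e) + w))).
  { replace (cexp (a * (s + exp e) + w))
      with (cexp (a * (s + exp e) + w) * (1 * (s + exp e) + a * 0 + 0) * / (s + exp e)
            + cexp (a * (s + exp e) + w) * 0)%C
      by (field; apply resolvent_neq_0).
    assert (Dc : forall c : C, is_cderive (fun _ => c) a 0%C).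
    { intros c; split; apply (is_derive_const (V := R_NormedModule)). }
    apply (is_cderive_mult (fun a => cexp (a * (s + exp e) + w)) (fun _ => / (s + exp e))%C); auto.
    apply (is_cderive_cexp (fun a => a * (s + exp e) + w)%C).
    apply (is_cderive_plus (fun a => a * (s + exp e))%C (fun _ => w)); auto.
    apply (is_cderive_mult RtoC (fun _ => s + exp e)%C); auto.
    split; simpl; [apply (is_derive_id (K := R_AbsRing)) | apply (is_derive_const (V := R_NormedModule))]. }
  assert (E : forall a : R, (cexp (a * (s + exp e) + w) = exp (a * exp e)%R * ray_C a x)%C).
  { intros b. replace (RtoC (exp (b * exp e))) with (cexp (RtoC (b * exp e))).
    - unfold ray_C; rewrite <- cexp_plus; f_equal. rewrite RtoC_mult; unfold w, s; ring.
    - unfold cexp, RtoC; simpl; rewrite cos_0, sin_0; f_equal; ring. }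
  destruct D as [_ D].
  rewrite E in D.
  evar_last; [eapply is_derive_ext; [| exact D] | simpl; ring].
  intros b; cbv beta; rewrite (E b); unfold ray_res; fold s; simpl; ring.
Qed.

Lemma Yint_derive (e a : R) : 0 < a ->
  is_derive (fun a => exp (a * exp e) * Yint e a) a (exp (a * exp e) * ray_int nu th 1 a z).
Proof.
  intros a0; assert (P := PI_RGT_0).
  destruct (ray_res_dominated_e e) as [K1 H1].
  destruct ray_kernel_dominated_t as [K2 H2].
  assert (K10 : 0 <= K1) by (apply (exp_dominated_pos _ _ _ (H1 0 e ltac:(lra) ltac:(lra)))).
  assert (K20 : 0 <= K2) by (apply (exp_dominated_pos _ _ _ (H2 0 ltac:(lra)))).
  set (M := exp ((a + 1) * exp e)).
  assert (HM : forall v, 0 < v < a + 1 -> 0 < exp (v * exp e) <= M).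
  { intros v Hv; split; [apply exp_pos | apply exp_le_le; pose proof (exp_pos e); nra]. }
  assert (M0 : 0 < M) by apply exp_pos.
  assert (D : is_derive (fun v => RIntR (fun x => exp (v * exp e) * snd (ray_res v e x))) a
    (RIntR (fun x => exp (a * exp e) * ray_kernel nu th 1 a z x))).
  { apply (is_derive_RIntR (fun x v => exp (v * exp e) * snd (ray_res v e x))
      (fun x v => exp (v * exp e) * ray_kernel nu th 1 v z x) 0 (a + 1) (M * (K1 + K2)) 1); try lra.
    - intros x v _; apply is_derive_ray_res.
    - intros x v _; unfold ray_kernel; cont_2d.
    - intros v Hv x; apply (continuous_scal_r (V := R_NormedModule) (exp (v * exp e))), continuous_ray_res.
    - intros v Hv x; rewrite Rabs_mult, Rabs_pos_eq by (apply Rlt_le, HM; auto).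
      rewrite Rmult_assoc; apply Rmult_le_compat; try apply Rabs_pos; try (apply HM; auto).
      + apply Rlt_le, exp_pos.
      + eapply Rle_trans; [apply (H1 v e); lra |].
        apply Rmult_le_compat_r; [apply Rlt_le, exp_pos | lra].
    - intros v Hv x; rewrite Rabs_mult, Rabs_pos_eq by (apply Rlt_le, HM; auto).
      rewrite Rmult_assoc; apply Rmult_le_compat; try apply Rabs_pos; try (apply HM; auto).
      + apply Rlt_le, exp_pos.
      + eapply Rle_trans; [apply (H2 v); lra |].
        apply Rmult_le_compat_r; [apply Rlt_le, exp_pos | lra]. }
  assert (E1 : forall v, 0 <= v -> RIntR (fun x => exp (v * exp e) * snd (ray_res v e x))
     = exp (v * exp e) * RIntR (fun x => snd (ray_res v e x))).
  { intros v v0; apply is_RIntR_unique, is_RIntR_scal.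
    apply (is_RIntR_dominated _ K1 1); [apply continuous_ray_res | apply H1; lra | lra]. }
  assert (E2 : RIntR (fun x => exp (a * exp e) * ray_kernel nu th 1 a z x)
     = exp (a * exp e) * RIntR (ray_kernel nu th 1 a z)).
  { apply is_RIntR_unique, is_RIntR_scal.
    apply (is_RIntR_dominated _ K2 1); [apply continuous_ray_kernel | apply H2; lra | lra]. }
  rewrite E2 in D.
  unfold Yint, ray_int.
  apply is_derive_ext_loc with
    (f := fun v => scal (RIntR (fun x => exp (v * exp e) * snd (ray_res v e x))) (/ PI)).
  - generalize (open_gt 0 a a0); apply filter_imp; intros v Hv.
    rewrite E1 by lra. unfold scal; simpl; unfold mult; simpl. unfold Rdiv; ring.
  - replace (exp (a * exp e) * (RIntR (ray_kernel nu th 1 a z) / PI))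
      with (scal (exp (a * exp e) * RIntR (ray_kernel nu th 1 a z)) (/ PI))
      by (unfold scal; simpl; unfold mult; simpl; unfold Rdiv; ring).
    apply (is_derive_scal_l (V := R_NormedModule)); exact D.
Qed.

(* rotation of the ray to the positive axis, where the integrand is real *)
Lemma Yint_0 (e : R) : Yint e 0 = 0.
Proof.
  assert (P := PI_RGT_0).
  (* Here [t] is an angle: the strip [|y| < t] contains the heights [th] and 0, avoids the pole
     [s = - exp e], and keeps [cos (nu y)] bounded below by [cos (nu t) > 0]. *)
  set (t := (th + PI) / 2).
  assert (Ht : PI / 2 < t < PI) by (unfold t; lra).
  assert (Htt : th < t) by (unfold t; lra).
  set (k := sqrt ((1 - - cos t) / 2)).
  assert (k0 : 0 < k) by (apply sqrt_half_pos, minus_cos_range, Ht).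
  assert (Cn : 0 < cos (nu * t)) by (apply cos_gt_0; nra).
  destruct (exp_exp_dominated 1 (z * cos (nu * t)) nu Rlt_0_1) as [K HK]; [nra | lra |].
  assert (Low : forall x y, - t < y < t -> k * (exp x + exp e) <= Cmod (cexp (x, y) + exp e)%C).
  { intros x y Hy; apply Cmod_cexp_plus_ge; [apply Rlt_le, exp_pos | apply minus_cos_range, Ht |].
    apply (cos_lower t y Ht); lra. }
  assert (Nz : forall x y, - t < y < t -> (cexp (x, y) + exp e)%C <> 0%C).
  { intros x y Hy E; specialize (Low x y Hy); rewrite E, Cmod_0 in Low.
    pose proof (exp_pos x); pose proof (exp_pos e); nra. }
  set (g := fun x y => ((x, y) + - z * cexp (nu * (x, y)))%C).
  set (g' := fun x y => (1 + - z * (cexp (nu * (x, y)) * (nu * 1)))%C).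
  set (h := fun x y => (cexp (g x y) * / (cexp (x, y) + exp e))%C).
  set (h' := fun x y => (cexp (g x y) * g' x y * / (cexp (x, y) + exp e)
    + cexp (g x y) * - ((cexp (x, y) * 1 + 0) * / (cexp (x, y) + exp e) * / (cexp (x, y) + exp e)))%C).
  assert (Hh : forall x y, - t < y < t -> is_hol h h' x y).
  { intros x y Hy; unfold h, h'.
    apply (is_hol_mult (fun x y => cexp (g x y)) (fun x y => cexp (g x y) * g' x y)%C
      (fun x y => / (cexp (x, y) + exp e))%C
      (fun x y => - ((cexp (x, y) * 1 + 0) * / (cexp (x, y) + exp e) * / (cexp (x, y) + exp e)))%C).
    - apply (is_hol_cexp g g'). unfold g, g'.
      apply (is_hol_plus (fun x y => (x, y)) (fun _ _ => 1%C)); [apply is_hol_id |].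
      apply (is_hol_scal (- z)%C (fun x y => cexp (nu * (x, y)))%C (fun x y => cexp (nu * (x, y)) * (nu * 1))%C).
      apply (is_hol_cexp (fun x y => nu * (x, y))%C (fun x y => nu * 1)%C).
      apply (is_hol_scal nu (fun u v => (u, v)) (fun _ _ => 1%C)), is_hol_id.
    - apply (is_hol_inv (fun x y => cexp (x, y) + exp e)%C (fun x y => cexp (x, y) * 1 + 0)%C); auto.
      apply is_hol_plus; [| apply is_hol_const].
      apply (is_hol_cexp (fun u v => (u, v)) (fun _ _ => 1%C)), is_hol_id. }
  assert (Ch : forall x y, - t < y < t -> cont_C h' x y).
  { intros x y Hy; unfold h', g, g'; cont_C_tac; auto. }
  assert (Bh : forall x y, - t < y < t -> Cmod (h x y) <= K * / (k * exp e) * exp (- (1 * Rabs x))).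
  { intros x y Hy; unfold h; rewrite Cmod_mult, Cmod_inv by auto.
    rewrite (Rmult_comm K), Rmult_assoc, (Rmult_comm (Cmod _)).
    pose proof (exp_pos x); pose proof (exp_pos e); specialize (Low x y Hy).
    apply Rmult_le_compat; [apply Rlt_le, Rinv_0_lt_compat; nra | apply Cmod_ge_0 | |].
    - apply Rinv_le_contravar; nra.
    - rewrite Cmod_cexp; eapply Rle_trans; [| apply HK]. apply exp_le_le; unfold g; simpl.
      replace (nu * x - 0 * y) with (nu * x) by ring. replace (nu * y + 0 * x) with (nu * y) by ring.
      assert (cos (nu * t) <= cos (nu * y)).
      { destruct (Rle_dec 0 y).
        - apply cos_decr_1; nra.
        - rewrite <- (cos_neg (nu * y)); apply cos_decr_1; nra. }
      pose proof (exp_pos (nu * x)).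
      assert (z * exp (nu * x) * cos (nu * t) <= z * exp (nu * x) * cos (nu * y))
        by (apply Rmult_le_compat_l; nra).
      nra. }
  assert (Rot := RIntR_rotation_snd h h' (- t) t _ 1 th 0 Rlt_0_1 ltac:(lra) ltac:(lra) Hh Ch Bh).
  unfold Yint.
  rewrite (RIntR_ext (fun x => snd (ray_res 0 e x)) (fun x => snd (h x th))), Rot.
  - rewrite (RIntR_ext _ (fun _ => 0)).
    + rewrite (is_RIntR_unique _ _ is_RIntR_0); unfold Rdiv; ring.
    + intros x; unfold h, g, cexp; simpl.
      repeat (rewrite ?Rmult_0_r, ?Rmult_0_l, ?Rplus_0_r, ?Rplus_0_l, ?sin_0, ?Ropp_0, ?Rminus_0_r).
      unfold Rdiv; ring.
  - intros x; unfold ray_res, ray_C, h, g. f_equal; f_equal; f_equal; ring.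
Qed.

(** * Convolution of the ray integral with the power kernel *)

Variable t : R.
Hypothesis Ht : 0 < t.

(* Writing [(t - a)^(- al)] as a Laplace integral in [p = exp e] makes [Qint] below an
   antiderivative of [Gamma al * (t - a)^(- al) * ray_int nu th 1 a z]. *)
Definition qker (a e : R) : R := exp (al * e) * exp (- (exp e * (t - a))) * Yint e a.

Lemma qker_derive (e a : R) : 0 < a ->
  is_derive (fun a => qker a e) a (exp (al * e - exp e * (t - a)) * ray_int nu th 1 a z).
Proof.
  intros a0.
  assert (D := is_derive_scal _ _ (exp (al * e) * exp (- (exp e * t))) _ (Yint_derive e a a0)).
  evar_last; [eapply is_derive_ext; [| exact D] |].
  - intros b; unfold qker.
    replace (exp (- (exp e * (t - b)))) with (exp (- (exp e * t)) * exp (b * exp e))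
      by (rewrite <- exp_plus; f_equal; ring). simpl; ring.
  - simpl. rewrite <- Rmult_assoc, <- !exp_plus; f_equal; f_equal; ring.
Qed.

(** The Laplace factor is at most 1 up to and including [a = t]; decay in [e] comes from
    [ray_res_product_bound] after [x] has been integrated out. *)
Lemma qker_dominated : exists K d, 0 < d /\ forall a, 0 <= a <= t -> exp_dominated K d (qker a).
Proof.
  destruct ray_res_product_bound as [K [d [d0 [K0 H]]]].
  assert (P := PI_RGT_0).
  exists (2 * (K / d) / PI), d; split; auto; intros a Ha e.
  assert (Hd : exp_dominated (K * exp (- (d * Rabs e))) d (fun x => exp (al * e) * snd (ray_res a e x))).
  { intros x; rewrite Rabs_mult, Rabs_pos_eq by (apply Rlt_le, exp_pos).
    replace (K * exp (- (d * Rabs e)) * exp (- (d * Rabs x)))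
      with (K * exp (- (d * Rabs x)) * exp (- (d * Rabs e))) by ring.
    eapply Rle_trans; [| apply (H a e x); lra].
    apply Rmult_le_compat_l; [apply Rlt_le, exp_pos | apply Rabs_snd_le_Cmod]. }
  assert (Cc : forall x, continuous (fun x => exp (al * e) * snd (ray_res a e x)) x).
  { intros x; apply (continuous_scal_r (V := R_NormedModule) (exp (al * e))), continuous_ray_res. }
  assert (B : Rabs (RIntR (fun x => exp (al * e) * snd (ray_res a e x)))
     <= 2 * (K * exp (- (d * Rabs e)) / d)) by exact (RIntR_bound _ _ d Cc Hd d0).
  destruct (ray_res_dominated_e e) as [K1 H1].
  assert (E : RIntR (fun x => exp (al * e) * snd (ray_res a e x)) = exp (al * e) * RIntR (fun x => snd (ray_res a e x))).
  { apply is_RIntR_unique, is_RIntR_scal, (is_RIntR_dominated _ K1 1);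
      [apply continuous_ray_res | apply H1; lra | lra]. }
  rewrite E in B.
  unfold qker, Yint.
  replace (exp (al * e) * exp (- (exp e * (t - a))) * (RIntR (fun x => snd (ray_res a e x)) / PI))
    with (exp (- (exp e * (t - a))) * / PI * (exp (al * e) * RIntR (fun x => snd (ray_res a e x))))
    by (field; lra).
  rewrite Rabs_mult, (Rabs_pos_eq (exp _ * / PI))
    by (apply Rmult_le_pos; [apply Rlt_le, exp_pos | apply Rlt_le, Rinv_0_lt_compat; auto]).
  assert (L : exp (- (exp e * (t - a))) <= 1).
  { rewrite <- exp_0; apply exp_le_le; pose proof (exp_pos e); nra. }
  apply Rle_trans with (1 * / PI * (2 * (K * exp (- (d * Rabs e)) / d))).
  - apply Rmult_le_compat; auto.
    + apply Rmult_le_pos; [apply Rlt_le, exp_pos | apply Rlt_le, Rinv_0_lt_compat; auto].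
    + apply Rabs_pos.
    + apply Rmult_le_compat_r; [apply Rlt_le, Rinv_0_lt_compat; auto | auto].
  - apply Req_le; field; lra.
Qed.

Lemma continuous_qker a e : 0 <= a -> continuous (qker a) e.
Proof.
  intros a0.
  apply (continuous_mult (K := R_AbsRing) (fun e => exp (al * e) * exp (- (exp e * (t - a)))) (fun e => Yint e a)).
  - cont_1d.
  - apply continuous_Yint; auto.
Qed.

Lemma Rabs_sub_le_derive (f df : R -> R) (a b M : R) : a <= b ->
  (forall x, a <= x <= b -> is_derive f x (df x)) ->
  (forall x, a <= x <= b -> Rabs (df x) <= M) -> Rabs (f b - f a) <= M * (b - a).
Proof.
  intros Hab Df HM.
  destruct (MVT_gen f a b df) as [c [Hc E]].
  - rewrite Rmin_left, Rmax_right by auto; intros; apply Df; lra.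
  - rewrite Rmin_left, Rmax_right by auto; intros x Hx.
    apply continuity_pt_filterlim, (ex_derive_continuous (V := R_NormedModule)).
    eexists; apply Df; auto.
  - rewrite Rmin_left, Rmax_right in Hc by auto.
    rewrite E, Rabs_mult, (Rabs_pos_eq (b - a)) by lra.
    apply Rmult_le_compat_r; [lra | auto].
Qed.

(** Uniformity in [e] is the point: the mean value inequality for [exp (a exp e)] times the
    resolvent integrand carries the factor [exp (a exp e)] on both sides, where it cancels. The
    value at [a = 0] is removed by [Yint_0]. *)
Lemma Yint_small : exists B, 0 <= B /\ forall e a, 0 <= a -> Rabs (Yint e a) <= B * a.
Proof.
  destruct (ray_exp_dominated 1 Rlt_0_1) as [K1 [K10 H1]].
  assert (P := PI_RGT_0).
  exists (2 * (K1 / 1) / PI); split.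
  { unfold Rdiv; repeat apply Rmult_le_pos; try lra; apply Rlt_le, Rinv_0_lt_compat; lra. }
  intros e a a0.
  set (p := exp (a * exp e)). assert (p0 : 0 < p) by apply exp_pos.
  set (u := fun x => p * snd (ray_res a e x) - snd (ray_res 0 e x)).
  assert (Du : exp_dominated (a * p * K1) 1 u).
  { intros x; unfold u.
    set (f := fun a => exp (a * exp e) * snd (ray_res a e x)).
    replace (p * snd (ray_res a e x) - snd (ray_res 0 e x)) with (f a - f 0)
      by (unfold f, p; rewrite Rmult_0_l, exp_0; ring).
    eapply Rle_trans; [apply (Rabs_sub_le_derive f (fun a => exp (a * exp e) * ray_kernel nu th 1 a z x) 0 a
      (p * (K1 * exp (- (1 * Rabs x)))) a0) |].
    - intros b _; apply is_derive_ray_res.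
    - intros b Hb; rewrite Rabs_mult, Rabs_pos_eq by (apply Rlt_le, exp_pos).
      apply Rmult_le_compat; [apply Rlt_le, exp_pos | apply Rabs_pos | |].
      + apply exp_le_le; pose proof (exp_pos e); nra.
      + rewrite <- snd_ray_C; eapply Rle_trans; [apply Rabs_snd_le_Cmod |].
        eapply Rle_trans; [apply Cmod_ray_C; lra | apply H1].
    - apply Req_le; ring. }
  assert (Cu : forall x, continuous u x).
  { intros x; apply (continuous_minus (V := R_NormedModule) (fun x => p * snd (ray_res a e x))).
    - apply (continuous_scal_r (V := R_NormedModule) p), continuous_ray_res.
    - apply continuous_ray_res. }
  destruct (ray_res_dominated_e e) as [K HK].
  assert (Iu : is_RIntR u (p * RIntR (fun x => snd (ray_res a e x)) - RIntR (fun x => snd (ray_res 0 e x)))).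
  { apply is_RIntR_minus; [apply is_RIntR_scal |];
      apply (is_RIntR_dominated _ K 1); try apply continuous_ray_res; try (apply HK; lra); lra. }
  assert (B := RIntR_bound u _ 1 Cu Du Rlt_0_1).
  rewrite (is_RIntR_unique _ _ Iu) in B.
  replace (p * RIntR (fun x => snd (ray_res a e x)) - RIntR (fun x => snd (ray_res 0 e x)))
    with (p * PI * (Yint e a - / p * Yint e 0)) in B by (unfold Yint; field; lra).
  rewrite Yint_0, Rmult_0_r, Rminus_0_r, Rabs_mult, (Rabs_pos_eq (p * PI)) in B by (apply Rmult_le_pos; lra).
  apply (Rmult_le_reg_l (p * PI)); [apply Rmult_lt_0_compat; lra |].
  eapply Rle_trans; [exact B |]. apply Req_le; field; lra.
Qed.

Definition Qint (a : R) : R := RIntR (qker a).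

Lemma Qint_lim_0 : filterlim Qint (at_right 0) (locally 0).
Proof.
  destruct qker_dominated as [K [d [d0 HK]]].
  destruct Yint_small as [B [B0 HB]].
  (* Continuity of [qker] is available for nonnegative times, whereas [RIntR_lim] asks it of every
     member of the family; the value 0 elsewhere is invisible at the right of 0. *)
  set (g := fun a e => if Rlt_dec 0 a then qker a e else 0).
  assert (L : filterlim (fun a => RIntR (g a)) (at_right 0) (locally (RIntR (fun _ => 0)))).
  { assert (K0 : 0 <= K) by apply (exp_dominated_pos _ _ _ (HK 0 ltac:(lra))).
    apply (RIntR_lim (at_right 0) g (fun _ => 0) K d); auto.
    - generalize (at_right_near 0 t Ht); apply filter_imp; intros a Ha; unfold g.
      destruct (Rlt_dec 0 a); [| lra]. apply HK; lra.
    - intros e; rewrite Rabs_R0; apply Rmult_le_pos; auto; apply Rlt_le, exp_pos.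
    - intros a e; unfold g; destruct (Rlt_dec 0 a); [apply continuous_qker; lra | apply continuous_const].
    - intros e; apply continuous_const.
    - intros N eps N0 e0.
      assert (M0 : 0 < eps / (exp (al * N) * (B + 1))).
      { apply Rdiv_lt_0_compat; auto; apply Rmult_lt_0_compat; [apply exp_pos | lra]. }
      generalize (filter_and _ _ (at_right_near 0 t Ht) (at_right_near 0 _ M0)); apply filter_imp; intros a [Ha1 Ha2] e He.
      unfold g; destruct (Rlt_dec 0 a); [| lra]. rewrite Rminus_0_r; unfold qker.
      rewrite !Rabs_mult, !(Rabs_pos_eq (exp _)) by (apply Rlt_le, exp_pos).
      assert (L1 : exp (al * e) <= exp (al * N)) by (apply exp_le_le; nra).
      assert (L2 : exp (- (exp e * (t - a))) <= 1).
      { rewrite <- exp_0; apply exp_le_le; pose proof (exp_pos e); nra. }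
      assert (L3 := HB e a ltac:(lra)).
      apply Rle_trans with (exp (al * N) * 1 * (B * a)).
      + apply Rmult_le_compat; auto using Rabs_pos.
        * apply Rlt_le, Rmult_lt_0_compat; apply exp_pos.
        * apply Rmult_le_compat; auto; apply Rlt_le, exp_pos.
      + apply Rle_trans with (exp (al * N) * (B + 1) * a).
        * pose proof (exp_pos (al * N)). nra.
        * destruct Ha2 as [_ Ha2]; apply Rlt_le.
          apply (Rmult_lt_compat_l (exp (al * N) * (B + 1))) in Ha2;
            [| apply Rmult_lt_0_compat; [apply exp_pos | lra]].
          replace (exp (al * N) * (B + 1) * (eps / (exp (al * N) * (B + 1)))) with eps in Ha2;
            [exact Ha2 | field; split; [lra | apply Rgt_not_eq, exp_pos]]. }
  rewrite (is_RIntR_unique _ _ is_RIntR_0) in L.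
  eapply filterlim_ext_loc; [| exact L].
  exists (mkposreal 1 Rlt_0_1); intros a _ Ha; unfold Qint, g.
  destruct (Rlt_dec 0 a); [reflexivity | lra].
Qed.

Lemma Qint_lim_t : filterlim Qint (at_left t) (locally (Qint t)).
Proof.
  destruct qker_dominated as [K [d [d0 HK]]].
  destruct ray_int_1_bound as [B [B0 HB]].
  set (g := fun a e => if Rlt_dec 0 a then qker a e else 0).
  assert (L : filterlim (fun a => RIntR (g a)) (at_left t) (locally (RIntR (qker t)))).
  { apply (RIntR_lim (at_left t) g (qker t) K d); auto.
    - generalize (at_left_near t 0 Ht); apply filter_imp; intros a Ha; unfold g.
      destruct (Rlt_dec 0 a); [| lra]. apply HK; lra.
    - apply HK; lra.
    - intros a e; unfold g; destruct (Rlt_dec 0 a); [apply continuous_qker; lra | apply continuous_const].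
    - intros e; apply continuous_qker; lra.
    - intros N eps N0 e0.
      (* [W] bounds the time derivative of [qker] for [|e| <= N], uniformly up to [t]. *)
      set (W := exp (al * N) * (B + 1)).
      assert (W0 : 0 < W) by (apply Rmult_lt_0_compat; [apply exp_pos | lra]).
      assert (M0 : t - eps / W < t) by (assert (0 < eps / W) by (apply Rdiv_lt_0_compat; auto); lra).
      generalize (filter_and _ _ (at_left_near t 0 Ht) (at_left_near t _ M0)); apply filter_imp; intros a [Ha1 Ha2] e He.
      unfold g; destruct (Rlt_dec 0 a); [| lra]. rewrite Rabs_minus_sym.
      eapply Rle_trans; [apply (Rabs_sub_le_derive (fun a => qker a e)
        (fun a => exp (al * e - exp e * (t - a)) * ray_int nu th 1 a z) a t W); [lra | |] |].
      + intros b Hb; apply qker_derive; lra.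
      + intros b Hb; rewrite Rabs_mult, Rabs_pos_eq by (apply Rlt_le, exp_pos).
        apply Rmult_le_compat; [apply Rlt_le, exp_pos | apply Rabs_pos | |].
        * apply exp_le_le; pose proof (exp_pos e); nra.
        * specialize (HB b ltac:(lra)); lra.
      + apply Rle_trans with (W * (eps / W)); [apply Rmult_le_compat_l; lra | apply Req_le; field; lra]. }
  eapply filterlim_ext_loc; [| exact L].
  generalize (at_left_near t 0 Ht); apply filter_imp; intros a Ha; unfold Qint, g.
  destruct (Rlt_dec 0 a); [reflexivity | lra].
Qed.

(** [qker_derive] integrated over time, then exchanged with the integral over [e]: the latter is a
    Gamma integral with rate [t - tau] and gives back the power kernel. *)
Lemma Qint_increment (a b : R) : 0 < a -> a <= b -> b < t ->
  is_RInt (fun tau => Gamma al * (ray_int nu th 1 tau z * exp (- (al * ln (t - tau))))) a b (Qint b - Qint a).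
Proof.
  intros a0 Hab Hb.
  destruct qker_dominated as [K [d [d0 HK]]].
  destruct ray_int_1_bound as [B [B0 HB]].
  (* Times stay below [hi < t], so all the Gamma integrands are dominated by the one with rate
     [t - hi]. *)
  set (lo := a / 2). set (hi := (b + t) / 2).
  assert (Hlo : 0 < lo < a) by (unfold lo; lra). assert (Hhi : b < hi < t) by (unfold hi; lra).
  set (F := fun e tau => exp (al * e - exp e * (t - tau)) * ray_int nu th 1 tau z).
  assert (CF : cont_strip F lo hi).
  { intros e tau Htau; unfold F; apply continuity_2d_pt_mult; [cont_2d |].
    apply (continuity_1d_2d_pt_comp (fun tau => ray_int nu th 1 tau z) (fun _ tau => tau)).
    - apply continuity_pt_filterlim, continuous_ray_int_t; lra.
    - apply continuity_2d_pt_id2. }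
  destruct (Gamma_integrand_dominated al (t - hi) ltac:(lra) ltac:(lra)) as [K1 H1].
  assert (DF : forall v, lo < v < hi -> exp_dominated (K1 * B) al (fun e => F e v)).
  { intros v Hv e; unfold F; rewrite Rabs_mult, Rabs_pos_eq by (apply Rlt_le, exp_pos).
    replace (K1 * B * exp (- (al * Rabs e))) with (K1 * exp (- (al * Rabs e)) * B) by ring.
    apply Rmult_le_compat; [apply Rlt_le, exp_pos | apply Rabs_pos | | apply HB; lra].
    generalize (H1 e); rewrite Rabs_pos_eq by (apply Rlt_le, exp_pos); apply Rle_trans.
    apply exp_le_le; pose proof (exp_pos e); nra. }
  assert (I1 := RIntR_RInt_Fubini F lo hi CF (K1 * B) al a b ltac:(lra) ltac:(lra) Hab ltac:(lra) DF).
  assert (I2 : is_RIntR (fun e => qker b e - qker a e) (Qint b - Qint a)).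
  { apply is_RIntR_minus; apply (is_RIntR_dominated _ K d); auto; try (apply HK; lra);
      intros e; apply continuous_qker; lra. }
  assert (E : RInt (fun tau => RIntR (fun e => F e tau)) a b = Qint b - Qint a).
  { apply (is_RIntR_unique2 (fun e => qker b e - qker a e)); [| exact I2].
    eapply is_RIntR_ext; [| exact I1]; intros e; simpl.
    apply is_RInt_unique, (is_RInt_derive (V := R_CompleteNormedModule) (fun a => qker a e)).
    - intros v Hv; rewrite Rmin_left, Rmax_right in Hv by lra; apply qker_derive; lra.
    - intros v Hv; rewrite Rmin_left, Rmax_right in Hv by lra; apply (continuity_2d_pt_r F), CF; lra. }
  assert (EF : forall tau, a <= tau <= b -> RIntR (fun e => F e tau)
     = Gamma al * (ray_int nu th 1 tau z * exp (- (al * ln (t - tau))))).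
  { intros tau Htau; apply is_RIntR_unique.
    assert (I := is_RIntR_scal _ (ray_int nu th 1 tau z) _ (is_RIntR_Gamma_scal al (t - tau) ltac:(lra) ltac:(lra))).
    replace (Gamma al * (ray_int nu th 1 tau z * exp (- (al * ln (t - tau)))))
      with (ray_int nu th 1 tau z * (exp (- (al * ln (t - tau))) * Gamma al)) by ring.
    eapply is_RIntR_ext; [| exact I]; intros e; unfold F; simpl.
    rewrite (Rmult_comm (exp e)); ring. }
  rewrite <- E.
  apply (is_RInt_ext (fun tau => RIntR (fun e => F e tau))).
  - intros tau Htau; rewrite Rmin_left, Rmax_right in Htau by lra; apply EF; lra.
  - apply (RInt_correct (V := R_CompleteNormedModule)).
    apply (ex_RInt_continuous (V := R_CompleteNormedModule)).
    intros v Hv; rewrite Rmin_left, Rmax_right in Hv by lra.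
    apply (cont_strip_RIntR F lo hi CF (K1 * B) al); auto; lra.
Qed.

(** At [a = t] the Laplace factor is 1. Integrating over [e] first, [is_RIntR_power_resolvent]
    contributes [s^(al - 1)], which lowers the power of [s] in [ray_C] from 1 to [al]. *)
Lemma Qint_t : Qint t = Gamma al * Gamma (1 - al) * ray_int nu th al t z.
Proof.
  destruct ray_res_product_bound as [K [d [d0 [K0 HK]]]].
  assert (P := PI_RGT_0).
  set (F := fun x e => exp (al * e) * snd (ray_res t e x)).
  assert (CF : forall x e, continuity_2d_pt F x e).
  { intros x e; unfold F; apply continuity_2d_pt_mult; [cont_2d | apply (cont_C_ray_res_xe t x e)]. }
  assert (BF : forall x e, Rabs (F x e) <= K * exp (- (d * Rabs x)) * exp (- (d * Rabs e))).
  { intros x e; unfold F; rewrite Rabs_mult, Rabs_pos_eq by (apply Rlt_le, exp_pos).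
    eapply Rle_trans; [| apply (HK t e x); lra].
    apply Rmult_le_compat_l; [apply Rlt_le, exp_pos | apply Rabs_snd_le_Cmod]. }
  assert (Fub := RIntR_RIntR_Fubini F K d d0 CF BF).
  assert (E1 : forall e, RIntR (fun x => F x e) = PI * qker t e).
  { intros e; unfold qker, Yint; rewrite Rminus_diag, Rmult_0_r, Ropp_0, exp_0.
    replace (PI * (exp (al * e) * 1 * (RIntR (fun x => snd (ray_res t e x)) / PI)))
      with (exp (al * e) * RIntR (fun x => snd (ray_res t e x))) by (field; lra).
    destruct (ray_res_dominated_e e) as [K1 H1].
    apply is_RIntR_unique, is_RIntR_scal, (is_RIntR_dominated _ K1 1);
      [apply continuous_ray_res | apply H1; lra | lra]. }
  assert (Rth : Rabs th < PI) by (rewrite Rabs_pos_eq; lra).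
  assert (E2 : forall x, RIntR (fun e => F x e) = Gamma al * Gamma (1 - al) * ray_kernel nu th al t z x).
  { intros x; apply is_RIntR_unique.
    destruct (is_RIntR_power_resolvent al x th Hal Rth) as [I1 I2].
    assert (I := is_RIntR_plus _ _ _ _ (is_RIntR_scal _ (snd (ray_C t x)) _ I1) (is_RIntR_scal _ (fst (ray_C t x)) _ I2)).
    replace (Gamma al * Gamma (1 - al) * ray_kernel nu th al t z x)
      with (snd (ray_C t x) * (fst (cexp ((al - 1) * (x, th))%C) * (Gamma al * Gamma (1 - al)))
       + fst (ray_C t x) * (snd (cexp ((al - 1) * (x, th))%C) * (Gamma al * Gamma (1 - al)))).
    - eapply is_RIntR_ext; [| exact I]; intros e; unfold F, ray_res; simpl; ring.
    - replace (ray_kernel nu th al t z x) with (snd (ray_C t x * cexp ((al - 1) * (x, th)))%C); [simpl; ring |].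
      unfold ray_C; rewrite <- cexp_plus; unfold ray_kernel, cexp; simpl.
      replace (nu * x - 0 * th) with (nu * x) by ring. replace (nu * th + 0 * x) with (nu * th) by ring.
      f_equal; f_equal; ring. }
  assert (Kd : exists K2, exp_dominated K2 al (ray_kernel nu th al t z)).
  { destruct (ray_exp_dominated al ltac:(lra)) as [K2 [_ H2]]; exists K2; intros x.
    unfold ray_kernel; eapply Rle_trans; [apply Rabs_exp_sin_le |].
    eapply Rle_trans; [| apply H2]. apply exp_le_le.
    pose proof (cos_th_neg th Hth). pose proof (exp_pos x).
    assert (0 <= t * exp x * - cos th) by (repeat apply Rmult_le_pos; lra). lra. }
  destruct Kd as [K2 H2].
  assert (E3 : RIntR (fun x => RIntR (fun e => F x e)) = Gamma al * Gamma (1 - al) * RIntR (ray_kernel nu th al t z)).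
  { rewrite (RIntR_ext _ _ E2). apply is_RIntR_unique, is_RIntR_scal, (is_RIntR_dominated _ K2 al); auto;
      [apply continuous_ray_kernel | lra]. }
  rewrite E3 in Fub.
  assert (I := is_RIntR_scal _ (/ PI) _ Fub).
  unfold ray_int, Qint.
  replace (Gamma al * Gamma (1 - al) * (RIntR (ray_kernel nu th al t z) / PI))
    with (/ PI * (Gamma al * Gamma (1 - al) * RIntR (ray_kernel nu th al t z))) by (field; lra).
  apply is_RIntR_unique; eapply is_RIntR_ext; [| exact I].
  intros e; simpl; rewrite E1; field; lra.
Qed.

Lemma is_RInt_gen_ray_int :
  is_RInt_gen (fun tau => ray_int nu th 1 tau z * exp (- (al * ln (t - tau))))
    (at_right 0) (at_left t) (Gamma (1 - al) * ray_int nu th al t z).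
Proof.
  assert (G := Gamma_pos al ltac:(lra)).
  replace (Gamma (1 - al) * ray_int nu th al t z) with (scal (/ Gamma al) (Qint t - 0))
    by (rewrite Qint_t; unfold scal; simpl; unfold mult; simpl; field; lra).
  apply (is_RInt_gen_ext (V := R_NormedModule)
    (fun tau => scal (/ Gamma al) (Gamma al * (ray_int nu th 1 tau z * exp (- (al * ln (t - tau))))))).
  { apply filter_forall; intros ab x _; unfold scal; simpl; unfold mult; simpl; field; lra. }
  apply (is_RInt_gen_scal (V := R_NormedModule)).
  assert (Lim : filterlim (fun ab => Qint (snd ab) - Qint (fst ab)) (filter_prod (at_right 0) (at_left t))
     (locally (Qint t - 0))).
  { apply (filterlim_comp_2 (G := locally (Qint t)) (H := locally (opp 0))
      (fun ab => Qint (snd ab)) (fun ab => opp (Qint (fst ab))) plus).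
    - apply (filterlim_comp _ _ _ snd Qint _ (at_left t)); [apply filterlim_snd | apply Qint_lim_t].
    - apply (filterlim_comp _ _ _ (fun ab => Qint (fst ab)) opp _ (locally 0));
        [| apply (filterlim_opp (V := R_NormedModule) 0)].
      apply (filterlim_comp _ _ _ fst Qint _ (at_right 0)); [apply filterlim_fst | apply Qint_lim_0].
    - apply (filterlim_plus (V := R_NormedModule)). }
  intros Q HQ; specialize (Lim Q HQ); unfold filtermap in Lim; unfold filtermapi.
  assert (Prod : filter_prod (at_right 0) (at_left t) (fun ab => 0 < fst ab < t / 2 /\ t / 2 < snd ab < t)).
  { eapply Filter_prod; [apply (at_right_near 0 (t / 2)); lra | apply (at_left_near t (t / 2)); lra |].
    intros a b Ha Hb; simpl; auto. }
  generalize (filter_and _ _ Prod Lim); apply filter_imp; intros [a b] [[H1 H2] H3]; simpl in *.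
  exists (Qint b - Qint a); split; auto.
  apply Qint_increment; lra.
Qed.

End Caputo.

(** * A maximum principle for the fractional derivative *)

Lemma exp_ln_le (a x y : R) : 0 <= a -> 0 < x -> x <= y -> exp (- (a * ln y)) <= exp (- (a * ln x)).
Proof.
  intros a0 x0 Hxy; apply exp_le_le.
  assert (ln x <= ln y) by (apply ln_le; auto). nra.
Qed.

Lemma is_RInt_gen_elim (h : R -> R) (t v eps da db : R) : 0 < t ->
  is_RInt_gen h (at_right 0) (at_left t) v -> 0 < eps -> 0 < da -> 0 < db ->
  exists a b I, 0 < a < da /\ a < t / 2 /\ t / 2 < b /\ t - db < b < t /\ is_RInt h a b I /\ Rabs (I - v) < eps.
Proof.
  intros t0 H e0 da0 db0.
  destruct (H (ball v (mkposreal eps e0)) (locally_ball _ _)) as [P Q [d1 HP] [d2 HQ] HPQ].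
  destruct d1 as [d1 d10]. destruct d2 as [d2 d20]; simpl in *.
  set (a := Rmin (Rmin d1 da) (t / 2) / 2).
  set (k := Rmin (Rmin d2 db) (t / 2) / 2).
  assert (Ha : 0 < a /\ a < d1 /\ a < da /\ a < t / 2).
  { assert (M0 : 0 < Rmin (Rmin d1 da) (t / 2)) by (repeat apply Rmin_glb_lt; lra).
    pose proof (Rmin_l (Rmin d1 da) (t / 2)). pose proof (Rmin_r (Rmin d1 da) (t / 2)).
    pose proof (Rmin_l d1 da). pose proof (Rmin_r d1 da). unfold a; lra. }
  assert (Hk : 0 < k /\ k < d2 /\ k < db /\ k < t / 2).
  { assert (M0 : 0 < Rmin (Rmin d2 db) (t / 2)) by (repeat apply Rmin_glb_lt; lra).
    pose proof (Rmin_l (Rmin d2 db) (t / 2)). pose proof (Rmin_r (Rmin d2 db) (t / 2)).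
    pose proof (Rmin_l d2 db). pose proof (Rmin_r d2 db). unfold k; lra. }
  destruct (HPQ a (t - k)) as [I [HI HB]].
  - apply HP; [| lra]. unfold ball; simpl; unfold AbsRing_ball, abs, minus, plus, opp; simpl.
    rewrite Ropp_0, Rplus_0_r, Rabs_pos_eq; lra.
  - apply HQ; [| lra]. unfold ball; simpl; unfold AbsRing_ball, abs, minus, plus, opp; simpl.
    replace (t - k + - t) with (- k) by ring. rewrite Rabs_Ropp, Rabs_pos_eq; lra.
  - exists a, (t - k), I; repeat split; try lra; auto.
Qed.

Section Maximum_principle.

Variables (u f : R -> R) (L B al t v : R).
Hypothesis Hal : 0 < al < 1.
Hypothesis Ht : 0 < t.
Hypothesis Hu : forall x, 0 < x -> is_derive u x (f x).
Hypothesis Hf : forall x, 0 < x -> continuous f x.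
Hypothesis HB : 0 <= B.
Hypothesis HL : forall x, 0 < x -> Rabs (u x - L) <= B * x.
Hypothesis Hfb : forall x, 0 < x -> Rabs (f x) <= B.
Hypothesis Hv : is_RInt_gen (fun x => f x * exp (- (al * ln (t - x)))) (at_right 0) (at_left t) v.

Lemma continuous_frac_kernel (x : R) : 0 < x < t -> continuous (fun x => f x * exp (- (al * ln (t - x)))) x.
Proof.
  intros Hx; apply (continuous_mult (K := R_AbsRing) f); [apply Hf; lra |].
  apply (ex_derive_continuous (V := R_NormedModule)); auto_derive; lra.
Qed.

(** Integration by parts against [u t - u x], which is nonnegative: the integral term has a
    favourable sign, the boundary term at 0 gives [(u t - L) * t^(- al)], and the one at [t]
    vanishes because [u] is Lipschitz and [al < 1]. *)
Lemma caputo_max_principle : (forall x, 0 < x <= t -> u x <= u t) ->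
  (u t - L) * exp (- (al * ln t)) <= v.
Proof.
  intros Hmax; apply Rle_plus_epsilon; intros eps e0.
  set (q := exp (- (al * ln t))). assert (q0 : 0 < q) by apply exp_pos.
  assert (da0 : 0 < eps / (4 * (B + 1) * q)).
  { apply Rdiv_lt_0_compat; auto; repeat apply Rmult_lt_0_compat; lra. }
  assert (eB : 0 < eps / (4 * (B + 1))) by (apply Rdiv_lt_0_compat; lra).
  (* Chosen so that [db^(1 - al) = eps / (4 * (B + 1))], which makes the boundary term at [b] at
     most [eps / 4]. *)
  set (db := exp (ln (eps / (4 * (B + 1))) / (1 - al))).
  destruct (is_RInt_gen_elim _ t v (eps / 4) _ db Ht Hv ltac:(lra) da0 (exp_pos _))
    as [a [b [I [Ha [Hat [Hbt [Hb [HI HIv]]]]]]]].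
  set (G := fun x => - ((u t - u x) * exp (- (al * ln (t - x))))).
  set (G' := fun x => f x * exp (- (al * ln (t - x)))
     - (u t - u x) * (al / (t - x)) * exp (- (al * ln (t - x)))).
  assert (DG : forall x, 0 < x < t -> is_derive G x (G' x)).
  { intros x Hx; unfold G, G'.
    assert (Eu : ex_derive u x) by (eexists; apply Hu; lra).
    auto_derive; [repeat split; auto; lra |].
    rewrite (is_derive_unique (fun x : R => u x) _ _ (Hu x ltac:(lra)) : Derive (fun x : R => u x) x = _).
    unfold Rminus; field; lra. }
  assert (CG : forall x, 0 < x < t -> continuous G' x).
  { intros x Hx; unfold G'.
    apply (continuous_minus (V := R_NormedModule) (fun x => f x * exp (- (al * ln (t - x))))).
    - apply continuous_frac_kernel; auto.
    - apply (ex_derive_continuous (V := R_NormedModule)).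
      assert (Eu : ex_derive u x) by (eexists; apply Hu; lra).
      auto_derive; repeat split; auto; lra. }
  assert (IG : is_RInt G' a b (G b - G a)).
  { apply (is_RInt_derive (V := R_CompleteNormedModule) G G').
    - intros x Hx; rewrite Rmin_left, Rmax_right in Hx by lra; apply DG; lra.
    - intros x Hx; rewrite Rmin_left, Rmax_right in Hx by lra; apply CG; lra. }
  assert (Le : G b - G a <= I).
  { apply (is_RInt_le G' (fun x => f x * exp (- (al * ln (t - x)))) a b); auto; [lra |].
    intros x Hx; unfold G'.
    assert (0 <= (u t - u x) * (al / (t - x)) * exp (- (al * ln (t - x)))); [| lra].
    apply Rmult_le_pos; [apply Rmult_le_pos | apply Rlt_le, exp_pos].
    - specialize (Hmax x ltac:(lra)); lra.
    - apply Rlt_le, Rdiv_lt_0_compat; lra. }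
  assert (La : (u t - L) * q - eps / 4 <= (u t - u a) * exp (- (al * ln (t - a)))).
  { apply Rle_trans with ((u t - u a) * q).
    - pose proof (HL a ltac:(lra)) as HLa; apply Rabs_le_between in HLa.
      assert (B * a * q <= eps / 4); [| nra].
      apply Rle_trans with ((B + 1) * q * (eps / (4 * (B + 1) * q))).
      + replace (B * a * q) with (B * q * a) by ring.
        apply Rmult_le_compat; try lra; apply Rmult_le_pos; lra.
      + apply Req_le; field; lra.
    - apply Rmult_le_compat_l; [specialize (Hmax a ltac:(lra)); lra |].
      apply exp_ln_le; lra. }
  assert (Lb : (u t - u b) * exp (- (al * ln (t - b))) <= eps / 4).
  { apply Rle_trans with (B * (t - b) * exp (- (al * ln (t - b)))).
    - apply Rmult_le_compat_r; [apply Rlt_le, exp_pos |].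
      eapply Rle_trans; [apply Rle_abs |].
      apply (Rabs_sub_le_derive u f b t B); try lra; intros x Hx; [apply Hu; lra | apply Hfb; lra].
    - replace (B * (t - b) * exp (- (al * ln (t - b)))) with (B * exp ((1 - al) * ln (t - b))).
      + apply Rle_trans with ((B + 1) * (eps / (4 * (B + 1)))); [| apply Req_le; field; lra].
        apply Rmult_le_compat; try lra; [apply Rlt_le, exp_pos |].
        rewrite <- (exp_ln _ eB) at 1; apply exp_le_le.
        replace (ln (eps / (4 * (B + 1)))) with ((1 - al) * (ln (eps / (4 * (B + 1))) / (1 - al))) by (field; lra).
        apply Rmult_le_compat_l; [lra |].
        rewrite <- (ln_exp (ln (eps / (4 * (B + 1))) / (1 - al))). fold db.
        apply ln_le; lra.
      + rewrite <- (exp_ln (t - b)) at 2 by lra. rewrite Rmult_assoc, <- exp_plus; f_equal; f_equal; ring. }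
  apply Rabs_def2 in HIv. unfold G in Le. lra.
Qed.

(** Integration by parts on [(0, m)] isolates [(u m - L) * (t - m)^(- al)], the remaining integral
    being bounded through [W]; on [(m, t)] the derivative is bounded by [F] and the kernel is
    integrated exactly. *)
Lemma caputo_split_estimate (m W F : R) : 0 < m < t ->
  (forall x, 0 < x < t -> Rabs (u x - L) <= W) -> (forall x, m <= x <= t -> Rabs (f x) <= F) ->
  Rabs (v - (u m - L) * exp (- (al * ln (t - m))))
    <= W * (exp (- (al * ln (t - m))) - exp (- (al * ln t))) + F * (exp ((1 - al) * ln (t - m)) / (1 - al)).
Proof.
  intros Hm HW HF; apply Rle_plus_epsilon; intros eps e0.
  (* [Z] bounds the kernel for all lower cut points [a < t / 2], so the boundary term at [a] is at
     most [B * a * Z]. *)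
  set (Z := 2 * exp (- (al * ln (t / 2)))).
  assert (Z0 : 0 < Z) by (unfold Z; pose proof (exp_pos (- (al * ln (t / 2)))); lra).
  assert (da0 : 0 < Rmin m (eps / (2 * (B + 1) * Z))).
  { apply Rmin_glb_lt; [lra |]. apply Rdiv_lt_0_compat; auto; apply Rmult_lt_0_compat; [lra | exact Z0]. }
  destruct (is_RInt_gen_elim _ t v (eps / 2) _ (t - m) Ht Hv ltac:(lra) da0 ltac:(lra))
    as [a [b [I [Ha [Hat [Hbt [Hb [HI HIv]]]]]]]].
  assert (Ham : a < m) by (pose proof (Rmin_l m (eps / (2 * (B + 1) * Z))); lra).
  assert (Hae : a < eps / (2 * (B + 1) * Z)) by (pose proof (Rmin_r m (eps / (2 * (B + 1) * Z))); lra).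
  set (h := fun x => f x * exp (- (al * ln (t - x)))) in *.
  assert (Ch : forall x, 0 < x < t -> continuous h x) by (intros; apply continuous_frac_kernel; auto).
  assert (Exh : forall p q, 0 < p -> p <= q -> q < t -> ex_RInt h p q).
  { intros p q Hp Hpq Hq; apply (ex_RInt_continuous (V := R_CompleteNormedModule)).
    intros x Hx; rewrite Rmin_left, Rmax_right in Hx by lra; apply Ch; lra. }
  assert (EI : I = RInt h a m + RInt h m b).
  { rewrite <- (is_RInt_unique (V := R_CompleteNormedModule) _ _ _ _ HI). symmetry.
    apply (RInt_Chasles h a m b); apply Exh; lra. }
  set (G := fun x => (u x - L) * exp (- (al * ln (t - x)))).
  set (k := fun x => (u x - L) * (al / (t - x) * exp (- (al * ln (t - x))))).
  assert (Ck : forall x, 0 < x < t -> continuous k x).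
  { intros x Hx; unfold k; apply (ex_derive_continuous (V := R_NormedModule)).
    assert (Eu : ex_derive u x) by (eexists; apply Hu; lra).
    auto_derive; repeat split; auto; lra. }
  assert (IG : is_RInt (fun x => h x + k x) a m (G m - G a)).
  { apply (is_RInt_derive (V := R_CompleteNormedModule) G).
    - intros x Hx; rewrite Rmin_left, Rmax_right in Hx by lra. unfold G, h, k.
      assert (Eu : ex_derive u x) by (eexists; apply Hu; lra).
      auto_derive; [repeat split; auto; lra |].
      rewrite (is_derive_unique (fun x : R => u x) _ _ (Hu x ltac:(lra)) : Derive (fun x : R => u x) x = _).
      unfold Rminus; field; lra.
    - intros x Hx; rewrite Rmin_left, Rmax_right in Hx by lra.
      apply (continuous_plus (V := R_NormedModule) h k); [apply Ch | apply Ck]; lra. }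
  assert (Exk : ex_RInt k a m).
  { apply (ex_RInt_continuous (V := R_CompleteNormedModule)).
    intros x Hx; rewrite Rmin_left, Rmax_right in Hx by lra; apply Ck; lra. }
  assert (E1 : RInt h a m = G m - G a - RInt k a m).
  { assert (EG := is_RInt_unique (V := R_CompleteNormedModule) _ _ _ _ IG).
    assert (EP : RInt (fun x => h x + k x) a m = RInt h a m + RInt k a m)
      by (apply (RInt_plus (V := R_CompleteNormedModule)); [apply Exh; lra | auto]).
    rewrite EP in EG; lra. }
  set (K1 := exp (- (al * ln (t - m)))) in *.
  assert (Bk : Rabs (RInt k a m) <= W * (K1 - exp (- (al * ln t)))).
  { apply Rle_trans with (W * (K1 - exp (- (al * ln (t - a))))).
    - apply (norm_RInt_le k (fun x => W * (al / (t - x) * exp (- (al * ln (t - x))))) a m); [lra | | |].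
      + intros x Hx. change (Rabs (k x) <= W * (al / (t - x) * exp (- (al * ln (t - x))))).
        assert (P : 0 < al / (t - x) * exp (- (al * ln (t - x)))).
        { apply Rmult_lt_0_compat; [apply Rdiv_lt_0_compat; lra | apply exp_pos]. }
        unfold k; rewrite Rabs_mult, (Rabs_pos_eq (al / (t - x) * _)) by lra.
        apply Rmult_le_compat_r; [lra | apply HW; lra].
      + apply (RInt_correct (V := R_CompleteNormedModule)); auto.
      + replace (W * (K1 - exp (- (al * ln (t - a))))) with (W * K1 - W * exp (- (al * ln (t - a)))) by ring.
        apply (is_RInt_derive (V := R_CompleteNormedModule) (fun x => W * exp (- (al * ln (t - x))))).
        * intros x Hx; rewrite Rmin_left, Rmax_right in Hx by lra. auto_derive; [lra | unfold Rminus; field; lra].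
        * intros x Hx; rewrite Rmin_left, Rmax_right in Hx by lra.
          apply (ex_derive_continuous (V := R_NormedModule)); auto_derive; repeat split; auto; lra.
    - apply Rmult_le_compat_l; [eapply Rle_trans; [apply Rabs_pos | apply (HW a); lra] |].
      assert (exp (- (al * ln t)) <= exp (- (al * ln (t - a)))) by (apply exp_ln_le; lra). lra. }
  assert (B2 : Rabs (RInt h m b) <= F * (exp ((1 - al) * ln (t - m)) / (1 - al))).
  { assert (F0 : 0 <= F) by (eapply Rle_trans; [apply Rabs_pos | apply (HF m); lra]).
    apply Rle_trans with (- (F / (1 - al)) * exp ((1 - al) * ln (t - b)) - - (F / (1 - al)) * exp ((1 - al) * ln (t - m))).
    - apply (norm_RInt_le h (fun x => F * exp (- (al * ln (t - x)))) m b); [lra | | |].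
      + intros x Hx; change (Rabs (h x) <= F * exp (- (al * ln (t - x)))).
        unfold h; rewrite Rabs_mult, (Rabs_pos_eq (exp _)) by (apply Rlt_le, exp_pos).
        apply Rmult_le_compat_r; [apply Rlt_le, exp_pos | apply HF; lra].
      + apply (RInt_correct (V := R_CompleteNormedModule)); apply Exh; lra.
      + apply (is_RInt_derive (V := R_CompleteNormedModule) (fun x => - (F / (1 - al)) * exp ((1 - al) * ln (t - x)))).
        * intros x Hx; rewrite Rmin_left, Rmax_right in Hx by lra. auto_derive; [lra |].
          replace (exp (- (al * ln (t - x)))) with (exp ((1 - al) * ln (t - x)) / (t - x)); [unfold Rminus; field; lra |].
          rewrite <- (exp_ln (t - x)) at 2 by lra. unfold Rdiv; rewrite <- exp_Ropp, <- exp_plus; f_equal; ring.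
        * intros x Hx; rewrite Rmin_left, Rmax_right in Hx by lra.
          apply (ex_derive_continuous (V := R_NormedModule)); auto_derive; repeat split; auto; lra.
    - assert (0 <= F / (1 - al) * exp ((1 - al) * ln (t - b))).
      { apply Rmult_le_pos; [| apply Rlt_le, exp_pos].
        apply Rmult_le_pos; [auto | apply Rlt_le, Rinv_0_lt_compat; lra]. }
      unfold Rdiv in *. lra. }
  assert (BG : Rabs (G a) <= eps / 2).
  { unfold G; rewrite Rabs_mult, (Rabs_pos_eq (exp _)) by (apply Rlt_le, exp_pos).
    apply Rle_trans with (B * a * Z).
    - apply Rmult_le_compat; [apply Rabs_pos | apply Rlt_le, exp_pos | apply HL; lra |].
      assert (exp (- (al * ln (t - a))) <= exp (- (al * ln (t / 2)))) by (apply exp_ln_le; lra).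
      unfold Z; pose proof (exp_pos (- (al * ln (t / 2)))); lra.
    - apply Rle_trans with ((B + 1) * Z * (eps / (2 * (B + 1) * Z))).
      + replace (B * a * Z) with (B * Z * a) by ring.
        apply Rmult_le_compat; try lra; apply Rmult_le_pos; lra.
      + apply Req_le; field; lra. }
  replace (v - (u m - L) * K1) with (- (I - v) + (- G a - RInt k a m + RInt h m b))
    by (rewrite EI, E1; unfold G at 1; fold K1; ring).
  apply Rabs_def2 in HIv. apply Rabs_le_between in BG. apply Rabs_le_between in Bk. apply Rabs_le_between in B2.
  apply Rabs_le_between; lra.
Qed.

End Maximum_principle.

(** * The self-similar profile *)

Lemma is_lim_seq_exp_opp (k : R) : 0 < k -> is_lim_seq (fun n => exp (- (k * INR n))) 0.
Proof.
  intros k0.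
  apply (is_lim_seq_ext (fun n => exp (- k) ^ n)).
  - intros n. rewrite <- Rpower_pow by apply exp_pos. unfold Rpower; rewrite ln_exp; f_equal; ring.
  - apply is_lim_seq_geom. rewrite Rabs_pos_eq by (apply Rlt_le, exp_pos).
    rewrite <- exp_0; apply exp_increasing; lra.
Qed.

Lemma is_lim_seq_comp_derive (f : R -> R) (w : nat -> R) (l : R) :
  is_lim_seq w l -> ex_derive f l -> is_lim_seq (fun n => f (w n)) (f l).
Proof.
  intros Hw Hf; apply is_lim_seq_continuous; auto.
  apply continuity_pt_filterlim, (ex_derive_continuous (V := R_NormedModule)); auto.
Qed.

(** A negative derivative forces smaller values just to the right; reflection about [x] treats a
    positive one. If [f2 x < 0] with [f1 x = 0], then [f1 < 0] just to the right and the mean value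
    theorem contradicts minimality. *)
Lemma second_derivative_at_min (f f1 f2 : R -> R) (x r : R) : 0 < r ->
  (forall y, is_derive f y (f1 y)) -> (forall y, is_derive f1 y (f2 y)) ->
  (forall y, x - r < y < x + r -> f x <= f y) -> f1 x = 0 /\ 0 <= f2 x.
Proof.
  intros r0 D1 D2 Hmin.
  assert (Dir : forall g l, is_derive g x l -> l < 0 -> exists d, 0 < d /\ d < r /\
     forall y, x < y <= x + d -> g y < g x).
  { intros g l Hg Hl; apply is_derive_Reals in Hg.
    destruct (Hg (- l) ltac:(lra)) as [d Hd].
    assert (M0 : 0 < Rmin d r) by (apply Rmin_glb_lt; [apply cond_pos | auto]).
    pose proof (Rmin_l d r). pose proof (Rmin_r d r).
    exists (Rmin d r / 2); repeat split; try lra. intros y Hy.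
    specialize (Hd (y - x) ltac:(lra)).
    rewrite (Rabs_pos_eq (y - x)) in Hd by lra. specialize (Hd ltac:(lra)).
    replace (x + (y - x)) with y in Hd by ring.
    apply Rabs_def2 in Hd. destruct Hd as [Hd _].
    assert (H3 : (g y - g x) / (y - x) < 0) by lra.
    apply (Rmult_lt_compat_r (y - x)) in H3; [| lra].
    replace ((g y - g x) / (y - x) * (y - x)) with (g y - g x) in H3 by (field; lra). lra. }
  assert (Z : f1 x = 0).
  { destruct (Rtotal_order (f1 x) 0) as [H | [H | H]]; auto; exfalso.
    - destruct (Dir f (f1 x) (D1 x) H) as [d [d0 [dr Hd]]].
      specialize (Hd (x + d) ltac:(lra)). specialize (Hmin (x + d) ltac:(lra)). lra.
    - assert (Dm : is_derive (fun y => f (2 * x - y)) x (- f1 x)).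
      { evar_last; [apply (is_derive_comp f (fun y => 2 * x - y)) |].
        - replace (2 * x - x) with x by ring. apply D1.
        - auto_derive; auto.
        - unfold scal; simpl; unfold mult; simpl; ring. }
      destruct (Dir _ _ Dm ltac:(lra)) as [d [d0 [dr Hd]]].
      specialize (Hd (x + d) ltac:(lra)). specialize (Hmin (2 * x - (x + d)) ltac:(lra)).
      replace (2 * x - x) with x in Hd by ring. lra. }
  split; auto.
  destruct (Rle_lt_dec 0 (f2 x)) as [H | H]; auto; exfalso.
  destruct (Dir f1 (f2 x) (D2 x) H) as [d [d0 [dr Hd]]].
  destruct (MVT_cor2 f f1 x (x + d) ltac:(lra)) as [c [E Hc]].
  { intros y _; apply is_derive_Reals, D1. }
  specialize (Hmin (x + d) ltac:(lra)). specialize (Hd c ltac:(lra)). nra.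
Qed.

Definition profile (nu z : R) : R := Wright (- z) (- nu) 1.

Definition profile_dd (nu z : R) : R := Wright (- z) (- nu) (1 - nu - nu).

Section Profile.

Variables nu th : R.
Hypothesis Hnu : 0 < nu < 1 / 2.
Hypothesis Hth : PI / 2 < th < PI.

Local Notation g := (profile nu).
Local Notation M := (Mainardi nu).
Local Notation W2 := (profile_dd nu).

Lemma is_derive_Wright_opp (b z : R) : b <= 1 ->
  is_derive (fun z => Wright (- z) (- nu) b) z (- Wright (- z) (- nu) (b - nu)).
Proof.
  intros Hb.
  assert (D := is_derive_Wright nu th Hnu Hth b (- z) Hb).
  evar_last; [apply (is_derive_comp (fun z => Wright z (- nu) b) (fun z => - z) z); [exact D | auto_derive; auto] |].
  unfold scal; simpl; unfold mult; simpl; ring.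
Qed.

Lemma is_derive_profile (z : R) : is_derive g z (- M z).
Proof. exact (is_derive_Wright_opp 1 z (Rle_refl 1)). Qed.

Lemma is_derive_Mainardi (z : R) : is_derive M z (- W2 z).
Proof. exact (is_derive_Wright_opp (1 - nu) z ltac:(lra)). Qed.

(** The constant term vanishes as [rgamma 0 = 0]; in the others the functional equation of [rgamma]
    yields a factor [- nu (n + 1)] that cancels against the factorial and shifts the index by
    one. *)
Lemma Wright_0_eq_Mainardi (y : R) : Wright (- y) (- nu) 0 = nu * y * M y.
Proof.
  unfold Mainardi; rewrite !(Wright_PSeries nu).
  assert (C0 : CV_radius (Wright_coef nu 0) = p_infty) by (apply (CV_radius_Wright_coef nu th); auto; lra).
  unfold PSeries. rewrite Series_incr_1.
  - rewrite <- Series_scal_l.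
    unfold Wright_coef at 1; simpl INR. rewrite Rmult_0_l, Rplus_0_l, rgamma_nonpos by lra.
    rewrite Rmult_0_l, !Rmult_0_r, Rmult_0_l, Rplus_0_l.
    apply Series_ext; intros n; unfold Wright_coef.
    rewrite rgamma_nonpos by (pose proof (pos_INR n); rewrite S_INR; nra).
    replace (INR (S n) * - nu + 0 + 1) with (INR n * - nu + (1 - nu)) by (rewrite S_INR; ring).
    change (fact (S n)) with (S n * fact n)%nat. rewrite mult_INR. simpl pow.
    field. split; [apply INR_fact_neq_0 | apply not_0_INR; lia].
  - apply ex_series_Rabs, CV_disk_inside; rewrite C0; exact I.
Qed.

(* the similarity variable [X / tau^nu] *)
Definition sim (X tau : R) : R := X * exp (- (nu * ln tau)).

Lemma is_derive_sim (X tau : R) : 0 < tau -> is_derive (sim X) tau (- nu / tau * sim X tau).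
Proof. intros H; unfold sim; auto_derive; [auto | field; lra]. Qed.

(** The chain rule gives [nu / tau * y * M y] at [y = sim X tau], which is the Wright function with
    second parameter 0, that is, the ray integral with [c = 1]. *)
Lemma is_derive_selfsim (X tau : R) : 0 < X -> 0 < tau ->
  is_derive (fun tau => g (sim X tau)) tau (ray_int nu th 1 tau X).
Proof.
  intros X0 t0.
  evar_last; [apply (is_derive_comp g (sim X) tau); [apply is_derive_profile | apply is_derive_sim; auto] |].
  rewrite ray_int_scal by (auto; lra). rewrite Rminus_diag, Wright_0_eq_Mainardi; fold (sim X tau).
  rewrite Rmult_1_l, exp_Ropp, exp_ln by auto.
  unfold scal; simpl; unfold mult; simpl; field; lra.
Qed.

Lemma is_RInt_gen_selfsim (X t : R) : 0 < X -> 0 < t ->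
  is_RInt_gen (fun tau => ray_int nu th 1 tau X * exp (- (2 * nu * ln (t - tau)))) (at_right 0) (at_left t)
    (Gamma (1 - 2 * nu) * (exp (- (2 * nu * ln t)) * W2 (sim X t))).
Proof.
  intros X0 t0.
  assert (I := is_RInt_gen_ray_int nu th X (2 * nu) Hnu Hth X0 ltac:(lra) t t0).
  rewrite (ray_int_scal nu th Hnu Hth (2 * nu)) in I by (auto; lra).
  replace (1 - 2 * nu) with (1 - nu - nu) in I at 2 by ring. exact I.
Qed.

Lemma Mainardi_bound_01 : exists B, 0 <= B /\ forall z, 0 <= z <= 1 -> Rabs (M z) <= B.
Proof.
  assert (P := PI_RGT_0).
  destruct (ray_kernel_dominated_z nu th Hnu Hth nu 1 ltac:(lra) ltac:(lra)) as [K HK].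
  assert (K0 : 0 <= K) by (apply (exp_dominated_pos _ _ _ (HK 0 ltac:(rewrite Rabs_R0; lra)))).
  exists (2 * (K / nu) / PI); split.
  { unfold Rdiv; repeat apply Rmult_le_pos; try lra; apply Rlt_le, Rinv_0_lt_compat; lra. }
  intros z Hz.
  assert (E : M z = ray_int nu th nu 1 z).
  { destruct (Req_dec z 0) as [-> | Hn].
    - unfold Mainardi; rewrite Ropp_0, (Wright_0 nu), (ray_int_0 nu th); auto; lra.
    - exact (Wright_ray_int nu th Hnu Hth nu z ltac:(lra) ltac:(lra)). }
  rewrite E; unfold ray_int; unfold Rdiv at 1.
  rewrite Rabs_mult, (Rabs_pos_eq (/ PI)) by (apply Rlt_le, Rinv_0_lt_compat; auto).
  apply Rmult_le_compat_r; [apply Rlt_le, Rinv_0_lt_compat; auto |].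
  apply RIntR_bound; [apply continuous_ray_kernel | apply HK | lra].
  rewrite Rabs_pos_eq; lra.
Qed.

(** * Limit of the profile at infinity *)

Definition sim_inv (y : R) : R := exp (- (ln y / nu)).

Lemma sim_inv_pos y : 0 < sim_inv y.
Proof. apply exp_pos. Qed.

Lemma sim_sim_inv y : 0 < y -> sim 1 (sim_inv y) = y.
Proof.
  intros y0; unfold sim, sim_inv; rewrite ln_exp, Rmult_1_l.
  rewrite <- (exp_ln y) at 2 by auto; f_equal; field; lra.
Qed.

Lemma sim_antitone a b : 0 < a -> a <= b -> sim 1 b <= sim 1 a.
Proof. intros a0 Hab; unfold sim; rewrite !Rmult_1_l; apply exp_ln_le; lra. Qed.

Lemma sim_pos X tau : 0 < X -> 0 < sim X tau.
Proof. intros; apply Rmult_lt_0_compat; auto; apply exp_pos. Qed.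

(** Small [tau] means a large similarity variable. The time derivative is bounded uniformly, so
    [g (sim 1 tau)] is Lipschitz in [tau] and has a limit [L] as [tau] tends to 0, with a linear
    rate. *)
Lemma profile_lim_exists : exists L B, 0 <= B /\ (forall tau, 0 < tau -> Rabs (g (sim 1 tau) - L) <= B * tau) /\ (forall tau, 0 < tau -> Rabs (ray_int nu th 1 tau 1) <= B).
Proof.
  destruct (ray_int_1_bound nu th 1 Hnu Hth Rlt_0_1) as [B [B0 HB]].
  assert (Lip : forall a b, 0 < a -> a <= b -> Rabs (g (sim 1 b) - g (sim 1 a)) <= B * (b - a)).
  { intros a b a0 Hab.
    apply (Rabs_sub_le_derive (fun tau => g (sim 1 tau)) (fun tau => ray_int nu th 1 tau 1)); auto; intros x Hx.
    - apply is_derive_selfsim; lra.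
    - apply HB; lra. }
  set (w := fun n => g (sim 1 (/ (INR n + 1)))).
  assert (Pn : forall n, 0 < / (INR n + 1)) by (intros n; apply Rinv_0_lt_compat; pose proof (pos_INR n); lra).
  assert (L0 : is_lim_seq (fun n => / (INR n + 1)) 0).
  { apply (is_lim_seq_inv (fun n => INR n + 1) p_infty); [| discriminate].
    apply (is_lim_seq_plus INR (fun _ => 1) p_infty 1 p_infty);
      [apply is_lim_seq_INR | apply is_lim_seq_const | reflexivity]. }
  assert (Cau : ex_lim_seq_cauchy w).
  { intros eps.
    assert (e2 : 0 < eps / (B + 1)) by (apply Rdiv_lt_0_compat; [apply cond_pos | lra]).
    destruct (proj2 (is_lim_seq_spec _ _) L0 (mkposreal _ e2)) as [N HN].
    exists N; intros n m Hn Hm.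
    assert (Main : forall n m, (N <= n)%nat -> (N <= m)%nat -> / (INR n + 1) <= / (INR m + 1) ->
       Rabs (w m - w n) < eps).
    { clear n m Hn Hm; intros n m Hn Hm Hnm. unfold w.
      eapply Rle_lt_trans; [apply Lip; auto |].
      specialize (HN m Hm); rewrite Rminus_0_r, Rabs_pos_eq in HN by (apply Rlt_le; auto); simpl in HN.
      pose proof (Pn n).
      apply Rle_lt_trans with (B * / (INR m + 1)); [apply Rmult_le_compat_l; lra |].
      apply Rle_lt_trans with ((B + 1) * / (INR m + 1)); [specialize (Pn m); nra |].
      apply (Rmult_lt_compat_l (B + 1)) in HN; [| lra].
      replace ((B + 1) * (eps / (B + 1))) with (pos eps) in HN by (field; lra). exact HN. }
    destruct (Rle_dec (/ (INR n + 1)) (/ (INR m + 1))).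
    - rewrite Rabs_minus_sym; apply Main; auto.
    - apply Main; auto; lra. }
  apply ex_lim_seq_cauchy_corr in Cau. destruct Cau as [L HL].
  exists L, B; repeat split; auto; [| intros; apply HB; lra].
  intros tau t0. apply Rle_plus_epsilon; intros eps e0.
  destruct (proj2 (is_lim_seq_spec _ _) HL (mkposreal _ e0)) as [N1 HN1].
  destruct (proj2 (is_lim_seq_spec _ _) L0 (mkposreal _ t0)) as [N2 HN2].
  specialize (HN1 (N1 + N2)%nat ltac:(lia)). specialize (HN2 (N1 + N2)%nat ltac:(lia)).
  set (n := (N1 + N2)%nat) in *. simpl in HN1, HN2.
  rewrite Rminus_0_r, Rabs_pos_eq in HN2 by (apply Rlt_le; auto).
  assert (Lp := Lip (/ (INR n + 1)) tau (Pn n) ltac:(lra)). fold (w n) in Lp.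
  replace (g (sim 1 tau) - L) with ((g (sim 1 tau) - w n) + (w n - L)) by ring.
  eapply Rle_trans; [apply Rabs_triang |].
  assert (B * (tau - / (INR n + 1)) <= B * tau) by (specialize (Pn n); apply Rmult_le_compat_l; lra).
  lra.
Qed.

End Profile.

(** * Monotonicity and positivity *)

Section Positivity.

Variables nu th : R.
Hypothesis Hnu : 0 < nu < 1 / 2.
Hypothesis Hth : PI / 2 < th < PI.

Local Notation g := (profile nu).
Local Notation M := (Mainardi nu).
Local Notation W2 := (profile_dd nu).

Lemma profile_0 : g 0 = 1.
Proof. unfold profile; rewrite Ropp_0, Wright_0, rgamma_pos, Gamma_1 by lra; field. Qed.

Lemma profile_dd_0 : Gamma (1 - 2 * nu) * W2 0 = 1.
Proof.
  unfold profile_dd; rewrite Ropp_0, Wright_0, rgamma_pos by lra.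
  replace (1 - nu - nu) with (1 - 2 * nu) by ring.
  pose proof (Gamma_pos (1 - 2 * nu) ltac:(lra)); field; lra.
Qed.

Section Limit.

Variables L B : R.
Hypothesis B0 : 0 <= B.
Hypothesis HL : forall tau, 0 < tau -> Rabs (g (sim nu 1 tau) - L) <= B * tau.
(** Early times use the linear rate; for [tau >= 1] the similarity variable lies in [[0, 1]], where
    [g] is Lipschitz and [g 0 = 1]. *)
Lemma profile_minus_lim_bounded : exists W, forall tau, 0 < tau -> Rabs (g (sim nu 1 tau) - L) <= W.
Proof.
  destruct (Mainardi_bound_01 nu th Hnu Hth) as [K [K0 HK]].
  exists (B + (K + Rabs (1 - L))); intros tau t0.
  pose proof (Rabs_pos (1 - L)).
  destruct (Rle_dec tau 1) as [Ht | Ht].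
  - specialize (HL tau t0). nra.
  - assert (Hs : 0 < sim nu 1 tau <= 1).
    { split; [apply sim_pos; lra |].
      replace 1 with (sim nu 1 1) at 2 by (unfold sim; rewrite ln_1, Rmult_0_r, Ropp_0, exp_0; ring).
      apply (sim_antitone nu Hnu); lra. }
    set (y := sim nu 1 tau) in *.
    assert (Hd : Rabs (g y - g 0) <= K * (y - 0)).
    { apply (Rabs_sub_le_derive g (fun z => - M z)); [lra | intros x _ |].
      - apply (is_derive_profile nu th Hnu Hth).
      - intros x Hx; rewrite Rabs_Ropp; apply HK; lra. }
    rewrite profile_0 in Hd.
    replace (g y - L) with ((g y - 1) + (1 - L)) by ring.
    eapply Rle_trans; [apply Rabs_triang |].
    nra.
Qed.

(* As [t] tends to infinity the fractional derivative times [t^(2 nu)] tends to the total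
   increment [1 - L] of the profile, and also to [Gamma (1 - 2 nu) * W2 0 = 1]. *)
Lemma profile_limit_0 : L = 0.
Proof.
  destruct profile_minus_lim_bounded as [W HW].
  destruct (Mainardi_bound_01 nu th Hnu Hth) as [K [K0 HK]].
  (* With [t = exp n], the splitting time is [m = t^ga = t * r n]. As [ga < 1], [m / t] tends to 0;
     as [(1 + nu) * ga = 1 + nu / 2], the contribution of [(m, t)], once multiplied by [t^(2 nu)],
     is of order [t^(- nu / 2)]. *)
  set (ga := (2 + nu) / (2 * (1 + nu))).
  set (k := nu / (2 * (1 + nu))).
  assert (k0 : 0 < k) by (unfold k; apply Rdiv_lt_0_compat; lra).
  assert (Ega : ga = 1 - k) by (unfold ga, k; field; lra).
  assert (Egn : (1 + nu) * ga = 1 + nu / 2) by (unfold ga; field; lra).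
  assert (ga0 : 0 < ga) by (unfold ga; apply Rdiv_lt_0_compat; lra).
  set (r := fun n => exp (- (k * INR n))).
  set (rho := fun n => exp (- (2 * nu * ln (1 - r n)))).
  set (phi := fun n => Gamma (1 - 2 * nu) * W2 (exp (- (nu * INR n)))).
  set (w := fun n => g (exp (- (nu * ga * INR n))) - L).
  set (err := fun n => W * (rho n - 1)
     + nu * K * exp (- (nu / 2 * INR n)) * (exp ((1 - 2 * nu) * ln (1 - r n)) / (1 - 2 * nu))).
  assert (Est : forall n, (1 <= n)%nat -> Rabs (phi n - w n * rho n) <= err n).
  { intros n Hn. assert (Hn' : 1 <= INR n) by (apply (le_INR 1 n); auto).
    assert (r0 : 0 < r n) by apply exp_pos.
    assert (r1 : r n < 1) by (unfold r; rewrite <- exp_0; apply exp_increasing; nra).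
    set (t := exp (INR n)). set (m := exp (ga * INR n)).
    assert (t0 : 0 < t) by apply exp_pos. assert (m0 : 0 < m) by apply exp_pos.
    assert (Em : m = t * r n) by (unfold m, t, r; rewrite <- exp_plus; f_equal; rewrite Ega; ring).
    assert (Hm : 0 < m < t) by (split; auto; rewrite Em; nra).
    assert (Etm : t - m = t * (1 - r n)) by (rewrite Em; ring).
    assert (Lt : ln t = INR n) by apply ln_exp.
    assert (Lm : ln m = ga * INR n) by apply ln_exp.
    assert (Ltm : ln (t - m) = INR n + ln (1 - r n)) by (rewrite Etm, ln_mult, Lt by lra; auto).
    assert (V := is_RInt_gen_selfsim nu th Hnu Hth 1 t Rlt_0_1 t0).
    assert (S := caputo_split_estimate (fun tau => g (sim nu 1 tau)) (fun tau => ray_int nu th 1 tau 1)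
      L B (2 * nu) t _ ltac:(lra) t0 (fun x Hx => is_derive_selfsim nu th Hnu Hth 1 x Rlt_0_1 Hx)
      (fun x Hx => continuous_ray_int_t nu th 1 Hnu Hth Rlt_0_1 x Hx) B0 HL V m W
      (nu * K * exp (- ((1 + nu) * ga * INR n))) Hm (fun x Hx => HW x (proj1 Hx))).
    assert (S' : Rabs (Gamma (1 - 2 * nu) * (exp (- (2 * nu * ln t)) * W2 (sim nu 1 t))
        - (g (sim nu 1 m) - L) * exp (- (2 * nu * ln (t - m))))
      <= W * (exp (- (2 * nu * ln (t - m))) - exp (- (2 * nu * ln t)))
       + nu * K * exp (- ((1 + nu) * ga * INR n)) * (exp ((1 - 2 * nu) * ln (t - m)) / (1 - 2 * nu))).
    (* On [[m, t]] the time derivative is [nu * y * M y / x] with [y = sim 1 x <= m^(- nu) <= 1],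
       hence at most [nu * K * m^(- (1 + nu))] in absolute value. *)
    { apply S. intros x Hx.
      rewrite ray_int_scal by (auto; lra). rewrite Rminus_diag, (Wright_0_eq_Mainardi nu th Hnu Hth); fold (sim nu 1 x).
      set (y := sim nu 1 x).
      assert (Hy0 : 0 < y) by (apply sim_pos; lra).
      assert (Hym : y <= exp (- (nu * ga * INR n))).
      { apply Rle_trans with (sim nu 1 m); [apply (sim_antitone nu Hnu); lra |].
        unfold sim; rewrite Lm, Rmult_1_l; apply exp_le_le; lra. }
      assert (Hy1 : exp (- (nu * ga * INR n)) <= 1).
      { rewrite <- exp_0; apply exp_le_le; assert (0 < nu * ga) by nra; nra. }
      assert (Hx1 : exp (- (1 * ln x)) <= exp (- (ga * INR n))).
      { rewrite <- Lm, <- (Rmult_1_l (ln m)). apply exp_ln_le; lra. }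
      rewrite Rabs_mult, Rabs_pos_eq by (apply Rlt_le, exp_pos).
      rewrite Rabs_mult, (Rabs_pos_eq (nu * y)) by nra.
      replace (nu * K * exp (- ((1 + nu) * ga * INR n)))
        with (exp (- (ga * INR n)) * (nu * exp (- (nu * ga * INR n)) * K)).
      - apply Rmult_le_compat; auto.
        + apply Rlt_le, exp_pos.
        + apply Rmult_le_pos; [nra | apply Rabs_pos].
        + apply Rmult_le_compat; [nra | apply Rabs_pos | nra | apply HK; lra].
      - replace (exp (- ((1 + nu) * ga * INR n))) with (exp (- (ga * INR n)) * exp (- (nu * ga * INR n)))
          by (rewrite <- exp_plus; f_equal; ring). ring. }
    set (q := exp (- (2 * nu * ln t))) in *.
    assert (q0 : 0 < q) by apply exp_pos.
    assert (Eq1 : exp (- (2 * nu * ln (t - m))) = q * rho n).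
    { unfold q, rho; rewrite <- exp_plus, Ltm, Lt; f_equal; ring. }
    assert (Eq2 : exp (- ((1 + nu) * ga * INR n)) * exp ((1 - 2 * nu) * ln (t - m))
      = q * (exp (- (nu / 2 * INR n)) * exp ((1 - 2 * nu) * ln (1 - r n)))).
    { unfold q; rewrite <- !exp_plus, Ltm, Lt, Egn; f_equal; field. }
    rewrite Eq1 in S'.
    replace (nu * K * exp (- ((1 + nu) * ga * INR n)) * (exp ((1 - 2 * nu) * ln (t - m)) / (1 - 2 * nu)))
      with (q * (nu * K * exp (- (nu / 2 * INR n)) * (exp ((1 - 2 * nu) * ln (1 - r n)) / (1 - 2 * nu)))) in S'.
    2: { transitivity (nu * K * (exp (- ((1 + nu) * ga * INR n)) * exp ((1 - 2 * nu) * ln (t - m))) / (1 - 2 * nu));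
         [rewrite Eq2; field; lra | field; lra]. }
    assert (Es1 : sim nu 1 t = exp (- (nu * INR n))) by (unfold sim; rewrite Lt; ring).
    assert (Es2 : sim nu 1 m = exp (- (nu * ga * INR n))).
    { unfold sim; rewrite Lm, Rmult_1_l; f_equal; ring. }
    rewrite Es1, Es2 in S'.
    apply (Rmult_le_reg_l q); auto.
    replace (q * Rabs (phi n - w n * rho n)) with (Rabs (q * (phi n - w n * rho n)))
      by (rewrite Rabs_mult, (Rabs_pos_eq q); lra).
    eapply Rle_trans; [| eapply Rle_trans; [exact S' |]]; apply Req_le.
    - f_equal; unfold phi, w; ring.
    - unfold err; ring. }
  assert (Lr : is_lim_seq r 0) by (apply is_lim_seq_exp_opp; auto).
  assert (L1 : is_lim_seq phi 1).
  { rewrite <- profile_dd_0.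
    refine (is_lim_seq_comp_derive (fun z => Gamma (1 - 2 * nu) * W2 z) _ 0 _ _).
    - apply is_lim_seq_exp_opp; lra.
    - apply ex_derive_scal; eexists; exact (is_derive_Wright_opp nu th Hnu Hth (1 - nu - nu) 0 ltac:(lra)). }
  assert (L2 : is_lim_seq w (1 - L)).
  { rewrite <- profile_0.
    refine (is_lim_seq_comp_derive (fun z => g z - L) _ 0 _ _).
    - apply is_lim_seq_exp_opp; nra.
    - apply (ex_derive_minus (V := R_NormedModule) g (fun _ => L)); [| apply ex_derive_const].
      eexists; apply (is_derive_profile nu th Hnu Hth). }
  assert (L3 : is_lim_seq rho 1).
  { assert (H := is_lim_seq_comp_derive (fun x => exp (- (2 * nu * ln (1 - x)))) r 0 Lr
      ltac:(auto_derive; lra)).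
    simpl in H; rewrite Rminus_0_r, ln_1, Rmult_0_r, Ropp_0, exp_0 in H; exact H. }
  assert (L4 : is_lim_seq err 0).
  { assert (H1 := is_lim_seq_comp_derive (fun x => W * (x - 1)) rho 1 L3 ltac:(auto_derive; auto)).
    simpl in H1; rewrite Rminus_diag, Rmult_0_r in H1.
    assert (H2 := is_lim_seq_comp_derive (fun x => exp ((1 - 2 * nu) * ln (1 - x)) / (1 - 2 * nu)) r 0 Lr
      ltac:(auto_derive; lra)).
    simpl in H2.
    assert (H3 := is_lim_seq_exp_opp (nu / 2) ltac:(lra)).
    assert (H4 := is_lim_seq_mult' _ _ _ _ (is_lim_seq_mult' _ _ _ _ (is_lim_seq_const (nu * K)) H3) H2).
    rewrite Rmult_0_r, Rmult_0_l in H4.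
    assert (H5 := is_lim_seq_plus' _ _ _ _ H1 H4); rewrite Rplus_0_l in H5; exact H5. }
  assert (L5 : is_lim_seq (fun n => Rabs (phi n - w n * rho n)) (Rabs (1 - (1 - L) * 1))).
  { apply (is_lim_seq_abs _ (Finite _)), is_lim_seq_minus'; auto. apply is_lim_seq_mult'; auto. }
  (* In the limit the estimate reads [|1 - (1 - L)| <= 0], that is, [L = 0]. *)
  assert (Le : Rbar_le (Rabs (1 - (1 - L) * 1)) 0).
  { apply (is_lim_seq_le_loc _ _ _ _ (ex_intro _ 1%nat Est) L5 L4). }
  simpl in Le. pose proof (Rabs_pos (1 - (1 - L) * 1)).
  assert (Z : Rabs (1 - (1 - L) * 1) = 0) by lra.
  apply Rabs_eq_0 in Z; lra.
Qed.

End Limit.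

Lemma profile_sim_small : exists B, 0 <= B /\
  (forall tau, 0 < tau -> Rabs (g (sim nu 1 tau)) <= B * tau) /\
  (forall tau, 0 < tau -> Rabs (ray_int nu th 1 tau 1) <= B).
Proof.
  destruct (profile_lim_exists nu th Hnu Hth) as [L [B [B0 [HL HB]]]].
  assert (L0 := profile_limit_0 L B B0 HL); subst L.
  exists B; repeat split; auto. intros tau t0; generalize (HL tau t0); now rewrite Rminus_0_r.
Qed.

(** Times before [t] correspond to arguments beyond [y], so a maximum on [[y, oo)] is a maximum over
    the past of [t]. With [L = 0], the factor [t^(- 2 nu)] is common to both sides of the maximum
    principle. *)
Lemma profile_max (y : R) : 0 < y -> (forall z, y <= z -> g z <= g y) -> g y <= Gamma (1 - 2 * nu) * W2 y.
Proof.
  intros y0 Hmax; destruct profile_sim_small as [B [B0 [HL HB]]].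
  set (t := sim_inv nu y). assert (t0 : 0 < t) by apply sim_inv_pos.
  assert (Et : sim nu 1 t = y) by (apply (sim_sim_inv nu Hnu); auto).
  assert (V := is_RInt_gen_selfsim nu th Hnu Hth 1 t Rlt_0_1 t0).
  assert (P := caputo_max_principle (fun tau => g (sim nu 1 tau)) (fun tau => ray_int nu th 1 tau 1)
      0 B (2 * nu) t _ ltac:(lra) t0 (fun x Hx => is_derive_selfsim nu th Hnu Hth 1 x Rlt_0_1 Hx)
      (fun x Hx => continuous_ray_int_t nu th 1 Hnu Hth Rlt_0_1 x Hx) B0
      (fun x Hx => eq_ind_r (fun q => Rabs q <= B * x) (HL x Hx) (Rminus_0_r _)) HB V).
  simpl in P; rewrite Et, Rminus_0_r in P.
  apply (Rmult_le_reg_r (exp (- (2 * nu * ln t)))); [apply exp_pos |].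
  eapply Rle_trans; [apply P | apply Req_le; unfold profile_dd; ring].
  intros x Hx; apply Hmax; rewrite <- Et; apply (sim_antitone nu Hnu); lra.
Qed.

Lemma profile_min (y : R) : 0 < y -> (forall z, y <= z -> g y <= g z) -> Gamma (1 - 2 * nu) * W2 y <= g y.
Proof.
  intros y0 Hmin; destruct profile_sim_small as [B [B0 [HL HB]]].
  set (t := sim_inv nu y). assert (t0 : 0 < t) by apply sim_inv_pos.
  assert (Et : sim nu 1 t = y) by (apply (sim_sim_inv nu Hnu); auto).
  assert (V := is_RInt_gen_selfsim nu th Hnu Hth 1 t Rlt_0_1 t0).
  apply (is_RInt_gen_opp (V := R_NormedModule)) in V.
  assert (V' : is_RInt_gen (fun x => - ray_int nu th 1 x 1 * exp (- (2 * nu * ln (t - x)))) (at_right 0) (at_left t)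
     (- (Gamma (1 - 2 * nu) * (exp (- (2 * nu * ln t)) * W2 (sim nu 1 t))))).
  { refine (is_RInt_gen_ext (V := R_NormedModule) _ _ _ _ V).
    apply filter_forall; intros ab x _; unfold opp; simpl; ring. }
  assert (P := caputo_max_principle (fun tau => - g (sim nu 1 tau)) (fun tau => - ray_int nu th 1 tau 1)
      0 B (2 * nu) t (- (Gamma (1 - 2 * nu) * (exp (- (2 * nu * ln t)) * W2 (sim nu 1 t)))) ltac:(lra) t0
      (fun x Hx => is_derive_opp _ _ _ (is_derive_selfsim nu th Hnu Hth 1 x Rlt_0_1 Hx))
      (fun x Hx => continuous_opp (V := R_NormedModule) _ _ (continuous_ray_int_t nu th 1 Hnu Hth Rlt_0_1 x Hx)) B0).
  assert (H1 : forall x, 0 < x -> Rabs (- g (sim nu 1 x) - 0) <= B * x).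
  { intros x Hx; rewrite Rminus_0_r, Rabs_Ropp; auto. }
  assert (H2 : forall x, 0 < x -> Rabs (- ray_int nu th 1 x 1) <= B).
  { intros x Hx; rewrite Rabs_Ropp; auto. }
  specialize (P H1 H2 V'); simpl in P; rewrite Et, Rminus_0_r in P.
  assert (Q : - g y * exp (- (2 * nu * ln t)) <= - (Gamma (1 - 2 * nu) * (exp (- (2 * nu * ln t)) * W2 y))).
  { apply P. intros x Hx; apply Ropp_le_contravar, Hmin; rewrite <- Et; apply (sim_antitone nu Hnu); lra. }
  apply (Rmult_le_reg_r (exp (- (2 * nu * ln t)))); [apply exp_pos | lra].
Qed.

Lemma profile_small_at_infty (eps : R) : 0 < eps -> exists Z, 0 < Z /\ forall z, Z < z -> Rabs (g z) < eps.
Proof.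
  intros e0; destruct profile_sim_small as [B [B0 [HL _]]].
  assert (q0 : 0 < eps / (B + 1)) by (apply Rdiv_lt_0_compat; lra).
  exists (sim nu 1 (eps / (B + 1))); split; [apply sim_pos; lra |].
  intros z Hz. assert (z0 : 0 < z) by (eapply Rlt_trans; [apply (sim_pos nu 1 (eps / (B + 1))); lra | exact Hz]).
  rewrite <- (sim_sim_inv nu Hnu z z0) in Hz |- *.
  assert (Hlt : sim_inv nu z < eps / (B + 1)).
  { destruct (Rlt_le_dec (sim_inv nu z) (eps / (B + 1))) as [H | H]; auto.
    apply (sim_antitone nu Hnu) in H; lra. }
  eapply Rle_lt_trans; [apply HL, sim_inv_pos |].
  pose proof (sim_inv_pos nu z).
  apply Rle_lt_trans with ((B + 1) * sim_inv nu z); [nra |].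
  apply (Rmult_lt_compat_l (B + 1)) in Hlt; [| lra].
  replace ((B + 1) * (eps / (B + 1))) with eps in Hlt by (field; lra); auto.
Qed.

Lemma continuity_profile (z : R) : continuity_pt g z.
Proof.
  apply continuity_pt_filterlim, (ex_derive_continuous (V := R_NormedModule)).
  eexists; apply (is_derive_profile nu th Hnu Hth).
Qed.

Lemma is_derive_opp_Mainardi (z : R) : is_derive (fun z => - M z) z (W2 z).
Proof.
  assert (D := is_derive_opp _ _ _ (is_derive_Mainardi nu th Hnu Hth z)).
  unfold opp in D; simpl in D; rewrite Ropp_involutive in D; exact D.
Qed.

(** A negative value would force a negative global minimum, interior because [g 0 = 1] and [g] tends
    to 0. There [g'' >= 0], while [profile_min] makes it negative. *)
Lemma profile_nonneg (z : R) : 0 <= z -> 0 <= g z.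
Proof.
  intros z0; destruct (Rle_lt_dec 0 (g z)) as [H | H]; auto; exfalso.
  destruct (profile_small_at_infty (- g z) ltac:(lra)) as [Z [Z0 HZ]].
  assert (HzZ : z <= Z).
  { destruct (Rle_lt_dec z Z) as [H' | H']; auto. apply HZ, Rabs_def2 in H'; lra. }
  destruct (continuity_ab_min g 0 Z ltac:(lra) (fun c _ => continuity_profile c)) as [m [Hm Hm0]].
  assert (Gm : g m <= g z) by (apply Hm; lra).
  assert (Glob : forall y, 0 <= y -> g m <= g y).
  { intros y Hy; destruct (Rle_lt_dec y Z); [apply Hm; lra |].
    apply HZ, Rabs_def2 in r; lra. }
  assert (m0 : 0 < m).
  { destruct (Req_dec m 0) as [-> | Hn]; [rewrite profile_0 in Gm; lra | lra]. }
  destruct (second_derivative_at_min g (fun z => - M z) W2 m m m0 (is_derive_profile nu th Hnu Hth) is_derive_opp_Mainardi)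
    as [_ S2].
  { intros y Hy; apply Glob; lra. }
  assert (P := profile_min m m0 (fun y Hy => Glob y ltac:(lra))).
  pose proof (Gamma_pos (1 - 2 * nu) ltac:(lra)).
  assert (0 <= Gamma (1 - 2 * nu) * W2 m) by (apply Rmult_le_pos; lra). lra.
Qed.

(** An increase from [a] to [b] would put the maximum over [[a, oo)] at some [m > a] with [g m > 0],
    since [g a >= 0]. There [g'' <= 0], against [profile_max]. *)
Lemma profile_nonincreasing (a b : R) : 0 <= a -> a <= b -> g b <= g a.
Proof.
  intros a0 Hab; destruct (Rle_lt_dec (g b) (g a)) as [H | H]; auto; exfalso.
  assert (Ga := profile_nonneg a a0).
  destruct (profile_small_at_infty (g b) ltac:(lra)) as [Z [Z0 HZ]].
  assert (HbZ : b <= Z).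
  { destruct (Rle_lt_dec b Z) as [H' | H']; auto. apply HZ, Rabs_def2 in H'; lra. }
  destruct (continuity_ab_maj g a Z ltac:(lra) (fun c _ => continuity_profile c)) as [m [Hm Hm0]].
  assert (Gm : g b <= g m) by (apply Hm; lra).
  assert (Glob : forall y, a <= y -> g y <= g m).
  { intros y Hy; destruct (Rle_lt_dec y Z); [apply Hm; lra |].
    apply HZ, Rabs_def2 in r; lra. }
  assert (m0 : a < m).
  { destruct (Req_dec m a) as [-> | Hn]; lra. }
  destruct (second_derivative_at_min (fun z => - g z) M (fun z => - W2 z) m (m - a) ltac:(lra)) as [_ S2].
  { intros y; assert (D := is_derive_opp _ _ _ (is_derive_profile nu th Hnu Hth y)).
    unfold opp in D; simpl in D; rewrite Ropp_involutive in D; exact D. }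
  { intros y; apply (is_derive_Mainardi nu th Hnu Hth). }
  { intros y Hy; apply Ropp_le_contravar, Glob; lra. }
  assert (P := profile_max m ltac:(lra) (fun y Hy => Glob y ltac:(lra))).
  pose proof (Gamma_pos (1 - 2 * nu) ltac:(lra)).
  assert (Gamma (1 - 2 * nu) * W2 m <= 0) by nra. lra.
Qed.

Lemma Mainardi_nonneg (z : R) : 0 <= z -> 0 <= M z.
Proof.
  intros z0; destruct (Rle_lt_dec 0 (M z)) as [H | H]; auto; exfalso.
  assert (D := is_derive_profile nu th Hnu Hth z). apply is_derive_Reals in D.
  destruct (D (- M z) ltac:( lra)) as [d Hd].
  pose proof (cond_pos d).
  specialize (Hd (d / 2) ltac:(lra)). rewrite (Rabs_pos_eq (d / 2)) in Hd by lra.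
  specialize (Hd ltac:(lra)). 
  pose proof (profile_nonincreasing z (z + d / 2) z0 ltac:(lra)) as G.
  apply Rabs_def2 in Hd. destruct Hd as [_ Hd].
  assert (Q : (g (z + d / 2) - g z) / (d / 2) <= 0).
  { apply (Rmult_le_reg_r (d / 2)); [lra |].
    replace ((g (z + d / 2) - g z) / (d / 2) * (d / 2)) with (g (z + d / 2) - g z) by (field; lra). lra. }
  lra.
Qed.

Lemma is_derive_n_Wright (n : nat) (x : R) :
  is_derive_n (fun z => Wright z (- nu) 1) n x (Wright x (- nu) (1 - nu * INR n)).
Proof.
  revert x; induction n as [| n IH]; intros x.
  - simpl; rewrite Rmult_0_r, Rminus_0_r; reflexivity.
  - change (is_derive (Derive_n (fun z => Wright z (- nu) 1) n) x (Wright x (- nu) (1 - nu * INR (S n)))).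
    apply (is_derive_ext (fun z => Wright z (- nu) (1 - nu * INR n))).
    + intros t; symmetry; apply is_derive_n_unique, IH.
    + replace (1 - nu * INR (S n)) with (1 - nu * INR n - nu) by (rewrite S_INR; ring).
      apply (is_derive_Wright nu th Hnu Hth). pose proof (pos_INR n); nra.
Qed.

(* Taylor expansion at a point where all derivatives vanish; the remainder tends to 0
   because the function is entire. *)
Lemma profile_not_flat (z0 : R) : 0 < z0 -> ~ (forall z, z0 <= z -> g z = 0).
Proof.
  intros Hz0 Hflat.
  (* The unit neighbourhood of [- Z] lies in the flat region, so every Taylor coefficient there
     vanishes; the expansion is evaluated at 0, where the function is 1. *)
  set (Z := z0 + 1).
  set (h := fun z => Wright z (- nu) 1).
  assert (Flat : forall n, Derive_n h n (- Z) = 0).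
  { intros n. rewrite (Derive_n_ext_loc h (fun _ => 0)).
    - destruct n; [reflexivity | apply Derive_n_const].
    - exists (mkposreal 1 Rlt_0_1); intros y Hy.
      apply Rabs_def2 in Hy; unfold minus, plus, opp in Hy; simpl in Hy.
      rewrite <- (Hflat (- y)) by (unfold Z in Hy; lra). unfold profile, h; rewrite Ropp_involutive; auto. }
  (* The exponent starts at [c = nu], the first derivative, because [c = 0] is excluded; index [n]
     of the bound thus serves the derivative of order [n + 1]. *)
  destruct (ray_int_tail_bound nu th Hnu Hth nu Z ltac:(lra) ltac:(unfold Z; lra)) as [B HB].
  assert (Main : forall n, Rabs (h 0) <= Z * B * (1 / 2) ^ n).
  { intros n.
    destruct (Taylor_Lagrange h n (- Z) 0 ltac:(unfold Z; lra)) as [zeta [Hzeta E]].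
    { intros t _ k _; destruct k; [exact I |]. eexists; exact (is_derive_n_Wright (S k) t). }
    rewrite (sum_eq _ (fun _ => 0)) in E by (intros i _; rewrite Flat; ring).
    rewrite sum_eq_R0 in E by auto. rewrite Rplus_0_l in E.
    assert (Eh : Derive_n h (S n) zeta = Wright zeta (- nu) (1 - nu * INR (S n)))
      by exact (is_derive_n_unique _ _ _ _ (is_derive_n_Wright (S n) zeta)).
    rewrite E, Eh.
    replace (0 - - Z) with Z by ring.
    replace (Wright zeta (- nu) (1 - nu * INR (S n))) with (ray_int nu th (nu + nu * INR n) 1 (- zeta)).
    2: { rewrite <- (Wright_ray_int nu th Hnu Hth) by (pose proof (pos_INR n); nra).
         rewrite Ropp_involutive; f_equal; rewrite S_INR; ring. }
    assert (Z0 : 0 < Z) by (unfold Z; lra).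
    specialize (HB n (- zeta) ltac:(rewrite Rabs_pos_eq; lra)).
    set (R := ray_int nu th (nu + nu * INR n) 1 (- zeta)) in *.
    rewrite Rabs_mult, (Rabs_pos_eq (Z ^ S n / INR (fact (S n)))).
    - assert (F : Z ^ S n / INR (fact (S n)) <= Z * (Z ^ n / INR (fact n))).
      { change (fact (S n)) with (S n * fact n)%nat. rewrite mult_INR. simpl pow.
        assert (f0 := INR_fact_lt_0 n).
        assert (s1 : 1 <= INR (S n)) by (apply (le_INR 1); lia).
        assert (p0 : 0 < Z ^ n) by (apply pow_lt; auto).
        replace (Z * Z ^ n / (INR (S n) * INR (fact n))) with (Z * (Z ^ n / INR (fact n)) * / INR (S n))
          by (field; lra).
        rewrite <- (Rmult_1_r (Z * (Z ^ n / INR (fact n)))) at 2.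
        apply Rmult_le_compat_l.
        - apply Rmult_le_pos; [lra |]. apply Rlt_le, Rdiv_lt_0_compat; auto.
        - rewrite <- Rinv_1; apply Rinv_le_contravar; lra. }
      apply Rle_trans with (Z * (Rabs R * (Z ^ n / INR (fact n)))).
      + rewrite (Rmult_comm _ (Rabs R)). rewrite <- Rmult_assoc, (Rmult_comm Z (Rabs R)), Rmult_assoc.
        apply Rmult_le_compat_l; [apply Rabs_pos | exact F].
      + rewrite Rmult_assoc; apply Rmult_le_compat_l; [lra | exact HB].
    - apply Rlt_le, Rdiv_lt_0_compat; [apply pow_lt; auto | apply INR_fact_lt_0]. }
  assert (L : is_lim_seq (fun n => Z * B * (1 / 2) ^ n) 0).
  { replace (Finite 0) with (Rbar_mult (Z * B) 0) by (simpl; f_equal; ring).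
    apply is_lim_seq_scal_l, is_lim_seq_geom. rewrite Rabs_pos_eq; lra. }
  assert (Le := is_lim_seq_le _ _ (Rabs (h 0)) 0 Main (is_lim_seq_const _) L). simpl in Le.
  assert (h0 : h 0 = 1) by (rewrite <- profile_0; unfold profile, h; rewrite Ropp_0; auto).
  rewrite h0, Rabs_R1 in Le; lra.
Qed.

(** A zero of the nonnegative function [M] is a minimum, so [g'' = - M'] vanishes there. As [g] is
    nonincreasing, [profile_max] applies and gives [g z <= 0], whence [g] is 0 from [z] on. *)
Lemma Mainardi_pos (z : R) : 0 < z -> 0 < M z.
Proof.
  intros z0; destruct (Rle_lt_or_eq_dec 0 (M z) (Mainardi_nonneg z ltac:(lra))) as [H | H]; auto; exfalso.
  assert (S1 : W2 z = 0).
  { destruct (second_derivative_at_min (fun z => M z) (fun z => - W2 z)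
      (fun z => Wright (- z) (- nu) (1 - nu - nu - nu)) z z z0) as [E _].
    - intros y; apply (is_derive_Mainardi nu th Hnu Hth).
    - intros y. assert (D := is_derive_opp _ _ _ (is_derive_Wright_opp nu th Hnu Hth (1 - nu - nu) y ltac:(lra))).
      unfold opp in D; simpl in D; rewrite Ropp_involutive in D; exact D.
    - intros y Hy; rewrite <- H; apply Mainardi_nonneg; lra.
    - lra. }
  assert (P := profile_max z z0 (fun y Hy => profile_nonincreasing z y ltac:(lra) Hy)).
  rewrite S1, Rmult_0_r in P.
  apply (profile_not_flat z z0); intros y Hy.
  apply Rle_antisym; [| apply profile_nonneg; lra].
  eapply Rle_trans; [apply (profile_nonincreasing z y); lra | auto].
Qed.

End Positivity.

(** * The Stefan problem *)

Lemma tpow_pos (t a : R) : 0 < t -> tpow t a = exp (a * ln t).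
Proof. intros Ht; unfold tpow; destruct (Rlt_dec 0 t); [reflexivity | lra]. Qed.

Lemma is_derive_tpow (C a t : R) : 0 < t ->
  is_derive (fun t => C * tpow t a) t (C * (a * exp ((a - 1) * ln t))).
Proof.
  intros Ht.
  apply (is_derive_ext_loc (fun t => C * exp (a * ln t))).
  - generalize (open_gt 0 t Ht); apply filter_imp; intros x Hx; now rewrite tpow_pos.
  - auto_derive; auto.
    replace (exp ((a - 1) * ln t)) with (exp (a * ln t) / t).
    + field; lra.
    + rewrite <- (exp_ln t) at 2 by auto. unfold Rdiv; rewrite <- exp_Ropp, <- exp_plus; f_equal; ring.
Qed.

(** Substitution [tau = t exp x / (1 + exp x)], with inverse [ln (tau / (t - tau))], in the
    logarithmic form of the Beta integral. *)
Lemma is_RInt_gen_Beta (a b t : R) : 0 < a -> 0 < b -> 0 < t ->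
  is_RInt_gen (fun tau => exp ((a - 1) * ln tau) * exp ((b - 1) * ln (t - tau))) (at_right 0) (at_left t)
    (exp ((a + b - 1) * ln t) * (Gamma a * Gamma b / Gamma (a + b))).
Proof.
  intros a0 b0 t0.
  assert (P : forall x, 0 < 1 + exp x) by (intros x; pose proof (exp_pos x); lra).
  refine (is_RInt_gen_subst _ (fun x => t * exp x / (1 + exp x)) (fun x => t * exp x / (1 + exp x) ^ 2)
    (fun u => ln (u / (t - u))) (fun u => 0 < u < t) _ _ _ _ _ _ _ _ _ _ _).
  - intros x Hx; apply (ex_derive_continuous (V := R_NormedModule)); auto_derive; repeat split; lra.
  - intros; lra.
  - intros x; pose proof (P x); pose proof (exp_pos x); split.
    + apply Rdiv_lt_0_compat; auto; apply Rmult_lt_0_compat; auto.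
    + apply (Rmult_lt_reg_r (1 + exp x)); auto.
      replace (t * exp x / (1 + exp x) * (1 + exp x)) with (t * exp x) by (field; lra). nra.
  - intros x; pose proof (P x); auto_derive; [lra | field; lra].
  - intros x; pose proof (P x); apply (ex_derive_continuous (V := R_NormedModule)); auto_derive.
    apply Rgt_not_eq. nra.
  - intros N. set (d := t * exp N / (1 + exp N)).
    assert (d0 : 0 < d) by (apply Rdiv_lt_0_compat; auto; apply Rmult_lt_0_compat; auto; apply exp_pos).
    assert (dt : d < t).
    { unfold d; apply (Rmult_lt_reg_r (1 + exp N)); auto.
      replace (t * exp N / (1 + exp N) * (1 + exp N)) with (t * exp N) by (field; specialize (P N); lra). nra. }
    assert (HN : forall u : R, 0 < u < d ->
      t * exp (ln (u / (t - u))) / (1 + exp (ln (u / (t - u)))) = u /\ ln (u / (t - u)) < N).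
    { intros u Hu.
    assert (Q : 0 < u / (t - u)) by (apply Rdiv_lt_0_compat; lra).
    split; [rewrite exp_ln by auto; field; lra |].
    rewrite <- (ln_exp N); apply ln_increasing; auto.
    apply (Rmult_lt_reg_r (t - u)); [lra |]. replace (u / (t - u) * (t - u)) with u by (field; lra).
    assert (Hd : d * (1 + exp N) = t * exp N) by (unfold d; field; specialize (P N); lra).
    pose proof (exp_pos N). nra. }
    generalize (at_right_near 0 d d0); apply filter_imp; intros u Hu; apply HN, Hu.
  - intros N. set (d := t / (1 + exp N)).
    assert (d0 : 0 < d) by (apply Rdiv_lt_0_compat; auto).
    assert (dt : d < t).
    { unfold d; apply (Rmult_lt_reg_r (1 + exp N)); auto. pose proof (exp_pos N).
      replace (t / (1 + exp N) * (1 + exp N)) with t by (field; specialize (P N); lra). nra. }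
    assert (HN : forall u : R, t - d < u < t ->
      t * exp (ln (u / (t - u))) / (1 + exp (ln (u / (t - u)))) = u /\ N < ln (u / (t - u))).
    { intros u Hu.
    assert (Q : 0 < u / (t - u)) by (apply Rdiv_lt_0_compat; lra).
    split; [rewrite exp_ln by auto; field; lra |].
    rewrite <- (ln_exp N); apply ln_increasing; [apply exp_pos |].
    apply (Rmult_lt_reg_r (t - u)); [lra |]. replace (u / (t - u) * (t - u)) with u by (field; lra).
    assert (Hd : d * (1 + exp N) = t) by (unfold d; field; specialize (P N); lra).
    pose proof (exp_pos N). nra. }
    generalize (at_left_near t (t - d) ltac:(lra)); apply filter_imp; intros u Hu; apply HN, Hu.
  - eapply is_RIntR_ext; [| apply (is_RIntR_scal _ (exp ((a + b - 1) * ln t)) _ (is_RIntR_Beta a b a0 b0))].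
    intros x; simpl; pose proof (P x) as Px; pose proof (exp_pos x) as Ex.
    set (l := ln (1 + exp x)).
    assert (E0 : exp (- l) = / (1 + exp x)) by (unfold l; rewrite exp_Ropp, exp_ln; auto).
    assert (E1 : ln (t * exp x / (1 + exp x)) = ln t + x - l).
    { assert (T0 : 0 < t * exp x) by (apply Rmult_lt_0_compat; auto).
      unfold Rdiv; rewrite ln_mult by (auto; apply Rinv_0_lt_compat; auto).
      rewrite ln_mult by auto. rewrite ln_exp, ln_Rinv by auto. unfold l; ring. }
    assert (E2 : ln (t - t * exp x / (1 + exp x)) = ln t - l).
    { replace (t - t * exp x / (1 + exp x)) with (t * / (1 + exp x)) by (field; lra).
      rewrite ln_mult by (auto; apply Rinv_0_lt_compat; auto). rewrite ln_Rinv by auto; unfold l; ring. }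
    assert (E3 : t * exp x / ((1 + exp x) * ((1 + exp x) * 1)) = exp (ln t + x - l - l)).
    { replace (ln t + x - l - l) with (ln t + (x + (- l + - l))) by ring.
      rewrite !exp_plus, exp_ln, E0 by auto; field; lra. }
    rewrite E1, E2, E3, <- !exp_plus; f_equal; ring.
Qed.

Lemma is_RInt_gen_ext_between (f g : R -> R) (t l : R) : 0 < t ->
  (forall x, 0 < x < t -> f x = g x) ->
  is_RInt_gen f (at_right 0) (at_left t) l -> is_RInt_gen g (at_right 0) (at_left t) l.
Proof.
  intros t0 H; apply (is_RInt_gen_ext (V := R_NormedModule)).
  eapply Filter_prod; [apply (at_right_near 0 t t0) | apply (at_left_near t 0 t0) |].
  intros a b Ha Hb x Hx; simpl in Hx; apply H.
  revert Hx; unfold Rmin, Rmax; destruct (Rle_dec a b); lra.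
Qed.

(** The derivative [nu * tau^(nu - 1)] leads to a Beta integral with parameters [nu] and [1 - 2 nu],
    whose sum is [1 - nu]; the prefactor cancels [Gamma (1 - 2 nu)], and
    [nu * Gamma nu = Gamma (1 + nu)]. *)
Lemma is_caputo_tpow (nu C t : R) : 0 < nu < 1 / 2 -> 0 < t ->
  is_caputo (2 * nu) (fun t => C * tpow t nu) t (C * (Gamma (1 + nu) / Gamma (1 - nu)) * exp (- (nu * ln t))).
Proof.
  intros Hnu t0; split.
  - intros tau Htau; eexists; apply is_derive_tpow; lra.
  - assert (I := is_RInt_gen_Beta nu (1 - 2 * nu) t ltac:(lra) ltac:(lra) t0).
    apply (is_RInt_gen_scal (V := R_NormedModule) _ (/ Gamma (1 - 2 * nu) * (C * nu))) in I.
    assert (G1 := Gamma_pos (1 - 2 * nu) ltac:(lra)). assert (G2 := Gamma_pos (1 - nu) ltac:(lra)).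
    match type of I with is_RInt_gen _ _ _ ?v =>
      assert (Ev : v = C * (Gamma (1 + nu) / Gamma (1 - nu)) * exp (- (nu * ln t))) end.
    { unfold scal; simpl; unfold mult; simpl.
      rewrite (Rplus_comm 1 nu), Gamma_plus_1 by lra.
      replace (nu + (1 - 2 * nu)) with (1 - nu) by ring.
      replace ((1 - nu - 1) * ln t) with (- (nu * ln t)) by ring. field; lra. }
    rewrite Ev in I.
    refine (is_RInt_gen_ext_between _ _ t _ t0 _ I); intros x Hx.
      rewrite (is_derive_unique _ _ _ (is_derive_tpow C nu x ltac:(lra))
        : Derive (fun t : R => C * tpow t nu) x = _).
      unfold scal; simpl; unfold mult; simpl. unfold Rpower, Rdiv.
      replace ((1 - 2 * nu - 1) * ln (t - x)) with (- (2 * nu * ln (t - x))) by ring.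
      rewrite exp_Ropp; ring.
Qed.

(* Any angle strictly between [PI / 2] and [PI] would do. *)
Definition th0 : R := 3 * PI / 4.

Lemma th0_range : PI / 2 < th0 < PI.
Proof. unfold th0; pose proof PI_RGT_0; lra. Qed.

Lemma is_caputo_profile (nu X A B t : R) : 0 < nu < 1 / 2 -> 0 < X -> 0 < t ->
  is_caputo (2 * nu) (fun tau => B + A * profile nu (sim nu X tau)) t
    (A * (exp (- (2 * nu * ln t)) * profile_dd nu (sim nu X t))).
Proof.
  intros Hnu X0 t0.
  assert (D : forall tau, 0 < tau -> is_derive (fun tau => B + A * profile nu (sim nu X tau)) tau
     (A * ray_int nu th0 1 tau X)).
  { intros tau Htau. rewrite <- (Rplus_0_l (A * _)).
    apply (is_derive_plus (V := R_NormedModule) (fun _ => B)); [apply (is_derive_const (V := R_NormedModule)) |].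
    apply is_derive_scal. apply (is_derive_selfsim nu th0 Hnu th0_range); auto. }
  split.
  - intros tau Htau; eexists; apply D; lra.
  - assert (I := is_RInt_gen_selfsim nu th0 Hnu th0_range X t X0 t0).
    apply (is_RInt_gen_scal (V := R_NormedModule) _ (/ Gamma (1 - 2 * nu) * A)) in I.
    assert (G1 := Gamma_pos (1 - 2 * nu) ltac:(lra)).
    match type of I with is_RInt_gen _ _ _ ?v =>
      assert (Ev : v = A * (exp (- (2 * nu * ln t)) * profile_dd nu (sim nu X t))) end.
    { unfold scal; simpl; unfold mult; simpl; field; lra. }
    rewrite Ev in I.
    refine (is_RInt_gen_ext_between _ _ t _ t0 _ I); intros x Hx.
      rewrite (is_derive_unique _ _ _ (D x ltac:(lra))
        : Derive (fun tau : R => B + A * profile nu (sim nu X tau)) x = _).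
      unfold scal; simpl; unfold mult; simpl. unfold Rpower, Rdiv.
      rewrite exp_Ropp; ring.
Qed.

Lemma profile_decreasing (nu a b : R) : 0 < nu < 1 / 2 -> 0 < a -> a < b -> profile nu b < profile nu a.
Proof.
  intros Hnu a0 Hab.
  destruct (MVT_cor2 (profile nu) (fun z => - Mainardi nu z) a b Hab) as [c [E Hc]].
  { intros z _; apply is_derive_Reals, (is_derive_profile nu th0 Hnu th0_range). }
  pose proof (Mainardi_pos nu th0 Hnu th0_range c ltac:(lra)). nra.
Qed.

(** [g] falls continuously from 1 to values below [1 - p], which gives a solution; strict decrease
    gives uniqueness. *)
Lemma profile_exists (nu p : R) : 0 < nu < 1 / 2 -> 0 < p < 1 -> exists! xi, 0 < xi /\ 1 - profile nu xi = p.
Proof.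
  intros Hnu Hp.
  destruct (profile_small_at_infty nu th0 Hnu th0_range (1 - p) ltac:(lra)) as [Z [Z0 HZ]].
  assert (G0 := profile_0 nu).
  specialize (HZ (Z + 1) ltac:(lra)). apply Rabs_def2 in HZ.
  destruct (IVT_gen (profile nu) 0 (Z + 1) (1 - p)) as [xi [Hxi E]].
  - intros z; apply (continuity_profile nu th0 Hnu th0_range).
  - rewrite G0, Rmin_right, Rmax_left by lra. lra.
  - rewrite Rmin_left, Rmax_right in Hxi by lra.
    assert (xi0 : 0 < xi) by (destruct (Req_dec xi 0) as [-> | Hn]; [rewrite G0 in E; lra | lra]).
    exists xi; split; [split; [auto | lra] |].
    intros y [y0 Ey].
    destruct (Rtotal_order xi y) as [H | [H | H]]; auto; exfalso.
    + pose proof (profile_decreasing nu xi y Hnu xi0 H); lra.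
    + pose proof (profile_decreasing nu y xi Hnu y0 H); lra.
Qed.

Lemma is_derive_profile_scal (nu A B k x : R) : 0 < nu < 1 / 2 ->
  is_derive (fun x => B + A * profile nu (x * k)) x (- (A * k * Mainardi nu (x * k))).
Proof.
  intros Hnu.
  evar_last.
  - apply (is_derive_plus (V := R_NormedModule) (fun _ => B)); [apply (is_derive_const (V := R_NormedModule)) |].
    apply is_derive_scal.
    apply (is_derive_comp (profile nu) (fun x => x * k)); [apply (is_derive_profile nu th0 Hnu th0_range) |].
    auto_derive; [auto | reflexivity].
  - unfold plus, zero, scal; simpl; unfold mult; simpl; ring.
Qed.

Lemma is_derive_Mainardi_scal (nu A k x : R) : 0 < nu < 1 / 2 ->
  is_derive (fun x => - (A * k * Mainardi nu (x * k))) x (A * k ^ 2 * profile_dd nu (x * k)).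
Proof.
  intros Hnu.
  evar_last.
  - apply (is_derive_opp (V := R_NormedModule)), is_derive_scal.
    apply (is_derive_comp (Mainardi nu) (fun x => x * k)); [apply (is_derive_Mainardi nu th0 Hnu th0_range) |].
    auto_derive; [auto | reflexivity].
  - unfold opp, scal; simpl; unfold mult; simpl; ring.
Qed.

Theorem theorem4 (al rho k c Tm T0 q0 : R) :
  0 < al < 1 -> 0 < rho -> 0 < k -> 0 < c -> Tm < T0 -> 0 < q0 ->
  sqrt (rho * c * k) * (T0 - Tm) / (q0 * Gamma (1 - al / 2)) < 1 ->
  (exists! xi, 0 < xi /\
     1 - Wright (- xi) (- (al / 2)) 1
       = sqrt (rho * c * k) * (T0 - Tm) / (q0 * Gamma (1 - al / 2))) /\
  (forall xi, 0 < xi ->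
     1 - Wright (- xi) (- (al / 2)) 1
       = sqrt (rho * c * k) * (T0 - Tm) / (q0 * Gamma (1 - al / 2)) ->
     let lam := sqrt (k / (rho * c)) in
     let F4 := fun x => x * (1 - Wright (- x) (- (al / 2)) 1) / Mainardi (al / 2) x in
     let ell := c * (T0 - Tm) * Gamma (1 - al / 2)
                / (Gamma (1 + al / 2) * F4 xi) in
     let T := fun x t => T0 - (T0 - Tm) / (1 - Wright (- xi) (- (al / 2)) 1)
                * (1 - Wright (- (x / (lam * Rpower t (al / 2)))) (- (al / 2)) 1) in
     let s := fun t => lam * xi * tpow t (al / 2) in
     stefan_case2_solution al rho k c ell Tm T0 q0 T s).
Proof.
  intros Hal Hrho Hk Hc HT Hq Hp.
  assert (Eal : al = 2 * (al / 2)) by field.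
  assert (Hnu : 0 < al / 2 < 1 / 2) by lra.
  revert Hp; set (nu := al / 2) in *; intros Hp.
  assert (G1 := Gamma_pos (1 - nu) ltac:(lra)). assert (G2 := Gamma_pos (1 + nu) ltac:(lra)).
  assert (rc : 0 < rho * c) by (apply Rmult_lt_0_compat; auto).
  set (sq := sqrt (rho * c * k)) in *.
  assert (sq0 : 0 < sq) by (apply sqrt_lt_R0, Rmult_lt_0_compat; auto).
  set (p := sq * (T0 - Tm) / (q0 * Gamma (1 - nu))) in *.
  assert (p0 : 0 < p).
  { apply Rdiv_lt_0_compat; apply Rmult_lt_0_compat; lra. }
  split; [exact (profile_exists nu p Hnu (conj p0 Hp)) |].
  intros xi xi0 Exi lam F4 ell T s.
  change (1 - profile nu xi = p) in Exi.
  assert (lam0 : 0 < lam) by (apply sqrt_lt_R0, Rdiv_lt_0_compat; auto).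
  assert (lam2 : lam * lam = k / (rho * c)).
  { apply sqrt_sqrt, Rlt_le, Rdiv_lt_0_compat; auto. }
  (* This identity links the coefficient in the equation for [xi] to the diffusivity, and is what
     makes the flux at [x = 0] come out right. *)
  assert (sqlam : sq * lam = k).
  { unfold sq, lam; rewrite <- sqrt_mult; [| apply Rlt_le, Rmult_lt_0_compat; auto | apply Rlt_le, Rdiv_lt_0_compat; auto].
    replace (rho * c * k * (k / (rho * c))) with (k * k) by (field; lra). apply sqrt_square; lra. }
  assert (M0 := Mainardi_pos nu th0 Hnu th0_range xi xi0).
  set (A := (T0 - Tm) / p).
  assert (ET : forall x t, T x t = (T0 - A) + A * profile nu (x * (exp (- (nu * ln t)) / lam))).
  { intros x t; unfold T. change (1 - Wright (- xi) (- nu) 1) with (1 - profile nu xi). rewrite Exi.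
    replace (- (x / (lam * Rpower t nu))) with (- (x * (exp (- (nu * ln t)) / lam))).
    - change (Wright (- (x * (exp (- (nu * ln t)) / lam))) (- nu) 1)
        with (profile nu (x * (exp (- (nu * ln t)) / lam))). unfold A; ring.
    - unfold Rpower; rewrite exp_Ropp; field. split; [apply Rgt_not_eq, exp_pos | lra]. }
  assert (EF : F4 xi = xi * p / Mainardi nu xi).
  { unfold F4; change (1 - Wright (- xi) (- nu) 1) with (1 - profile nu xi); rewrite Exi; reflexivity. }
  assert (Dx : forall x t, is_derive (fun x => T x t) x
     (- (A * (exp (- (nu * ln t)) / lam) * Mainardi nu (x * (exp (- (nu * ln t)) / lam))))).
  { intros x t; eapply is_derive_ext; [intros y; symmetry; apply ET |].
    apply is_derive_profile_scal; auto. }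
  (* Along the free boundary the similarity variable is constantly [xi], so the conditions there
     reduce to identities at [xi]. *)
  assert (Es : forall t, 0 < t -> s t * (exp (- (nu * ln t)) / lam) = xi).
  { intros t Ht; unfold s; rewrite tpow_pos, exp_Ropp by auto.
    assert (E := exp_pos (nu * ln t)). field; lra. }
  assert (s0 : s 0 = 0).
  { unfold s, tpow; destruct (Rlt_dec 0 0); [lra | ring]. }
  assert (sT : forall x, 0 < x -> ext_temp T s Tm x 0 = Tm).
  { intros x Hx; unfold ext_temp; rewrite s0; destruct (Rlt_dec x 0); [lra | reflexivity]. }
  split; [| split; [| split; [| split; [| split; [| split; [| split; [| split]]]]]]]; auto.
  (* Positivity of the latent heat rests on [Mainardi nu xi > 0]. *)
  - unfold ell; rewrite EF. apply Rdiv_lt_0_compat.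
    + apply Rmult_lt_0_compat; [apply Rmult_lt_0_compat; lra | auto].
    + apply Rmult_lt_0_compat; auto. apply Rdiv_lt_0_compat; auto. apply Rmult_lt_0_compat; auto.
  - intros x t Ht Hx.
    set (kap := exp (- (nu * ln t)) / lam).
    exists (A * (exp (- (2 * nu * ln t)) * profile_dd nu (x * kap))), (A * kap ^ 2 * profile_dd nu (x * kap)).
    split; [| split; [| split]].
    + assert (Ef : (fun tau => T x tau) = (fun tau => (T0 - A) + A * profile nu (sim nu (x / lam) tau))).
      { apply FunctionalExtensionality.functional_extensionality; intros tau.
        rewrite ET; unfold sim; do 3 f_equal; field; lra. }
      rewrite Ef, Eal. replace (x * kap) with (sim nu (x / lam) t) by (unfold sim, kap; field; lra).
      apply is_caputo_profile; auto. apply Rdiv_lt_0_compat; lra.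
    + apply filter_forall; intros y; eexists; apply Dx.
    + change (is_derive (Derive (fun y => T y t)) x (A * kap ^ 2 * profile_dd nu (x * kap))).
      apply (is_derive_ext (fun x => - (A * kap * Mainardi nu (x * kap)))).
      * intros y; symmetry; apply is_derive_unique, Dx.
      * apply is_derive_Mainardi_scal; auto.
    (* Both sides are multiples of the same value [profile_dd]; they agree because
       [(lam * kap)^2 = t^(- 2 nu)] and [lam^2 = k / (rho * c)]. *)
    + replace (exp (- (2 * nu * ln t))) with (lam * lam * kap ^ 2).
      * rewrite lam2; ring.
      * unfold kap. transitivity (exp (- (nu * ln t)) * exp (- (nu * ln t))); [field; lra |].
        rewrite <- exp_plus; f_equal; ring.
  - intros t Ht. apply (is_lim_ext_loc (fun _ => Tm)); [| apply is_lim_const].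
    exists (s t); intros x Hx; unfold ext_temp; destruct (Rlt_dec x (s t)); [lra | reflexivity].
  - intros t Ht; rewrite ET, Es by auto.
    replace (profile nu xi) with (1 - p) by lra. unfold A; field; lra.
  - intros t Ht. set (kap := exp (- (nu * ln t)) / lam).
    exists (- (A * kap * Mainardi nu (s t * kap))).
    exists (lam * xi * (Gamma (1 + nu) / Gamma (1 - nu)) * exp (- (nu * ln t))).
    split; [apply Dx | split].
    + rewrite Eal; apply is_caputo_tpow; auto.
    (* Both sides carry the factor [t^(- nu)]; [ell] is exactly the value that equates the remaining
       constants. *)
    + unfold kap; rewrite Es by auto. unfold ell; rewrite EF; unfold A.
      replace k with (lam * lam * (rho * c)) by (rewrite lam2; field; lra).
      field; repeat split; lra.
  - intros t Ht; rewrite ET, Rmult_0_l, profile_0; ring.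
  - intros t Ht. eexists; split; [apply Dx |].
    (* At the wall [M_nu 0 = 1 / Gamma (1 - nu)], which cancels the Gamma factor in [p]; the
       temperature difference cancels too and [q0] remains. *)
    rewrite Rmult_0_l. unfold Mainardi; rewrite Ropp_0, Wright_0, rgamma_pos by lra.
    unfold A, p; rewrite exp_Ropp; unfold Rpower; fold nu.
    rewrite <- sqlam. assert (E := exp_pos (nu * ln t)). field; repeat split; lra.
Qed.
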